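(* (1) Let $S$ be any subset of $\{e,c,i,o\}$, and let $\mathsf{L}$ be $\mathsf{FL_S}$ or the logic of any one of the sequent calculi $\mathbf{RL},\mathbf{CyFL},\mathbf{DFL},\mathbf{P_nFL},\mathbf{psBL},\mathbf{HA},\mathbf{DRL},\mathbf{IRL},\mathbf{CRL},\mathbf{GBH},\mathbf{Br}$. Then the number of lines of every proof of $\Theta^*_n$ in $\mathsf{L}-\mathbf{F}$ is exponential in $n$, and every proof of $\Theta^*_n$ in $\mathsf{L}-\mathbf{EF}$ has length exponential in $n$. (2) Let $\mathsf{L}$ be $\mathsf{BPC}$ or $\mathsf{EBPC}$ and let $\mathsf{M}$ be a super-intuitionistic logic of infinite branching with a Frege system (e.g. $\mathsf{M}=\mathsf{IPC}$). Then the number of lines of every proof of $(\Theta^*_n)^t$ in any $\mathsf{L}-\mathbf{F}$ system with respect to $\mathsf{M}$ is exponential in $n$, and every proof of $(\Theta^*_n)^t$ in any $\mathsf{L}-\mathbf{EF}$ system with respect to $\mathsf{M}$ has length exponential in $n$.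
   Context: **Convention.** ''Exponential in $n$'' means bounded below by $2^{n^{\Omega(1)}}$, i.e. there is $\varepsilon>0$ (depending on the systems but not on $n$) such that the quantity is at least $2^{n^{\varepsilon}}$ for all sufficiently large $n$. The length of a proof is its number of symbols. Languages: $\mathcal{L}^*=\{\wedge,\vee,*,\setminus,/,1,0\}$, $\mathcal{L}=\{\wedge,\vee,\to,\top,\bot\}$. The logic of a sequent calculus $\mathbf{S}$ is $\mathsf{S}=\{\phi:\ (\Rightarrow\phi)\text{ is provable in }\mathbf{S}\}$. **The calculus $\mathbf{FL}$** over $\mathcal{L}^*$. Sequents $\Gamma\Rightarrow\Delta$, with $\Gamma$ a finite sequence of formulas and $\Delta$ empty or a single formula. Initial sequents: $\phi\Rightarrow\phi$; $\Rightarrow 1$; $0\Rightarrow$. Rules (premises / conclusion): (cut) $\Gamma\Rightarrow\phi$ and $\Sigma,\phi,\Pi\Rightarrow\Delta$ / $\Sigma,\Gamma,\Pi\Rightarrow\Delta$; $(1w)$ $\Gamma,\Sigma\Rightarrow\Delta$ / $\Gamma,1,\Sigma\Rightarrow\Delta$; $(0w)$ $\Gamma\Rightarrow$ / $\Gamma\Rightarrow 0$; $(L\wedge)$ $\Gamma,\phi,\Sigma\Rightarrow\Delta$ (or $\Gamma,\psi,\Sigma\Rightarrow\Delta$) / $\Gamma,\phi\wedge\psi,\Sigma\Rightarrow\Delta$; $(R\wedge)$ $\Gamma\Rightarrow\phi$ and $\Gamma\Rightarrow\psi$ / $\Gamma\Rightarrow\phi\wedge\psi$; $(L\vee)$ $\Gamma,\phi,\Sigma\Rightarrow\Delta$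 and $\Gamma,\psi,\Sigma\Rightarrow\Delta$ / $\Gamma,\phi\vee\psi,\Sigma\Rightarrow\Delta$; $(R\vee)$ $\Gamma\Rightarrow\phi$ (or $\Gamma\Rightarrow\psi$) / $\Gamma\Rightarrow\phi\vee\psi$; $(L* )$ $\Gamma,\phi,\psi,\Sigma\Rightarrow\Delta$ / $\Gamma,\phi*\psi,\Sigma\Rightarrow\Delta$; $(R* )$ $\Gamma\Rightarrow\phi$ and $\Sigma\Rightarrow\psi$ / $\Gamma,\Sigma\Rightarrow\phi*\psi$; $(L/)$ $\Gamma\Rightarrow\phi$ and $\Pi,\psi,\Sigma\Rightarrow\delta$ / $\Pi,\psi/\phi,\Gamma,\Sigma\Rightarrow\delta$; $(R/)$ $\Gamma,\phi\Rightarrow\psi$ / $\Gamma\Rightarrow\psi/\phi$; $(L\setminus)$ $\Gamma\Rightarrow\phi$ and $\Pi,\psi,\Sigma\Rightarrow\delta$ / $\Pi,\Gamma,\phi\setminus\psi,\Sigma\Rightarrow\delta$; $(R\setminus)$ $\phi,\Gamma\Rightarrow\psi$ / $\Gamma\Rightarrow\phi\setminus\psi$. **$\mathbf{FL_S}$**: $\mathbf{FL}$ plus the structural rules named in $S$: $(e)$ $\Gamma,\phi,\psi,\Sigma\Rightarrow\Delta$ / $\Gamma,\psi,\phi,\Sigma\Rightarrow\Delta$; $(c)$ $\Gamma,\phi,\phi,\Sigma\Rightarrow\Delta$ / $\Gamma,\phi,\Sigma\Rightarrow\Delta$; $(i)$ $\Gamma,\Sigma\Rightarrow\Delta$ / $\Gamma,\phi,\Sigma\Rightarrow\Delta$;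 $(o)$ $\Gamma\Rightarrow$ / $\Gamma\Rightarrow\phi$. Also $w=i+o$. **Other calculi.** $\phi\Leftrightarrow\psi$ stands for both $\phi\Rightarrow\psi$ and $\psi\Rightarrow\phi$; $\mathbf{S}+\mathcal{I}$ adds the (schematic) sequents $\mathcal{I}$ as initial sequents; $\phi^1=\phi$, $\phi^{n+1}=\phi*\phi^n$. $\mathbf{RL}=\mathbf{FL}+(0\Leftrightarrow1)$; $\mathbf{CyFL}=\mathbf{FL}+(\phi\setminus0\Leftrightarrow0/\phi)$; $\mathbf{DFL}=\mathbf{FL}+(\phi\wedge(\psi\vee\theta)\Leftrightarrow(\phi\wedge\psi)\vee(\phi\wedge\theta))$; $\mathbf{P_nFL}=\mathbf{FL}+(\phi^n\Leftrightarrow\phi^{n+1})$ (for a fixed $n$); $\mathbf{psBL}=\mathbf{FL_w}+\{\phi\wedge\psi\Leftrightarrow\phi*(\phi\setminus\psi),\ \phi\wedge\psi\Leftrightarrow(\psi/\phi)*\phi\}$; $\mathbf{HA}=\mathbf{FL_w}+(\phi\Leftrightarrow\phi^2)$; $\mathbf{DRL}=\mathbf{RL}+(\phi\wedge(\psi\vee\theta)\Leftrightarrow(\phi\wedge\psi)\vee(\phi\wedge\theta))$; $\mathbf{IRL}=\mathbf{RL}+(\phi\Rightarrow1)$; $\mathbf{CRL}=\mathbf{RL}+(\phi*\psi\Leftrightarrow\psi*\phi)$; $\mathbf{GBH}=\mathbf{RL}+\{\phi\wedge\psi\Leftrightarrow\phi*(\phi\setminus\psi),\ \phi\wedge\psi\Leftrightarrow(\psi/\phi)*\phi\}$;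 $\mathbf{Br}=\mathbf{RL}+(\phi\wedge\psi\Leftrightarrow\phi*\psi)$. All the corresponding logics $\mathsf L$ are substructural logics; for them $\Upsilon\vdash_{\mathsf L}\phi$ means that $(\Rightarrow\phi)$ is provable in $\mathbf{FL}$ with the extra initial sequents $\Rightarrow\gamma$ for $\gamma\in\Upsilon\cup\mathsf{L}$. **The calculi $\mathbf{BPC}$ and $\mathbf{EBPC}$** over $\mathcal{L}$. Sequents $\Upsilon\Rightarrow\Xi$ with $\Upsilon,\Xi$ finite multisets. Initial sequents of $\mathbf{BPC}$: $\Upsilon,\phi\Rightarrow\phi,\Xi$; $\Upsilon\Rightarrow\top,\Xi$; $\Upsilon,\bot\Rightarrow\Xi$. Rules: $(L\wedge)$ $\phi,\psi,\Upsilon\Rightarrow\Xi$ / $\phi\wedge\psi,\Upsilon\Rightarrow\Xi$; $(R\wedge)$ $\Upsilon\Rightarrow\Xi,\phi$ and $\Upsilon\Rightarrow\Xi,\psi$ / $\Upsilon\Rightarrow\Xi,\phi\wedge\psi$; $(L\vee)$ $\phi,\Upsilon\Rightarrow\Xi$ and $\psi,\Upsilon\Rightarrow\Xi$ / $\phi\vee\psi,\Upsilon\Rightarrow\Xi$; $(R\vee)$ $\Upsilon\Rightarrow\Xi,\phi,\psi$ / $\Upsilon\Rightarrow\Xi,\phi\vee\psi$; $(R\to)$ $\phi,\Upsilon\Rightarrow\psi$ / $\Upsilon\Rightarrow\Xi,\phi\to\psi$; $(D)$ $\phi\wedge\psi,\Upsilon\Rightarrow\Xi$ and $\phi\wedge\theta,\Upsilon\Rightarrow\Xi$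 / $\phi\wedge(\psi\vee\theta),\Upsilon\Rightarrow\Xi$; $(Tr)$ $\Upsilon\Rightarrow\phi\to\psi$ and $\Upsilon\Rightarrow\psi\to\theta$ / $\Upsilon\Rightarrow\Xi,\phi\to\theta$; $(F\wedge)$ $\Upsilon\Rightarrow\phi\to\psi$ and $\Upsilon\Rightarrow\phi\to\theta$ / $\Upsilon\Rightarrow\Xi,\phi\to(\psi\wedge\theta)$; $(F\vee)$ $\Upsilon\Rightarrow\phi\to\theta$ and $\Upsilon\Rightarrow\psi\to\theta$ / $\Upsilon\Rightarrow\Xi,(\phi\vee\psi)\to\theta$; (cut) $\Upsilon_1\Rightarrow\phi,\Xi_1$ and $\Upsilon_2,\phi\Rightarrow\Xi_2$ / $\Upsilon_1,\Upsilon_2\Rightarrow\Xi_1,\Xi_2$. $\mathbf{EBPC}$ is $\mathbf{BPC}$ plus the initial sequent $\top\to\bot\Rightarrow\bot$. For $\mathsf{L}\in\{\mathsf{BPC},\mathsf{EBPC}\}$, $\Upsilon\vdash_{\mathsf L}\phi$ means $(\Rightarrow\phi)$ is provable in the calculus with the extra initial sequents $\Rightarrow\gamma$, $\gamma\in\Upsilon$. **Super-intuitionistic logics.** A consequence relation $\vdash_{\mathsf M}$ is a relation between sets of formulas and formulas that is closed under substitution, reflexive, transitive (cut-closed) and finitary; its logic is $\{\phi:\ \vdash_{\mathsf M}\phi\}$. It is super-intuitionistic if it is over $\mathcal{L}$ and closed under the initial sequents and rules of the standard intuitionistic calculus $\mathbf{LJ}$, reading $\Upsilon\Rightarrow\Xi$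 as $\Upsilon\vdash_{\mathsf M}\bigvee\Xi$. $\mathsf{IPC}$ is intuitionistic logic. $\mathsf{T_k}$ is the super-intuitionistic logic axiomatized over $\mathsf{IPC}$ by $\bigwedge_{i=0}^{k}\big((p_i\to\bigvee_{j\ne i}p_j)\to\bigvee_j p_j\big)\to\bigvee_i p_i$. $\mathsf M$ has branching $k$ if $\mathsf{T_k}\subseteq\mathsf{M}$; it has infinite branching if it has branching $k$ for no $k$. **Frege systems.** An inference system is given by a set of rules $\phi_1,\dots,\phi_m\,/\,\phi$ ($m\ge 0$); a proof of $\phi$ from a set $X$ is a sequence of formulas (lines) ending in $\phi$, each in $X$ or derived from earlier ones by a substitution instance of a rule. For logics $\mathsf{L}\subseteq\mathsf{M}$, it is a Frege system for $\mathsf L$ with respect to $\mathsf M$ ($\mathsf{L}-\mathbf{F}$ system wrt $\mathsf M$) if it has finitely many rules, is sound (provable formulas are in $\mathsf L$), strongly complete ($\phi_1,\dots,\phi_n\vdash_{\mathsf L}\phi$ implies $\phi$ is derivable from $\phi_1,\dots,\phi_n$), and every rule $\phi_1,\dots,\phi_m/\phi$ satisfies $\phi_1,\dots,\phi_m\vdash_{\mathsf M}\phi$. When $\mathsf M=\mathsf L$ it is called a Frege system for $\mathsf L$. An extended Frege system ($\mathsf{L}-\mathbf{EF}$, possibly wrt $\mathsf M$) is a Frege system together with the extension axiom: one may add a line $p\equiv\phi$, where $p$ is a variable not occurring in $\phi$, in any earlier line, in any hypothesis, or in the last line; $p\equiv\phi$ is $(p\setminus\phi)\wedge(\phi\setminus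 p)$ in the substructural case and $(p\to\phi)\wedge(\phi\to p)$ over $\mathcal{L}$. In (1), $\mathsf{L}-\mathbf{F}$ and $\mathsf{L}-\mathbf{EF}$ denote any Frege, resp. extended Frege, system for $\mathsf L$ (unique up to a constant factor in lines, resp. polynomial equivalence). **Translation $t$** from $\mathcal{L}^*$ to $\mathcal{L}$: $p^t=p$, $0^t=\bot$, $1^t=\top$, $(\phi\circ\psi)^t=\phi^t\circ\psi^t$ for $\circ\in\{\wedge,\vee\}$, $(\phi*\psi)^t=\phi^t\wedge\psi^t$, $(\psi/\phi)^t=(\phi\setminus\psi)^t=\phi^t\to\psi^t$. **The formulas.** For $1\le k\le n$ use variables $p_{i,j},q_{i,j}$ ($0\le i,j<n$), $s_{i,l},s'_{i,l}$ ($0\le i<n$, $0\le l<k$), $r_{i,l},r'_{i,l}$ ($0\le i<n$, $0\le l<k+1$), and put $$\alpha^k_n(\bar p,\bar s,\bar s'):=\bigvee_{i<n}\bigwedge_{l<k}s'_{i,l}\ \vee\bigvee_{i,j<n}\bigvee_{l<k}(s_{i,l}\wedge s_{j,l}\wedge p_{i,j}),$$ $$\beta^{k+1}_n(\bar q,\bar r,\bar r'):=\bigvee_{l<k+1}\bigwedge_{i<n}r'_{i,l}\ \vee\bigvee_{i,j<n}\bigvee_{l<m<k+1}(r_{i,l}\wedge r_{j,m}\wedge q_{i,j}).$$ With $\bigotimes$ denoting iterated fusion $*$ in lexicographic order of the indices, $$\Theta^*_{n,k}:=\Big[\bigotimes_{i,j<n}((p_{i,j}\wedge1)\vee(q_{i,j}\wedge1))\Big]\setminus\Big(\Big[\bigotimes_{i<n,\,l<k}((s_{i,l}\wedge1)\vee(s'_{i,l}\wedge1))\setminus\alpha^k_n\Big]\vee\Big[\bigotimes_{i<n,\,l<k+1}((r_{i,l}\wedge1)\vee(r'_{i,l}\wedge1))\setminus\beta^{k+1}_n\Big]\Big),$$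 and $\Theta^*_n:=\Theta^*_{n,\lfloor\sqrt n\rfloor}$. *)

(* Defs.v *)
From Stdlib Require Import Arith List Permutation Reals.
Import ListNotations.

(* One countably infinite stock of variables shared by both languages; the
   six families are the ones the formulas below are written in.  Indices are
   unrestricted, so there are always infinitely many fresh variables. *)
Inductive var : Set :=
| vp (i j : nat) | vq (i j : nat)
| vs (i l : nat) | vs' (i l : nat)
| vr (i l : nat) | vr' (i l : nat).

Inductive derivable {Seq : Type} (ax : Seq -> Prop)
    (rule : list Seq -> Seq -> Prop) : Seq -> Prop :=
| d_ax s : ax s -> derivable ax rule s
| d_rule prems s : rule prems s ->
    (forall s', In s' prems -> derivable ax rule s') -> derivable ax rule s.

Definition closed_under {Seq : Type} (ax : Seq -> Prop)
    (rule : list Seq -> Seq -> Prop) (Q : Seq -> Prop) : Prop :=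
  (forall s, ax s -> Q s) /\
  (forall prems s, rule prems s -> (forall s', In s' prems -> Q s') -> Q s).

Definition nothing {A : Type} : A -> Prop := fun _ => False.
Definition elems {A : Type} (l : list A) : A -> Prop := fun x => In x l.

(* a1 op (a2 op (... op am)); the unit [e] is used for the empty list only. *)
Fixpoint big {A : Type} (op : A -> A -> A) (e : A) (l : list A) : A :=
  match l with
  | [] => e
  | [a] => a
  | a :: l' => op a (big op e l')
  end.

(* [pf n x]: x is a proof of the n-th formula. *)
Definition exponential {A : Type} (pf : nat -> A -> Prop) (cost : A -> nat)
    : Prop :=
  exists eps : R, (0 < eps)%R /\
  exists N : nat, forall (n : nat) (x : A), N <= n -> pf n x ->
    (Rpower 2 (Rpower (INR n) eps) <= INR (cost x))%R.

Record language : Type := Language {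
  form :> Type;
  subst : (var -> form) -> form -> form;
  occurs : var -> form -> Prop;
  size : form -> nat;                (* number of symbols; no parentheses *)
  ext_axiom : var -> form -> form    (* the equivalence p ≡ phi *)
}.
Arguments subst {_} _ _.
Arguments occurs {_} _ _.
Arguments size {_} _.
Arguments ext_axiom {_} _ _.

Definition consequence (F : language) : Type := (F -> Prop) -> F -> Prop.

Record logic (F : language) : Type := Logic {
  thm : F -> Prop;
  ent : consequence F
}.
Arguments Logic {F} _ _.
Arguments thm {F} _ _.
Arguments ent {F} _ _ _.

Definition logic_of {F : language} (vd : consequence F) : logic F :=
  Logic (vd nothing) vd.

Record frule (F : language) : Type := FRule { fprems : list F; fconcl : F }.
Arguments fprems {F} _.
Arguments fconcl {F} _.

Definition inference_system (F : language) : Type := frule F -> Prop.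

Definition inferred {F : language} (P : inference_system F)
    (earlier : list F) (A : F) : Prop :=
  exists (r : frule F) (sigma : var -> F),
    P r /\ A = subst sigma (fconcl r) /\
    forall B, In B (fprems r) -> In (subst sigma B) earlier.

Definition ends_in {A : Type} (pi : list A) (a : A) : Prop :=
  exists l, pi = l ++ [a].

Definition is_proof {F : language} (P : inference_system F) (X : F -> Prop)
    (pi : list F) (phi : F) : Prop :=
  ends_in pi phi /\
  forall l A l', pi = l ++ A :: l' -> X A \/ inferred P l A.

Definition is_extension {F : language} (X : F -> Prop) (earlier : list F)
    (last_line A : F) : Prop :=
  exists (p : var) (psi : F),
    A = ext_axiom p psi /\ ~ occurs p psi /\
    (forall B, In B earlier -> ~ occurs p B) /\
    (forall B, X B -> ~ occurs p B) /\
    ~ occurs p last_line.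

Definition is_ext_proof {F : language} (P : inference_system F)
    (X : F -> Prop) (pi : list F) (phi : F) : Prop :=
  ends_in pi phi /\
  forall l A l', pi = l ++ A :: l' ->
    X A \/ inferred P l A \/ is_extension X l phi A.

Definition lines {F : language} (pi : list F) : nat := length pi.
Definition symbols {F : language} (pi : list F) : nat :=
  list_sum (map size pi).

Definition finitely_many_rules {F : language} (P : inference_system F) : Prop :=
  exists rs : list (frule F), forall r, P r <-> In r rs.

Definition sound {F : language} (L : logic F) (P : inference_system F) : Prop :=
  forall pi phi, is_proof P nothing pi phi -> thm L phi.

Definition strongly_complete {F : language} (L : logic F)
    (P : inference_system F) : Prop :=
  forall (phis : list F) (phi : F), ent L (elems phis) phi ->
    exists pi, is_proof P (elems phis) pi phi.

(* The inclusion of L in M is not imposed separately: it holds automatically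
   wherever this is used (M = L, or (E)BPC below a super-intuitionistic M). *)
Definition frege_wrt {F : language} (L M : logic F) (P : inference_system F)
    : Prop :=
  finitely_many_rules P /\ sound L P /\ strongly_complete L P /\
  forall r, P r -> ent M (elems (fprems r)) (fconcl r).

Definition frege {F : language} (L : logic F) : inference_system F -> Prop :=
  frege_wrt L L.

Inductive sform : Type :=
| SVar (x : var) | SZero | SOne
| SAnd (A B : sform) | SOr (A B : sform) | SFus (A B : sform)
| SUnder (A B : sform)   (* A \ B *)
| SOver (B A : sform).   (* B / A *)

Declare Scope sform_scope.
Delimit Scope sform_scope with sf.
Bind Scope sform_scope with sform.
Notation "A ∧ B" := (SAnd A B) (at level 80, right associativity) : sform_scope.
Notation "A ∨ B" := (SOr A B) (at level 85, right associativity) : sform_scope.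
Notation "A * B" := (SFus A B) : sform_scope.
Notation "A \ B" := (SUnder A B) (at level 88, no associativity) : sform_scope.
Notation "B / A" := (SOver B A) : sform_scope.
Notation "1" := SOne : sform_scope.
Notation "0" := SZero : sform_scope.

Fixpoint ssubst (sigma : var -> sform) (A : sform) : sform :=
  match A with
  | SVar x => sigma x
  | SZero => SZero
  | SOne => SOne
  | SAnd A B => SAnd (ssubst sigma A) (ssubst sigma B)
  | SOr A B => SOr (ssubst sigma A) (ssubst sigma B)
  | SFus A B => SFus (ssubst sigma A) (ssubst sigma B)
  | SUnder A B => SUnder (ssubst sigma A) (ssubst sigma B)
  | SOver A B => SOver (ssubst sigma A) (ssubst sigma B)
  end.

Fixpoint soccurs (x : var) (A : sform) : Prop :=
  match A with
  | SVar y => x = y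
  | SZero | SOne => False
  | SAnd A B | SOr A B | SFus A B | SUnder A B | SOver A B =>
      soccurs x A \/ soccurs x B
  end.

Fixpoint ssize (A : sform) : nat :=
  match A with
  | SVar _ | SZero | SOne => 1
  | SAnd A B | SOr A B | SFus A B | SUnder A B | SOver A B =>
      S (ssize A + ssize B)
  end.

Definition Lstar : language :=
  Language sform ssubst soccurs ssize
    (fun p phi => (SVar p \ phi) ∧ (phi \ SVar p))%sf.

Definition ssequent : Type := list sform * option sform.

Declare Scope seq_scope.
Delimit Scope seq_scope with seq.
Notation "G ⇒ D" := (G, D) (at level 90, no associativity) : seq_scope.

Inductive structural : Set := exch | contr | iweak | oweak.

Inductive FL_init : ssequent -> Prop :=
| FL_id phi : FL_init ([phi] ⇒ Some phi)%seq
| FL_one : FL_init ([] ⇒ Some SOne)%seq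
| FL_zero : FL_init ([SZero] ⇒ None)%seq.

Inductive FL_rule (S : structural -> Prop) : list ssequent -> ssequent -> Prop :=
| FL_cut G Sg Pi phi D : FL_rule S
    [G ⇒ Some phi; Sg ++ phi :: Pi ⇒ D]%seq (Sg ++ G ++ Pi ⇒ D)%seq
| FL_1w G Sg D : FL_rule S
    [G ++ Sg ⇒ D]%seq (G ++ SOne :: Sg ⇒ D)%seq
| FL_0w G : FL_rule S
    [G ⇒ None]%seq (G ⇒ Some SZero)%seq
| FL_Land1 G Sg phi psi D : FL_rule S
    [G ++ phi :: Sg ⇒ D]%seq (G ++ (phi ∧ psi)%sf :: Sg ⇒ D)%seq
| FL_Land2 G Sg phi psi D : FL_rule S
    [G ++ psi :: Sg ⇒ D]%seq (G ++ (phi ∧ psi)%sf :: Sg ⇒ D)%seq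
| FL_Rand G phi psi : FL_rule S
    [G ⇒ Some phi; G ⇒ Some psi]%seq (G ⇒ Some (phi ∧ psi)%sf)%seq
| FL_Lor G Sg phi psi D : FL_rule S
    [G ++ phi :: Sg ⇒ D; G ++ psi :: Sg ⇒ D]%seq
    (G ++ (phi ∨ psi)%sf :: Sg ⇒ D)%seq
| FL_Ror1 G phi psi : FL_rule S
    [G ⇒ Some phi]%seq (G ⇒ Some (phi ∨ psi)%sf)%seq
| FL_Ror2 G phi psi : FL_rule S
    [G ⇒ Some psi]%seq (G ⇒ Some (phi ∨ psi)%sf)%seq
| FL_Lfus G Sg phi psi D : FL_rule S
    [G ++ phi :: psi :: Sg ⇒ D]%seq (G ++ (phi * psi)%sf :: Sg ⇒ D)%seq
| FL_Rfus G Sg phi psi : FL_rule S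
    [G ⇒ Some phi; Sg ⇒ Some psi]%seq (G ++ Sg ⇒ Some (phi * psi)%sf)%seq
| FL_Lover G Pi Sg phi psi D : FL_rule S
    [G ⇒ Some phi; Pi ++ psi :: Sg ⇒ D]%seq
    (Pi ++ (psi / phi)%sf :: G ++ Sg ⇒ D)%seq
| FL_Rover G phi psi : FL_rule S
    [G ++ [phi] ⇒ Some psi]%seq (G ⇒ Some (psi / phi)%sf)%seq
| FL_Lunder G Pi Sg phi psi D : FL_rule S
    [G ⇒ Some phi; Pi ++ psi :: Sg ⇒ D]%seq
    (Pi ++ G ++ (phi \ psi)%sf :: Sg ⇒ D)%seq
| FL_Runder G phi psi : FL_rule S
    [phi :: G ⇒ Some psi]%seq (G ⇒ Some (phi \ psi)%sf)%seq
| FL_e G Sg phi psi D : S exch -> FL_rule S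
    [G ++ phi :: psi :: Sg ⇒ D]%seq (G ++ psi :: phi :: Sg ⇒ D)%seq
| FL_c G Sg phi D : S contr -> FL_rule S
    [G ++ phi :: phi :: Sg ⇒ D]%seq (G ++ phi :: Sg ⇒ D)%seq
| FL_i G Sg phi D : S iweak -> FL_rule S
    [G ++ Sg ⇒ D]%seq (G ++ phi :: Sg ⇒ D)%seq
| FL_o G phi : S oweak -> FL_rule S
    [G ⇒ None]%seq (G ⇒ Some phi)%seq.

Record calculus : Type := Calculus {
  str : structural -> Prop;
  extra : ssequent -> Prop
}.

Definition provable (C : calculus) : ssequent -> Prop :=
  derivable (fun s => FL_init s \/ extra C s) (FL_rule (str C)).

Definition FL_ (S : structural -> Prop) : calculus := Calculus S nothing.
Definition FL : calculus := FL_ nothing.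
Definition FLw : calculus := FL_ (fun x => x = iweak \/ x = oweak).

Definition extend (C : calculus) (I : ssequent -> Prop) : calculus :=
  Calculus (str C) (fun s => extra C s \/ I s).

Definition iff_seq (A B : sform) (s : ssequent) : Prop :=
  s = ([A] ⇒ Some B)%seq \/ s = ([B] ⇒ Some A)%seq.

(* phi^1 = phi and phi^(n+1) = phi * phi^n; only exponents n >= 1 are used. *)
Fixpoint spow (phi : sform) (n : nat) : sform :=
  match n with
  | O => SOne
  | S O => phi
  | S m => (phi * spow phi m)%sf
  end.

Definition distributivity (s : ssequent) : Prop :=
  exists phi psi theta,
    iff_seq (phi ∧ (psi ∨ theta)) ((phi ∧ psi) ∨ (phi ∧ theta)) s.
Definition divisibility (s : ssequent) : Prop :=
  exists phi psi, iff_seq (phi ∧ psi) (phi * (phi \ psi)) s \/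
                  iff_seq (phi ∧ psi) ((psi / phi) * phi) s.

Definition RL : calculus := extend FL (iff_seq SZero SOne).
Definition CyFL : calculus :=
  extend FL (fun s => exists phi, iff_seq (phi \ 0) (0 / phi) s).
Definition DFL : calculus := extend FL distributivity.
Definition PFL (n : nat) : calculus :=
  extend FL (fun s => exists phi, iff_seq (spow phi n) (spow phi (S n)) s).
Definition psBL : calculus := extend FLw divisibility.
Definition HA : calculus :=
  extend FLw (fun s => exists phi, iff_seq phi (spow phi 2) s).
Definition DRL : calculus := extend RL distributivity.
Definition IRL : calculus :=
  extend RL (fun s => exists phi, s = ([phi] ⇒ Some SOne)%seq).
Definition CRL : calculus :=
  extend RL (fun s => exists phi psi, iff_seq (phi * psi) (psi * phi) s).
Definition GBH : calculus := extend RL divisibility.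
Definition Br : calculus :=
  extend RL (fun s => exists phi psi, iff_seq (phi ∧ psi) (phi * psi) s).

Inductive listed : calculus -> Prop :=
| listed_FL (S : structural -> Prop) : listed (FL_ S)
| listed_RL : listed RL
| listed_CyFL : listed CyFL
| listed_DFL : listed DFL
| listed_PFL n : 1 <= n -> listed (PFL n)
| listed_psBL : listed psBL
| listed_HA : listed HA
| listed_DRL : listed DRL
| listed_IRL : listed IRL
| listed_CRL : listed CRL
| listed_GBH : listed GBH
| listed_Br : listed Br.

(* Whatever calculus the logic comes from, consequence is provability in plain
   FL from the hypotheses and the theorems of the logic. *)
Definition substructural (C : calculus) : logic Lstar :=
  let L := fun phi => provable C ([] ⇒ Some phi)%seq in
  @Logic Lstar L (fun Ups phi =>
    provable
      (extend FL (fun s => exists g, (Ups g \/ L g) /\ s = ([] ⇒ Some g)%seq))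
      ([] ⇒ Some phi)%seq).

Inductive iform : Type :=
| IVar (x : var) | IBot | ITop
| IAnd (A B : iform) | IOr (A B : iform) | IImp (A B : iform).

Declare Scope iform_scope.
Delimit Scope iform_scope with imf.
Bind Scope iform_scope with iform.
Notation "A ∧ B" := (IAnd A B) (at level 80, right associativity) : iform_scope.
Notation "A ∨ B" := (IOr A B) (at level 85, right associativity) : iform_scope.
Notation "A → B" := (IImp A B) (at level 88, right associativity) : iform_scope.
Notation "⊤" := ITop : iform_scope.
Notation "⊥" := IBot : iform_scope.

Fixpoint isubst (sigma : var -> iform) (A : iform) : iform :=
  match A with
  | IVar x => sigma x
  | IBot => IBot
  | ITop => ITop
  | IAnd A B => IAnd (isubst sigma A) (isubst sigma B)
  | IOr A B => IOr (isubst sigma A) (isubst sigma B)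
  | IImp A B => IImp (isubst sigma A) (isubst sigma B)
  end.

Fixpoint ioccurs (x : var) (A : iform) : Prop :=
  match A with
  | IVar y => x = y
  | IBot | ITop => False
  | IAnd A B | IOr A B | IImp A B => ioccurs x A \/ ioccurs x B
  end.

Fixpoint isize (A : iform) : nat :=
  match A with
  | IVar _ | IBot | ITop => 1
  | IAnd A B | IOr A B | IImp A B => S (isize A + isize B)
  end.

Definition Limp : language :=
  Language iform isubst ioccurs isize
    (fun p phi => (IVar p → phi) ∧ (phi → IVar p))%imf.

(* Pairs of multisets, represented by lists modulo the rule [BPC_perm]. *)
Definition isequent : Type := list iform * list iform.

Inductive BPC_init : isequent -> Prop :=
| BPC_id U X phi : BPC_init (phi :: U ⇒ phi :: X)%seq
| BPC_top U X : BPC_init (U ⇒ ITop :: X)%seq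
| BPC_bot U X : BPC_init (IBot :: U ⇒ X)%seq.

Inductive EBPC_init : isequent -> Prop :=
| EBPC_BPC s : BPC_init s -> EBPC_init s
| EBPC_E : EBPC_init ([(⊤ → ⊥)%imf] ⇒ [IBot])%seq.

Inductive BPC_rule : list isequent -> isequent -> Prop :=
| BPC_perm U U' X X' : Permutation U U' -> Permutation X X' -> BPC_rule
    [U ⇒ X]%seq (U' ⇒ X')%seq
| BPC_Land U X phi psi : BPC_rule
    [phi :: psi :: U ⇒ X]%seq ((phi ∧ psi)%imf :: U ⇒ X)%seq
| BPC_Rand U X phi psi : BPC_rule
    [U ⇒ phi :: X; U ⇒ psi :: X]%seq (U ⇒ (phi ∧ psi)%imf :: X)%seq
| BPC_Lor U X phi psi : BPC_rule
    [phi :: U ⇒ X; psi :: U ⇒ X]%seq ((phi ∨ psi)%imf :: U ⇒ X)%seq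
| BPC_Ror U X phi psi : BPC_rule
    [U ⇒ phi :: psi :: X]%seq (U ⇒ (phi ∨ psi)%imf :: X)%seq
| BPC_Rimp U X phi psi : BPC_rule
    [phi :: U ⇒ [psi]]%seq (U ⇒ (phi → psi)%imf :: X)%seq
| BPC_D U X phi psi theta : BPC_rule
    [(phi ∧ psi)%imf :: U ⇒ X; (phi ∧ theta)%imf :: U ⇒ X]%seq
    ((phi ∧ (psi ∨ theta))%imf :: U ⇒ X)%seq
| BPC_Tr U X phi psi theta : BPC_rule
    [U ⇒ [(phi → psi)%imf]; U ⇒ [(psi → theta)%imf]]%seq
    (U ⇒ (phi → theta)%imf :: X)%seq
| BPC_Fand U X phi psi theta : BPC_rule
    [U ⇒ [(phi → psi)%imf]; U ⇒ [(phi → theta)%imf]]%seq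
    (U ⇒ (phi → (psi ∧ theta))%imf :: X)%seq
| BPC_For U X phi psi theta : BPC_rule
    [U ⇒ [(phi → theta)%imf]; U ⇒ [(psi → theta)%imf]]%seq
    (U ⇒ ((phi ∨ psi) → theta)%imf :: X)%seq
| BPC_cut U1 U2 X1 X2 phi : BPC_rule
    [U1 ⇒ phi :: X1; phi :: U2 ⇒ X2]%seq (U1 ++ U2 ⇒ X1 ++ X2)%seq.

Definition basic (init : isequent -> Prop) : logic Limp :=
  logic_of (F := Limp) (fun Ups phi =>
    derivable (fun s => init s \/ exists g, Ups g /\ s = ([] ⇒ [g])%seq)
      BPC_rule ([] ⇒ [phi])%seq).

Definition BPC : logic Limp := basic BPC_init.
Definition EBPC : logic Limp := basic EBPC_init.

Definition jsequent : Type := list iform * option iform.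

Inductive LJ_init : jsequent -> Prop :=
| LJ_id phi : LJ_init ([phi] ⇒ Some phi)%seq
| LJ_top : LJ_init ([] ⇒ Some ITop)%seq
| LJ_bot : LJ_init ([IBot] ⇒ None)%seq.

Inductive LJ_rule : list jsequent -> jsequent -> Prop :=
| LJ_exchange G G' D : Permutation G G' -> LJ_rule
    [G ⇒ D]%seq (G' ⇒ D)%seq
| LJ_contraction G phi D : LJ_rule
    [phi :: phi :: G ⇒ D]%seq (phi :: G ⇒ D)%seq
| LJ_Lweakening G phi D : LJ_rule
    [G ⇒ D]%seq (phi :: G ⇒ D)%seq
| LJ_Rweakening G phi : LJ_rule
    [G ⇒ None]%seq (G ⇒ Some phi)%seq
| LJ_cut G Sg phi D : LJ_rule
    [G ⇒ Some phi; phi :: Sg ⇒ D]%seq (G ++ Sg ⇒ D)%seq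
| LJ_Land1 G phi psi D : LJ_rule
    [phi :: G ⇒ D]%seq ((phi ∧ psi)%imf :: G ⇒ D)%seq
| LJ_Land2 G phi psi D : LJ_rule
    [psi :: G ⇒ D]%seq ((phi ∧ psi)%imf :: G ⇒ D)%seq
| LJ_Rand G phi psi : LJ_rule
    [G ⇒ Some phi; G ⇒ Some psi]%seq (G ⇒ Some (phi ∧ psi)%imf)%seq
| LJ_Lor G phi psi D : LJ_rule
    [phi :: G ⇒ D; psi :: G ⇒ D]%seq ((phi ∨ psi)%imf :: G ⇒ D)%seq
| LJ_Ror1 G phi psi : LJ_rule
    [G ⇒ Some phi]%seq (G ⇒ Some (phi ∨ psi)%imf)%seq
| LJ_Ror2 G phi psi : LJ_rule
    [G ⇒ Some psi]%seq (G ⇒ Some (phi ∨ psi)%imf)%seq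
| LJ_Limp G Sg phi psi D : LJ_rule
    [G ⇒ Some phi; psi :: Sg ⇒ D]%seq ((phi → psi)%imf :: G ++ Sg ⇒ D)%seq
| LJ_Rimp G phi psi : LJ_rule
    [phi :: G ⇒ Some psi]%seq (G ⇒ Some (phi → psi)%imf)%seq.

Definition IPC_plus (Ax : iform -> Prop) (phi : iform) : Prop :=
  derivable (fun s => LJ_init s \/ exists g, Ax g /\ s = ([] ⇒ Some g)%seq)
    LJ_rule ([] ⇒ Some phi)%seq.

Definition bigIAnd : list iform -> iform := big IAnd ITop.
Definition bigIOr : list iform -> iform := big IOr IBot.

(* Taken as a schema: [p] gives the formulas substituted for p_0, ..., p_k.
   An empty disjunction (only for k = 0) is bottom. *)
Definition T_axiom (k : nat) (p : nat -> iform) : iform :=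
  let ix := seq 0 (S k) in
  let all_p := bigIOr (map p ix) in
  (bigIAnd (map (fun i =>
     (p i → bigIOr (map p (filter (fun j => negb (j =? i)) ix))) → all_p) ix)
   → all_p)%imf.

Definition T_ (k : nat) : iform -> Prop :=
  IPC_plus (fun phi => exists p, phi = T_axiom k p).

Record consequence_relation {F : language} (vd : consequence F) : Prop := {
  cr_subst : forall (sigma : var -> F) X phi, vd X phi ->
    vd (fun psi => exists chi, X chi /\ psi = subst sigma chi) (subst sigma phi);
  cr_refl : forall (X : F -> Prop) phi, X phi -> vd X phi;
  cr_cut : forall (X Y : F -> Prop) phi,
    (forall psi, Y psi -> vd X psi) -> vd Y phi -> vd X phi;
  cr_fin : forall X phi, vd X phi ->
    exists l : list F, (forall psi, In psi l -> X psi) /\ vd (elems l) phi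
}.

Definition super_intuitionistic (vd : consequence Limp) : Prop :=
  consequence_relation vd /\
  closed_under LJ_init LJ_rule (fun s : jsequent =>
    vd (elems (fst s)) (match snd s with Some phi => phi | None => IBot end)).

Definition has_branching (M : logic Limp) (k : nat) : Prop :=
  forall phi, T_ k phi -> thm M phi.

Definition infinite_branching (M : logic Limp) : Prop :=
  forall k, ~ has_branching M k.

Definition p_ (i j : nat) : sform := SVar (vp i j).
Definition q_ (i j : nat) : sform := SVar (vq i j).
Definition s_ (i l : nat) : sform := SVar (vs i l).
Definition s'_ (i l : nat) : sform := SVar (vs' i l).
Definition r_ (i l : nat) : sform := SVar (vr i l).
Definition r'_ (i l : nat) : sform := SVar (vr' i l).

(* The units are never reached for 1 <= k <= n. *)
Definition bigSAnd : list sform -> sform := big SAnd SOne.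
Definition bigSOr : list sform -> sform := big SOr SZero.
Definition bigSFus : list sform -> sform := big SFus SOne.

(* All (i, j) with i < m and j < n, in lexicographic order. *)
Definition pairs (m n : nat) : list (nat * nat) :=
  list_prod (seq 0 m) (seq 0 n).

Definition alpha (n k : nat) : sform :=
  (bigSOr (map (fun i => bigSAnd (map (fun l => s'_ i l) (seq 0 k))) (seq 0 n))
   ∨ bigSOr (map (fun '(i, j) =>
       bigSOr (map (fun l => s_ i l ∧ s_ j l ∧ p_ i j) (seq 0 k))) (pairs n n)))%sf.

(* [beta n k] is beta_n^k, so that beta_n^{k+1} is [beta n (k + 1)]. *)
Definition beta (n k : nat) : sform :=
  (bigSOr (map (fun l => bigSAnd (map (fun i => r'_ i l) (seq 0 n))) (seq 0 k))
   ∨ bigSOr (map (fun '(i, j) =>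
       bigSOr (map (fun '(l, m) => r_ i l ∧ r_ j m ∧ q_ i j)
                   (filter (fun '(l, m) => l <? m) (pairs k k))))
       (pairs n n)))%sf.

Definition Theta_ (n k : nat) : sform :=
  (bigSFus (map (fun '(i, j) => (p_ i j ∧ 1) ∨ (q_ i j ∧ 1)) (pairs n n))
   \ ((bigSFus (map (fun '(i, l) => (s_ i l ∧ 1) ∨ (s'_ i l ∧ 1)) (pairs n k))
       \ alpha n k)
      ∨ (bigSFus (map (fun '(i, l) => (r_ i l ∧ 1) ∨ (r'_ i l ∧ 1))
                      (pairs n (k + 1)))
         \ beta n (k + 1))))%sf.

Definition Theta (n : nat) : sform := Theta_ n (Nat.sqrt n).

Fixpoint tr (A : sform) : iform :=
  match A with
  | SVar x => IVar x
  | SZero => IBot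
  | SOne => ITop
  | SAnd A B => IAnd (tr A) (tr B)
  | SOr A B => IOr (tr A) (tr B)
  | SFus A B => IAnd (tr A) (tr B)
  | SUnder A B => IImp (tr A) (tr B)
  | SOver B A => IImp (tr A) (tr B)
  end.

(* Main.v *)
From mathcomp Require all_boot.
Require Import Defs.
From Stdlib Require Import Arith Lia List Bool Permutation Classical Reals Lra.
From Stdlib Require Cantor.

(* Frege proofs are exponentially long because they yield monotone circuits
   separating graphs with a (k+1)-clique from k-colourable graphs.

   Models.  The substructural logics are sound for forks (a root below finitely
   many leaves); a super-intuitionistic logic of infinite branching is sound for all
   forks or for all forks with an additional greatest point.  Indeed, if an
   instance of T_k fails in the canonical model, take a maximal theory [w]
   without d = \/ p_i.  With mu = \/_{i<>j} (p_i /\ p_j), either many p_i satisfy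
   p_i -> mu \/ ~mu at [w], and the p_i /\ ~mu define the leaves of a fork, or
   many do not, and these p_i, together with mu \/ ~mu as the top, define the
   other kind of frame.

   Interpolation.  Given a proof with [m] lines and a graph [x], close the
   initial formulas given by [x] under all inferences among the instances of
   subformulas of the rules used in the proof that are valid at the leaves; this
   closure is computed by a monotone circuit of size polynomial in [m].  The
   Kleene slash relative to the closure is truth at the root of a fork whose
   leaves are countervaluations to the formulas outside the closure, so all lines
   are slashed, and one of the two disjuncts of Theta lies in the closure.

   Lower bound.  Every gate is approximated by a DNF whose monomials are small
   vertex sets and by a CNF whose clauses are small edge sets, as in the
   arguments of Berg-Ulfberg and Jukna: switching between the two loses a
   negligible fraction of the cliques and of the colourings per gate. *)

(** The formulas in a proof may be arbitrarily long, so the circuit must not depend on their size.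
    An application of a rule contributes only the instances of the finitely many subformulas of that
    rule, and which inferences among them are valid depends on the substitution only through truth
    values at the top. The cost is thus governed by the number of lines. This also settles extension
    axioms: substituting the definitions keeps the number of lines and turns every p ≡ φ into an
    instance of the single axiom p ≡ p.

    The variables q stand for non-edges, which a monotone circuit cannot read. The circuit therefore
    starts from the larger set in which all q hold; this is harmless for the first disjunct, since α
    does not mention q. If the first disjunct is missing even from that closure, it is missing from
    the closure given by the exact values of p and q, and there the slash yields the second
    disjunct.

    The substructural calculi become sound for forks once fusion is read as conjunction, both
    residuals as implication and, where 0 and 1 are equivalent, 0 as truth. *)

Definition graph : Type := nat -> nat -> bool.

(** A straight-line program, newest gate first, in which a gate is given by the function it
    computes; the size is the length of the list. *)
Inductive circuit (n : nat) : list (graph -> bool) -> Prop :=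
| circuit_nil : circuit n nil
| circuit_const l f b : circuit n l ->
    (forall x, f x = b) -> circuit n (f :: l)
| circuit_input l f i j : circuit n l -> i < n -> j < n ->
    (forall x : graph, f x = x i j) -> circuit n (f :: l)
| circuit_and l f g h : circuit n l -> In g l -> In h l ->
    (forall x, f x = andb (g x) (h x)) -> circuit n (f :: l)
| circuit_or l f g h : circuit n l -> In g l -> In h l ->
    (forall x, f x = orb (g x) (h x)) -> circuit n (f :: l).

(** Graphs need be neither symmetric nor loop-free. Only the entries with [l < m] are read, because
    these are the ones that matter for refuting β. *)
Definition has_clique (n k : nat) (x : graph) : Prop :=
  exists h : nat -> nat, (forall l, l < k -> h l < n) /\
    forall l m, l < m -> m < k -> x (h l) (h m) = true.

Definition colourable (n k : nat) (x : graph) : Prop :=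
  exists c : nat -> nat, (forall i, i < n -> c i < k) /\
    forall i j, i < n -> j < n -> x i j = true -> c i <> c j.

(** * Monotone circuits separating cliques from colourings *)

Module CliqueColouring.
Import all_boot.
Set Implicit Arguments.
Unset Strict Implicit.
Unset Printing Implicit Defensive.

Section Approximation.
Variables n k : nat.
Notation V := 'I_n.
Implicit Types (E : seq (V * V)) (X T A : {set V}) (c : {ffun V -> 'I_k}).

(* Equivalently, [u] and [v] are joined by a path of edges of [E]. *)
Definition conn E (u v : V) : bool :=
  [forall A : {set V},
     all (fun e => (e.1 \in A) == (e.2 \in A)) E ==> ((u \in A) == (v \in A))].

Lemma connP E u v :
  reflect (forall A, (forall e, e \in E -> (e.1 \in A) = (e.2 \in A)) ->
             (u \in A) = (v \in A))
          (conn E u v).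
Proof.
apply: (iffP forallP) => H A.
  move=> HA; have /implyP I := H A; apply/eqP/I/allP => e /HA ->.
  exact: eqxx.
apply/implyP => /allP HA; apply/eqP/H => e eE; exact/eqP/HA.
Qed.

(** A clause [E], read as a disjunction of edges, fails on the complete multipartite graph of [c]
    exactly when all its edges are monochromatic. On such graphs it may be replaced by its
    transitive closure, which is why only [conn] matters. *)
Definition mono E c : bool := all (fun e => c e.1 == c e.2) E.

Lemma conn_mono E c u v : mono E c -> conn E u v -> c u = c v.
Proof.
move=> /allP Hm /connP /(_ [set w | c w == c u]) H.
have : (u \in [set w | c w == c u]) = (v \in [set w | c w == c u]).
  by apply: H => e /Hm /eqP ee; rewrite !inE ee.
by rewrite !inE eqxx => /esym/eqP.
Qed.

Lemma conn_sub E E' u v : {subset E <= E'} -> conn E u v -> conn E' u v.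
Proof.
move=> sEE /connP H; apply/connP => A HA; apply: H => e /sEE; exact: HA.
Qed.

Definition ends E : seq V := map fst E ++ map snd E.

Lemma conn_ends E u v : u != v -> conn E u v -> u \in ends E.
Proof.
move=> uv /connP H; apply: contraT => nu.
suff: (u \in [set u]) = (v \in [set u]) by rewrite !inE eqxx eq_sym (negPf uv).
apply: H => e eE; rewrite !inE; move: nu; rewrite mem_cat negb_or => /andP[n1 n2].
case: eqP => [ee|_]; first by move: n1; rewrite -ee map_f.
by case: eqP => // ee; move: n2; rewrite -ee map_f.
Qed.

Lemma conn_sym E u v : conn E u v = conn E v u.
Proof. by apply/connP/connP => H A HA; rewrite (H A HA). Qed.

(** The monomial [X] says that all pairs inside [X] are edges; it implies the transitive closure of
    the clause [E] because the two share a pair. *)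
Definition hit E X : bool :=
  [exists e : V * V, [&& e.1 \in X, e.2 \in X, e.1 != e.2 & conn E e.1 e.2]].

Lemma hit_subl E E' X : {subset E <= E'} -> hit E X -> hit E' X.
Proof.
move=> sEE /existsP[e /and4P[e1 e2 ne ce]]; apply/existsP; exists e.
by rewrite e1 e2 ne (conn_sub sEE).
Qed.

Lemma hit_subr E X X' : X \subset X' -> hit E X -> hit E X'.
Proof.
move=> /subsetP sXX /existsP[e /and4P[e1 e2 ne ce]]; apply/existsP; exists e.
by rewrite !sXX // ne ce.
Qed.

Definition rainbow X c : bool :=
  [forall e : V * V, [&& e.1 \in X, e.2 \in X & e.1 != e.2] ==> (c e.1 != c e.2)].

Lemma hit_rainbow E X c : hit E X -> rainbow X c -> ~~ mono E c.
Proof.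
case/existsP=> e /and4P[e1 e2 ne ce] /forallP/(_ e)/implyP H.
apply/negP=> /conn_mono/(_ ce) /eqP; apply/negP/H.
by rewrite e1 e2.
Qed.

(** * Switching between monomials and clauses *)

Section Switching.
Variable r : nat.

Definition new_edges E : seq (V * V) :=
  [seq e <- allpairs pair (ends E) (ends E) | (e.1 != e.2) && conn E e.1 e.2].

(* Monomials grown beyond [r] vertices and clauses grown beyond [r] edges stay in
   the output: they are the errors of the approximation. *)
Fixpoint to_dnf X (Q : seq (seq (V * V))) : seq {set V} :=
  if r < #|X| then [:: X] else
  if Q is E :: Q' then
    if hit E X then to_dnf X Q' else
    flatten [seq to_dnf (X :|: [set e.1; e.2]) Q' | e <- new_edges E]
  else [:: X].

Fixpoint to_cnf E (D : seq {set V}) : seq (seq (V * V)) :=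
  if r < size E then [:: E] else
  if D is X :: D' then
    if hit E X then to_cnf E D' else
    flatten [seq to_cnf (e :: E) D' | e <- [seq e <- allpairs pair (enum X) (enum X) | e.1 != e.2]]
  else [:: E].

Lemma size_flatten_map_le (A B : eqType) (f : A -> seq B) (p : pred B) (s : seq A) m :
  (forall a, a \in s -> size (filter p (f a)) <= m) ->
  size (filter p (flatten (map f s))) <= size s * m.
Proof.
elim: s => //= a s IH H; rewrite filter_cat size_cat mulSn leq_add //.
  by apply: H; rewrite mem_head.
by apply: IH => b bs; apply: H; rewrite inE bs orbT.
Qed.

Lemma size_new_edges E : size E <= r -> size (new_edges E) <= 4 * r ^ 2.
Proof.
move=> sE; rewrite size_filter; apply: leq_trans (count_size _ _) _.
rewrite size_allpairs size_cat !size_map addnn -mul2n.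
by rewrite (_ : 4 = 2 ^ 2) // -expnMn -mulnn leq_mul // leq_mul2l.
Qed.

(** Branching happens only at a clause that does not hit [X], so each branch adds a vertex to [X]:
    the depth is at most r + 1 - |X|, with at most 4r² branches at a time. *)
Lemma to_dnf_bad Q X : all (fun E => size E <= r) Q ->
  size [seq Y : {set V} <- to_dnf X Q | r < #|Y|] <= (4 * r ^ 2) ^ (r.+1 - #|X|).
Proof.
elim: Q X => [|E Q IH] X /=.
  by move=> _; case: ltnP => //= Hr; rewrite ?Hr ?ltnNge ?Hr //= (eqP Hr).
case/andP=> sE sQ; case: ltnP => Hr /=; first by rewrite Hr /= (eqP Hr).
case: ifP => [_|Nhit]; first exact: IH.
rewrite subSn // expnS; apply: leq_trans (_ : _ <= size (new_edges E) * (4 * r ^ 2) ^ (r - #|X|)) _; last first.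
  by rewrite leq_mul // size_new_edges.
apply: size_flatten_map_le => e; rewrite mem_filter => /andP[/andP[ne ce] _].
apply: leq_trans (IH _ sQ) _.
(* For r = 0 the base 4r² vanishes, but then [E] is empty and offers no pair. *)
case: (posnP r) => [r0|r0].
  move: sE; rewrite r0 leqn0 size_eq0 => /eqP E0.
  by move: (conn_ends ne ce); rewrite E0.
rewrite leq_pexp2l ?muln_gt0 ?expn_gt0 ?r0 // -(subSS #|X| r) leq_sub2l //.
apply: proper_card; rewrite properE subsetUl /=.
apply: contraFN Nhit => /subsetP H; apply/existsP; exists e.
by rewrite ne ce !H // !inE eqxx ?orbT.
Qed.

Lemma to_dnf_good Q X Y : Y \in to_dnf X Q ->
  #|Y| <= r -> X \subset Y /\ forall E, E \in Q -> hit E Y.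
Proof.
elim: Q X => [|E Q IH] X /=.
  by case: ltnP => _; rewrite inE => /eqP -> _.
case: ltnP => Hr; first by rewrite inE => /eqP ->; rewrite leqNgt Hr.
case: ifP => [Hh|_] HY sY.
  have [H1 H2] := IH _ HY sY; split=> // E'; rewrite inE => /orP[/eqP->|/H2//].
  exact: hit_subr H1 Hh.
case/flattenP: HY => _ /mapP[e He ->] HY; have [H1 H2] := IH _ HY sY.
move: He; rewrite mem_filter => /andP[/andP[ne ce] _].
split; first by apply: subset_trans H1; rewrite subsetUl.
move=> E'; rewrite inE => /orP[/eqP->|/H2//].
by apply: hit_subr H1 _; apply/existsP; exists e; rewrite ne ce !inE !eqxx ?orbT.
Qed.

(** Choosing at every clause a connected pair inside [T] gives a branch that never leaves [T]. *)
Lemma to_dnf_complete Q X T : X \subset T -> (forall E, E \in Q -> hit E T) ->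
  exists2 Y, Y \in to_dnf X Q & Y \subset T.
Proof.
elim: Q X => [|E Q IH] X sXT HQ /=.
  by exists X => //; case: ifP; rewrite mem_head.
case: ifP => _; first by exists X => //; rewrite mem_head.
have HQ' E' : E' \in Q -> hit E' T by move=> HE; apply: HQ; rewrite inE HE orbT.
case: ifP => _; first exact: IH.
have /existsP[e /and4P[e1 e2 ne ce]] := HQ E (mem_head _ _).
have [] := IH (X :|: [set e.1; e.2]) _ HQ'.
  by rewrite subUset sXT; apply/subsetP => w; rewrite !inE => /orP[] /eqP->.
move=> Y HY sYT; exists Y => //; apply/flattenP; eexists; last exact: HY.
apply/mapP; exists e => //; rewrite mem_filter ne ce /=.
apply/allpairsP; exists e; rewrite (conn_ends ne ce); split=> //; last by case: (e).
by apply: (@conn_ends E _ e.1); rewrite 1?eq_sym // conn_sym.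
Qed.

(** Each edge joins different components of the edges after it, so [E] is a forest, and for a random
    colouring its edges are monochromatic independently. *)
Fixpoint indep E : bool :=
  if E is e :: E' then ~~ conn E' e.1 e.2 && indep E' else true.

(** Each branch adds an edge, and a monomial offers at most r² pairs; the base 4r² is taken so that
    both kinds of error have the same bound. *)
Lemma to_cnf_bad D E : all (fun X : {set V} => #|X| <= r) D ->
  size [seq F <- to_cnf E D | r < size F] <= (4 * r ^ 2) ^ (r.+1 - size E).
Proof.
elim: D E => [|X D IH] E /=.
  by move=> _; case: ltnP => //= Hr; rewrite ?Hr ?ltnNge ?Hr //= (eqP Hr).
case/andP=> sX sD; case: ltnP => Hr /=; first by rewrite Hr /= (eqP Hr).
case: ifP => [_|_]; first exact: IH.
rewrite subSn // expnS.
set L := filter _ (allpairs _ _ _); apply: leq_trans (_ : _ <= size L * (4 * r ^ 2) ^ (r - size E)) _; last first.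
  rewrite leq_mul // size_filter; apply: leq_trans (count_size _ _) _.
  rewrite size_allpairs -cardE mulnn; apply: leq_trans (_ : r ^ 2 <= _); last by rewrite leq_pmull.
  by rewrite -!mulnn leq_mul.
apply: size_flatten_map_le => e _; apply: leq_trans (IH _ sD) _.
by rewrite /= subSS.
Qed.

Lemma to_cnf_good D E F : F \in to_cnf E D ->
  size F <= r -> {subset E <= F} /\ forall X, X \in D -> hit F X.
Proof.
elim: D E => [|X D IH] E /=.
  by case: ltnP => _; rewrite inE => /eqP -> _; split.
case: ltnP => Hr; first by rewrite inE => /eqP ->; rewrite leqNgt Hr.
case: ifP => [Hh|_] HF sF.
  have [H1 H2] := IH _ HF sF; split=> // X'; rewrite inE => /orP[/eqP->|/H2//].
  exact: hit_subl H1 Hh.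
case/flattenP: HF => _ /mapP[e He ->] HF; have [H1 H2] := IH _ HF sF.
move: He; rewrite mem_filter => /andP[ne /allpairsP[[a b] [/= Ha Hb ee]]].
rewrite !mem_enum in Ha Hb.
split; first by move=> x xE; apply: H1; rewrite inE xE orbT.
move=> X'; rewrite inE => /orP[/eqP->|/H2//].
apply: hit_subl H1 _; apply/existsP; exists e; rewrite ne ee Ha Hb /=.
by apply/connP => A /(_ (a, b)) ->; rewrite ?mem_head.
Qed.

(** A pair inside [X] is added only if [E] does not hit [X], that is, if no pair inside [X] is
    connected yet. *)
Lemma to_cnf_indep D E F : indep E -> F \in to_cnf E D -> indep F.
Proof.
elim: D E => [|X D IH] E iE /=.
  by case: ltnP => _; rewrite inE => /eqP ->.
case: ltnP => Hr; first by rewrite inE => /eqP ->.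
case: ifP => [_|Nh]; first exact: IH.
case/flattenP=> _ /mapP[e He ->]; apply: IH => /=; rewrite iE andbT.
move: He; rewrite mem_filter => /andP[ne /allpairsP[[a b] [/= Ha Hb ee]]].
rewrite !mem_enum in Ha Hb.
apply: contraFN Nh => ce; apply/existsP; exists e; rewrite ne ce; by rewrite ee Ha Hb.
Qed.

Lemma to_cnf_complete D E c : mono E c -> (forall X, X \in D -> ~~ rainbow X c) ->
  exists2 F, F \in to_cnf E D & mono F c.
Proof.
elim: D E => [|X D IH] E mE HD /=.
  by exists E => //; case: ifP; rewrite mem_head.
case: ifP => _; first by exists E => //; rewrite mem_head.
have HD' X' : X' \in D -> ~~ rainbow X' c by move=> HX; apply: HD; rewrite inE HX orbT.
case: ifP => _; first exact: IH.
have := HD X (mem_head _ _); rewrite negb_forall => /existsP[e].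
rewrite negb_imply negbK => /andP[/and3P[e1 e2 ne] ce].
have [|F HF mF] := IH (e :: E) _ HD'; first by rewrite /= ce.
exists F => //; apply/flattenP; eexists; last exact: HF.
apply/mapP; exists e => //; rewrite mem_filter ne /=.
by apply/allpairsP; exists e; rewrite !mem_enum e1 e2; split=> //; case: (e).
Qed.

End Switching.

(** * Counting cliques and colourings, with all probabilities multiplied out *)

Lemma union_bound (A : eqType) (B : finType) (P : A -> pred B) (s : seq A) m M :
  (forall a, a \in s -> #|[set b | P a b]| * m <= M) ->
  #|[set b | has (fun a => P a b) s]| * m <= size s * M.
Proof.
elim: s => [|a s IH] H /=.
  by rewrite (_ : [set b | false] = set0) ?cards0 //; apply/setP => b; rewrite !inE.
rewrite (_ : [set b | _] = [set b | P a b] :|: [set b | has (P^~ b) s]); last first.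
  by apply/setP => b; rewrite !inE.
apply: leq_trans (_ : (#|[set b | P a b]| + #|[set b | has (P^~ b) s]|) * m <= _).
  by rewrite leq_mul2r leq_card_setU orbT.
rewrite mulnDl mulSn leq_add //; first by apply: H; rewrite mem_head.
by apply: IH => b bs; apply: H; rewrite inE bs orbT.
Qed.

(* The colours of the component of [u] can be shifted cyclically, and exactly one
   of the [k] shifts gives [u] the colour of [v]. *)
Lemma card_mono_cons E u v : 0 < k -> ~~ conn E u v ->
  #|[set c | mono ((u, v) :: E) c]| * k <= #|[set c | mono E c]|.
Proof.
move=> k0 Nuv.
pose shift (p : {ffun V -> 'I_k} * 'I_k) : {ffun V -> 'I_k} :=
  [ffun w => if conn E u w then Ordinal (ltn_pmod (p.1 w + p.2) k0) else p.1 w].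
have cuu : conn E u u by apply/connP.
rewrite (_ : _ * k = #|setX [set c | mono ((u, v) :: E) c] [set: 'I_k]|); last first.
  by rewrite cardsX cardsT card_ord.
rewrite -(@card_in_imset _ _ shift); last first.
  move=> [c j] [c' j']; rewrite !inE /= !andbT => /andP[/eqP e1 _] /andP[/eqP e2 _] /ffunP H.
  have Hv : c v = c' v by have := H v; rewrite !ffunE (negPf Nuv).
  have jj : j = j'.
    have := H u; rewrite !ffunE cuu /= => /(congr1 val) /= /eqP.
    by rewrite e1 e2 Hv eqn_modDl !modn_small // => /eqP/val_inj.
  congr pair => //; apply/ffunP => w; have := H w; rewrite !ffunE jj.
  case: ifP => // _ /(congr1 val) /= /eqP.
  by rewrite eqn_modDr !modn_small // => /eqP/val_inj.
apply/subset_leq_card/subsetP => _ /imsetP[[c j] Hc ->].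
move: Hc; rewrite !inE /= andbT => /andP[_ /allP mc].
apply/allP => e eE; rewrite !ffunE (eqP (mc e eE)).
suff -> : conn E u e.1 = conn E u e.2 by [].
by apply/connP/connP => H A HA; rewrite (H A HA) HA.
Qed.

Lemma card_mono_indep E : 0 < k -> indep E ->
  #|[set c | mono E c]| * k ^ size E <= k ^ n.
Proof.
move=> k0; elim: E => [_|[u v] E IH /= /andP[Nuv iE]].
  by rewrite muln1; apply: leq_trans (max_card _) _; rewrite card_ffun !card_ord.
rewrite expnS mulnA; apply: leq_trans (IH iE).
by rewrite leq_mul2r card_mono_cons // orbT.
Qed.

(** At most |X|² pairs can fail, each with probability at most 1/k, so at most half of the
    colourings are lost. *)
Lemma card_rainbow X : 0 < k -> 2 * #|X| ^ 2 <= k ->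
  k ^ n <= 2 * #|[set c | rainbow X c]|.
Proof.
move=> k0 Xk.
set s := [seq e <- allpairs pair (enum X) (enum X) | e.1 != e.2].
have ss : size s <= #|X| ^ 2.
  by rewrite size_filter (leq_trans (count_size _ _)) // size_allpairs -cardE mulnn.
have H : #|[set c : {ffun V -> 'I_k} | has (fun e => c e.1 == c e.2) s]| * k <= size s * k ^ n.
  apply: union_bound => -[u v]; rewrite mem_filter => /andP[/= ne _].
  rewrite -[X in _ * X]expn1; apply: leq_trans (@card_mono_indep [:: (u, v)] k0 _).
    by apply: eq_leq; congr (_ * _); apply: eq_card => c; rewrite !inE /= andbT.
  rewrite /= andbT; apply/connP => /(_ [set u]) H.
  have: (u \in [set u]) = (v \in [set u]) by apply: H.
  by rewrite !inE eqxx eq_sym (negPf ne).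
have E : [set c : {ffun V -> 'I_k} | has (fun e => c e.1 == c e.2) s] = ~: [set c | rainbow X c].
  apply/setP => c; rewrite !inE negb_forall; apply/hasP/existsP => -[e].
    rewrite mem_filter => /andP[ne /allpairsP[[a b] [/= Ha Hb ee]]] ce.
    rewrite !mem_enum in Ha Hb; exists e; rewrite negb_imply negbK ce ne.
    by rewrite ee Ha Hb.
  rewrite negb_imply negbK => /andP[/and3P[e1 e2 ne] ce]; exists e => //.
  rewrite mem_filter ne; apply/allpairsP; exists e.
  by rewrite !mem_enum e1 e2; split=> //; case: (e).
have T : #|[set c | rainbow X c]| + #|~: [set c | rainbow X c]| = k ^ n.
  by rewrite cardsC card_ffun !card_ord.
rewrite {}E in H; rewrite -T mul2n -addnn leq_add2l.
rewrite -(leq_pmul2r k0) -(leq_add2l (#|[set c | rainbow X c]| * k)).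
have: 2 * (#|~: [set c | rainbow X c]| * k) <= k * k ^ n.
  apply: leq_trans (_ : 2 * (#|X| ^ 2 * k ^ n) <= _).
    by rewrite leq_mul2l /= (leq_trans H) // leq_mul2r ss orbT.
  by rewrite mulnA leq_mul2r Xk orbT.
rewrite -T mulnC muln2 -addnn mulnDr ![k * _]mulnC leq_add2r => HH.
by rewrite leq_add2l.
Qed.

(** The fraction of the K-subsets of an m-set that contain a given j-set is the product of (K -
    i)/(m - i) for i < j, and each factor is at most K/m. *)
Lemma bin_ratio m K j : j <= K -> K <= m ->
  'C(m - j, K - j) * m ^ j <= 'C(m, K) * K ^ j.
Proof.
move=> jK Km; elim: j jK => [|j IH] jK; first by rewrite !subn0 !expn0.
have jm : j < m by apply: leq_trans jK Km.
have E : (m - j) * 'C(m - j.+1, K - j.+1) = (K - j) * 'C(m - j, K - j).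
  by rewrite !subnS mul_bin_diag prednK ?subn_gt0.
rewrite -(leq_pmul2l (_ : 0 < m - j)) ?subn_gt0 // !expnS mulnA E.
apply: leq_trans (_ : (K - j) * m * ('C(m - j, K - j) * m ^ j) <= _).
  by rewrite eq_leq // -!mulnA; congr (_ * _); rewrite mulnCA.
apply: leq_trans (_ : (m - j) * K * ('C(m, K) * K ^ j) <= _); last first.
  by rewrite eq_leq // -!mulnA; congr (_ * _); rewrite mulnCA.
apply: leq_mul; last by apply: IH; apply: ltnW.
by rewrite !mulnBl [m * K]mulnC leq_sub2l // leq_mul2l Km orbT.
Qed.

Lemma card_super X K j : K <= n -> j <= #|X| ->
  #|[set T : {set V} | (#|T| == K) && (X \subset T)]| * n ^ j <= 'C(n, K) * K ^ j.
Proof.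
move=> Kn jX; have [XK|XK] := leqP #|X| K; last first.
  rewrite (_ : [set T | _] = set0) ?cards0 //; apply/setP => T; rewrite !inE.
  apply/negP => /andP[/eqP TK /subset_leq_card].
  by rewrite TK leqNgt XK.
have N : #|[set T : {set V} | (#|T| == K) && (X \subset T)]| <= 'C(n - #|X|, K - #|X|).
  have -> : n - #|X| = #|~: X| by apply/eqP; rewrite -(eqn_add2l #|X|) cardsC card_ord subnKC // (leq_trans XK).
  rewrite -cards_draws -(@card_in_imset _ _ (fun T => T :\: X)); last first.
    move=> A B; rewrite !inE => /andP[_ sA] /andP[_ sB] /setP H.
    apply/setP => w; have := H w; rewrite !inE.
    by case: (boolP (w \in X)) => // wX _; rewrite (subsetP sA) // (subsetP sB).
  apply/subset_leq_card/subsetP => _ /imsetP[T HT ->].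
  move: HT; rewrite !inE => /andP[/eqP <- sX].
  rewrite cardsD (setIidPr sX) eqxx andbT; apply/subsetP => w.
  by rewrite !inE => /andP[].
have H : #|[set T : {set V} | (#|T| == K) && (X \subset T)]| * n ^ #|X| <= 'C(n, K) * K ^ #|X|.
  by apply: leq_trans (bin_ratio XK Kn); rewrite leq_mul2r N orbT.
have [n0|n0] := posnP n.
  have K0 : K = 0 by apply/eqP; rewrite -leqn0 -n0.
  have X0 : #|X| = 0 by apply/eqP; rewrite -leqn0 -K0.
  by move: H jX; rewrite X0 leqn0 => H /eqP ->.
rewrite -(leq_pmul2r (_ : 0 < n ^ (#|X| - j))) ?expn_gt0 ?n0 // -mulnA -expnD subnKC //.
apply: leq_trans H _; rewrite -{1}(subnKC jX) expnD mulnA leq_mul2l.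
have [->|nj] := posnP (#|X| - j); first by rewrite !expn0 orbT.
by rewrite leq_exp2r ?Kn ?orbT.
Qed.

(** * Approximating a circuit *)

Definition clique_graph T : graph := fun i j =>
  [exists u in T, exists v in T, [&& val u == i, val v == j & u != v]].

(** Vertices outside the range form one further class, by way of [None]; circuits never read
    them. *)
Definition colour_graph c : graph := fun i j =>
  omap c (insub i) != omap c (insub j).

(** Conjunction is exact on CNFs and disjunction on DNFs, so a gate rebuilds only the other form and
    makes errors of one kind: overlong monomials, collected in [BX], or overlong clauses, collected
    in [BE]. The errors belong to the whole circuit, so that gates can be reused without counting
    them twice. [D] implies [Q] throughout; [D] misses only accepted cliques above a member of [BX],
    and [Q] only rejected colourings that falsify a member of [BE]. *)
Lemma approximation r (l : seq (graph -> bool)) : 1 < r -> circuit n l ->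
  exists (BX : seq {set V}) (BE : seq (seq (V * V))),
    [/\ forall X, X \in BX -> r < #|X|,
        forall E, E \in BE -> indep E && (r < size E),
        size BX <= size l * (4 * r ^ 2) ^ r.+1,
        size BE <= size l * (4 * r ^ 2) ^ r.+1 &
        forall f, In f l -> exists (D : seq {set V}) (Q : seq (seq (V * V))),
          [/\ all (fun X : {set V} => #|X| <= r) D, all (fun E => size E <= r) Q,
              forall X E, X \in D -> E \in Q -> hit E X,
              forall T, f (clique_graph T) ->
                ~~ has (fun X : {set V} => X \subset T) BX ->
                has (fun X : {set V} => X \subset T) D &
              forall c, ~~ f (colour_graph c) ->
                ~~ has (fun E => mono E c) BE -> has (fun E => mono E c) Q]].
Proof.
move=> r1; elim=> [|{}l f b _ [BX [BE [H1 H2 H3 H4 H5]]] Hf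
  |{}l f i j _ [BX [BE [H1 H2 H3 H4 H5]]] /ltP Hi /ltP Hj Hf
  |{}l f g h _ [BX [BE [H1 H2 H3 H4 H5]]] Hg Hh Hf
  |{}l f g h _ [BX [BE [H1 H2 H3 H4 H5]]] Hg Hh Hf].
- by exists [::], [::].
- exists BX, BE; split; rewrite ?(leq_trans H3) ?(leq_trans H4) ?leq_mul2r ?leqnSn ?orbT // => _ [<-|/H5//].
  case: b Hf => Hf.
    exists [:: set0], [::]; split=> //= [||c]; rewrite ?cards0 // ?Hf // => T _ _.
    by rewrite sub0set.
  by exists [::], [:: [::]]; split=> //= T; rewrite Hf.
- exists BX, BE; split; rewrite ?(leq_trans H3) ?(leq_trans H4) ?leq_mul2r ?leqnSn ?orbT // => _ [<-|/H5//].
  pose u := Ordinal Hi; pose v := Ordinal Hj.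
  have [uv|uv] := eqVneq u v.
    have ij : i = j by have := congr1 val uv.
    (* A loop is absent from all the test graphs: the empty DNF and the empty clause. *)
    exists [::], [:: [::]]; split=> //= T; rewrite Hf.
    case/existsP=> u' /andP[_ /existsP[v' /andP[_ /and3P[/eqP e1 /eqP e2]]]].
    by rewrite -val_eqE /= e1 e2 ij eqxx.
  exists [:: [set u; v]], [:: [:: (u, v)]]; split=> /=.
  + by rewrite cards2 andbT (leq_trans _ r1) // uv.
  + by rewrite andbT ltnW.
  + move=> X E; rewrite !inE => /eqP-> /eqP->; apply/existsP; exists (u, v).
    rewrite /= !inE !eqxx orbT uv /=; apply/connP => A /(_ (u, v)) -> //.
    by rewrite mem_head.
  + move=> T; rewrite Hf orbF => /existsP[u' /andP[Tu /existsP[v' /andP[Tv /and3P[e1 e2 _]]]]] _.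
    apply/subsetP => w; rewrite !inE => /orP[] /eqP ->.
      by rewrite (_ : u = u') //; apply: val_inj; rewrite /= (eqP e1).
    by rewrite (_ : v = v') //; apply: val_inj; rewrite /= (eqP e2).
  + move=> c; rewrite Hf /colour_graph -[i]/(val u) -[j]/(val v) !valK negbK /= => /eqP[ee] _.
    by rewrite /mono /= !andbT orbF ee.
- have [D1 [Q1 [d1 q1 dq1 p1 n1]]] := H5 _ Hg; have [D2 [Q2 [d2 q2 dq2 p2 n2]]] := H5 _ Hh.
  set Q := Q1 ++ Q2; have sQ : all (fun E => size E <= r) Q by rewrite all_cat q1.
  exists ([seq X : {set V} <- to_dnf r set0 Q | r < #|X|] ++ BX), BE; split => //.
  + by move=> X; rewrite mem_cat => /orP[|/H1//]; rewrite mem_filter => /andP[].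
  + rewrite size_cat /= mulSn leq_add //.
    by apply: leq_trans (to_dnf_bad _ sQ) _; rewrite cards0 subn0.
  + by rewrite (leq_trans H4) // leq_mul2r leqnSn orbT.
  move=> f' [<-|/H5[D' [Q' [dd qq dq pp nn]]]]; last first.
    exists D', Q'; split=> // T fT; rewrite has_cat negb_or => /andP[_]; exact: pp.
  exists [seq X : {set V} <- to_dnf r set0 Q | #|X| <= r], Q; split=> //.
  + exact: filter_all.
  + move=> X E; rewrite mem_filter => /andP[sX XQ] EQ.
    by have [_] := to_dnf_good XQ sX; apply.
  + move=> T; rewrite Hf => /andP[gT hT]; rewrite has_cat negb_or => /andP[B1 B2].
    have [Y YQ YT] : exists2 Y, Y \in to_dnf r set0 Q & Y \subset T.
      apply: to_dnf_complete; rewrite ?sub0set // => E.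
      rewrite mem_cat => /orP[] EQ.
        have /hasP[X XD XT] := p1 _ gT B2; exact: hit_subr XT (dq1 _ _ XD EQ).
      have /hasP[X XD XT] := p2 _ hT B2; exact: hit_subr XT (dq2 _ _ XD EQ).
    apply/hasP; exists Y => //; rewrite mem_filter YQ andbT leqNgt.
    by apply: contra B1 => rY; apply/hasP; exists Y; rewrite ?mem_filter ?rY.
  + move=> c; rewrite Hf negb_and => /orP[] Hc Bc; rewrite has_cat.
      by rewrite n1.
    by rewrite n2 ?orbT.
- have [D1 [Q1 [d1 q1 dq1 p1 n1]]] := H5 _ Hg; have [D2 [Q2 [d2 q2 dq2 p2 n2]]] := H5 _ Hh.
  set D := D1 ++ D2; have sD : all (fun X : {set V} => #|X| <= r) D by rewrite all_cat d1.
  exists BX, ([seq E <- to_cnf r [::] D | r < size E] ++ BE); split => //.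
  + move=> E; rewrite mem_cat => /orP[|/H2//]; rewrite mem_filter => /andP[-> HE].
    by rewrite andbT; apply: to_cnf_indep HE.
  + by rewrite (leq_trans H3) // leq_mul2r leqnSn orbT.
  + rewrite size_cat /= mulSn leq_add //.
    by apply: leq_trans (to_cnf_bad _ sD) _; rewrite subn0.
  move=> f' [<-|/H5[D' [Q' [dd qq dq pp nn]]]]; last first.
    exists D', Q'; split=> // T fT; rewrite has_cat negb_or => /andP[_]; exact: nn.
  exists D, [seq E <- to_cnf r [::] D | size E <= r]; split=> //.
  + exact: filter_all.
  + move=> X E XD; rewrite mem_filter => /andP[sE EQ].
    by have [_] := to_cnf_good EQ sE; apply.
  + move=> T; rewrite Hf => /orP[] Hc Bc; rewrite has_cat.
      by rewrite p1.
    by rewrite p2 ?orbT.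
  + move=> c; rewrite Hf negb_or => /andP[gc hc]; rewrite has_cat negb_or => /andP[B1 B2].
    have [F FQ Fc] : exists2 F, F \in to_cnf r [::] D & mono F c.
      apply: to_cnf_complete => // X; rewrite mem_cat => /orP[] XD; apply/negP => rX.
        have /hasP[E EQ Ec] := n1 _ gc B2.
        by have := hit_rainbow (dq1 _ _ XD EQ) rX; rewrite Ec.
      have /hasP[E EQ Ec] := n2 _ hc B2.
      by have := hit_rainbow (dq2 _ _ XD EQ) rX; rewrite Ec.
    apply/hasP; exists F => //; rewrite mem_filter FQ andbT leqNgt.
    by apply: contra B1 => rY; apply/hasP; exists F; rewrite ?mem_filter ?rY.
Qed.

(** If the DNF of [f] is empty, every clique lies above a bad monomial, and one of these covers at
    most a fraction ((k+1)/n)^(r+1) of the cliques. Otherwise the DNF has a monomial [X], and every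
    colouring that is rainbow on [X], hence at least half of all, falsifies a bad clause; one of
    these covers at most a fraction k^-(r+1). There are at most (4r²)^(r+1) bad sets per gate, and
    the constants 8 and 16 leave a surplus of 2^(r+1). *)
Lemma circuit_size r (l : seq (graph -> bool)) f : 1 < r -> 16 * r ^ 2 <= k ->
  8 * r ^ 2 * k.+1 <= n -> circuit n l -> In f l ->
  (forall T, #|T| = k.+1 -> f (clique_graph T)) ->
  (forall c, ~~ f (colour_graph c)) ->
  2 ^ r.+1 <= size l.
Proof.
move=> r1 rk kn /(approximation r1)[BX [BE [H1 H2 H3 H4 H5]]] Hf pos neg.
have [D [Q [dD dQ dq pT nc]]] := H5 _ Hf.
have r0 : 0 < r by apply: ltnW.
have r20 : 0 < r ^ 2 by rewrite expn_gt0 r0.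
have k0 : 0 < k by apply: leq_trans rk; rewrite muln_gt0.
have k1n : k.+1 <= n by apply: leq_trans kn; rewrite leq_pmull // muln_gt0.
case: D dD dq pT => [_ _ pT|X D /= /andP[sX _] dq _].
- have B : 'C(n, k.+1) * n ^ r.+1 <= size BX * ('C(n, k.+1) * k.+1 ^ r.+1).
    apply: leq_trans (_ : #|[set T : {set V} | has (fun X : {set V} => (#|T| == k.+1) && (X \subset T)) BX]| * n ^ r.+1 <= _); last first.
      apply: union_bound => X XB; apply: card_super => //; exact: H1.
    rewrite leq_mul2r; apply/orP; right.
    have := cards_draws [set: V] k.+1; rewrite cardsT card_ord => <-.
    apply/subset_leq_card/subsetP => T; rewrite !inE => /andP[_ TK].
    have := pT T (pos T (eqP TK)); case: (boolP (has _ _)) => [|_ /(_ isT)//].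
    by move=> /hasP[X XB XT] _; apply/hasP; exists X; rewrite ?TK.
  have C0 : 0 < 'C(n, k.+1) by rewrite bin_gt0.
  rewrite mulnCA leq_pmul2l // in B.
  rewrite -(leq_pmul2r (_ : 0 < ((4 * r ^ 2) * k.+1) ^ r.+1)); last first.
    by rewrite expn_gt0 !muln_gt0 r0.
  rewrite -expnMn; apply: leq_trans (_ : n ^ r.+1 <= _).
    by rewrite leq_exp2r // (_ : 2 * _ = 8 * r ^ 2 * k.+1) // !mulnA.
  by apply: leq_trans B _; rewrite expnMn mulnA leq_mul2r H3 orbT.
- have XC : k ^ n <= 2 * #|[set c | rainbow X c]|.
    apply: card_rainbow => //; apply: leq_trans rk.
    by apply: leq_mul => //; rewrite -!mulnn leq_mul.
  have B : #|[set c | rainbow X c]| * k ^ r.+1 <= size BE * k ^ n.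
    apply: leq_trans (_ : #|[set c | has (fun E => mono E c) BE]| * k ^ r.+1 <= _).
      rewrite leq_mul2r; apply/orP; right.
      apply/subset_leq_card/subsetP => c; rewrite !inE => Xc; apply: contraT => Bc.
      have /hasP[E EQ Ec] := nc c (neg c) Bc.
      by have := hit_rainbow (dq _ _ (mem_head _ _) EQ) Xc; rewrite Ec.
    apply: union_bound => E EB; have /andP[iE sE] := H2 _ EB.
    apply: leq_trans (card_mono_indep k0 iE); rewrite leq_mul2l.
    by rewrite leq_pexp2l ?orbT.
  have K0 : 0 < k ^ n by rewrite expn_gt0 k0.
  have B' : k ^ r.+1 <= 2 * size BE.
    rewrite -(leq_pmul2r K0) mulnC; apply: leq_trans (_ : 2 * (#|[set c | rainbow X c]| * k ^ r.+1) <= _).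
      by rewrite mulnA leq_mul2r XC orbT.
    by rewrite -mulnA leq_mul2l B orbT.
  rewrite -(leq_pmul2r (_ : 0 < 2 * (4 * r ^ 2) ^ r.+1)); last first.
    by rewrite muln_gt0 expn_gt0 !muln_gt0 r0.
  apply: leq_trans (_ : k ^ r.+1 <= _); last first.
    apply: leq_trans B' _; rewrite mulnCA leq_mul2l; exact: H4.
  (* Since 16 = 4 * 4, a further factor 2^(r+1) is available; it absorbs the 2 lost by using only
     half of the colourings. *)
  rewrite mulnCA -expnMn; apply: leq_trans (_ : 2 ^ r.+1 * (2 * (4 * r ^ 2)) ^ r.+1 <= _).
    by apply: leq_mul => //; rewrite -{1}(expn1 2) leq_pexp2l.
  by rewrite -expnMn leq_exp2r // (_ : 2 * _ = 16 * r ^ 2 * 1) ?muln1 // !mulnA.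
Qed.

Lemma clique_graph_has_clique T m : #|T| = m -> has_clique n m (clique_graph T).
Proof.
move=> Tm; have [->|n0] := posnP m; first by exists id; split=> [l /ltP|l p _ /ltP].
have [v0 _] : exists v, v \in T by apply/set0Pn; rewrite -card_gt0 Tm.
have e l : (l < m)%coq_nat -> nth v0 (enum T) l \in T.
  by move=> /ltP lm; rewrite -mem_enum mem_nth // -cardE Tm.
exists (fun l => val (nth v0 (enum T) l)); split=> [l _|l p /ltP lp pm]; first exact/ltP/ltn_ord.
have lm : (l < m)%coq_nat by apply/ltP/(ltn_trans lp)/ltP.
apply/existsP; exists (nth v0 (enum T) l); rewrite e //=.
apply/existsP; exists (nth v0 (enum T) p); rewrite e //= !eqxx /=.
by rewrite nth_uniq ?enum_uniq -?cardE ?Tm ?ltn_eqF //; apply/ltP.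
Qed.

Lemma colour_graph_colourable c : colourable n k (colour_graph c).
Proof.
exists (fun i => if insub i is Some v then val (c v) else 0); split=> [i /ltP Hi|i j /ltP Hi /ltP Hj].
  by rewrite insubT; apply/ltP/ltn_ord.
rewrite /colour_graph !insubT /= => /eqP H E; apply: H; congr Some.
exact: val_inj.
Qed.
End Approximation.

Lemma circuit_lower_bound (n k r : nat) (l : list (graph -> bool)) f :
  le 2 r -> le (Nat.mul 16 (Nat.mul r r)) k ->
  le (Nat.mul (Nat.mul 8 (Nat.mul r r)) (S k)) n -> circuit n l -> In f l ->
  (forall x, has_clique n (S k) x -> f x = true) ->
  (forall x, colourable n k x -> f x = false) ->
  le (Nat.pow 2 (S r)) (length l).
Proof.
move=> /leP r1 /leP rk /leP kn Hl Hf pos neg.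
have powE m : Nat.pow 2 m = 2 ^ m by elim: m => // m IH; rewrite expnS -IH.
apply/leP; rewrite powE.
apply: (@circuit_size n k r _ f) => // [T TK|c].
- by apply: pos; apply: clique_graph_has_clique.
- by rewrite neg //; apply: colour_graph_colourable.
Qed.
End CliqueColouring.

Import ListNotations.
Set Bullet Behavior "Strict Subproofs".
Unset SsrOldRewriteGoalsOrder.

(** * Interpolation *)

(** [g] holds the truth values at the top; it is kept abstract so that a substitution can be moved
    into it. *)
Fixpoint leaf_eval (g : iform -> bool) (a : var -> bool) (A : iform) : bool :=
  match A with
  | IVar x => a x
  | IBot => false
  | ITop => true
  | IAnd A B => leaf_eval g a A && leaf_eval g a B
  | IOr A B => leaf_eval g a A || leaf_eval g a B
  | IImp A B => implb (g A) (g B) && implb (leaf_eval g a A) (leaf_eval g a B)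
  end.

Fixpoint root_eval (g : iform -> bool) (K : list (var -> bool))
    (v : var -> bool) (A : iform) : bool :=
  match A with
  | IVar x => v x
  | IBot => false
  | ITop => true
  | IAnd A B => root_eval g K v A && root_eval g K v B
  | IOr A B => root_eval g K v A || root_eval g K v B
  | IImp A B => forallb (fun a => leaf_eval g a (IImp A B)) K &&
                implb (root_eval g K v A) (root_eval g K v B)
  end.

Fixpoint classical_eval (t : var -> bool) (A : iform) : bool :=
  match A with
  | IVar x => t x
  | IBot => false
  | ITop => true
  | IAnd A B => classical_eval t A && classical_eval t B
  | IOr A B => classical_eval t A || classical_eval t B
  | IImp A B => implb (classical_eval t A) (classical_eval t B)
  end.

(* For [m = true] the top point forces everything, bottom included, so that the
   model is in effect a fork without a top. *)
Definition top_eval (m : bool) (t : var -> bool) (A : iform) : bool :=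
  m || classical_eval t A.

Definition is_model (m : bool) (t : var -> bool) (K : list (var -> bool))
    (v : var -> bool) : Prop :=
  K <> [] /\
  (forall a x, In a K -> v x = true -> a x = true) /\
  (forall a x, In a K -> a x = true -> top_eval m t (IVar x) = true).

Definition forces (m : bool) (t : var -> bool) (K : list (var -> bool))
    (v : var -> bool) (A : iform) : Prop :=
  root_eval (top_eval m t) K v A = true.

(** Truth has to be preserved at the root of each single model, which is stronger than preserving
    validity. *)
Definition valid_rule (m : bool) (r : frule Limp) : Prop :=
  forall t K v, is_model m t K v ->
    (forall A, In A (fprems r) -> forces m t K v A) -> forces m t K v (fconcl r).

Definition iform_eq_dec (A B : iform) : {A = B} + {A <> B}.
Proof. decide equality; decide equality; apply Nat.eq_dec. Defined.

(** * Closure under finitely many inferences *)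

Notation inference := (list iform * iform)%type.

Definition closure_step (infs : list inference) (Phi : iform -> bool)
    (A : iform) : bool :=
  Phi A || existsb (fun i => (if iform_eq_dec (snd i) A then true else false)
                             && forallb Phi (fst i)) infs.

Fixpoint closure (infs : list inference) (Phi : iform -> bool) (r : nat)
    : iform -> bool :=
  match r with
  | O => Phi
  | S r => closure_step infs (closure infs Phi r)
  end.

Definition closed (infs : list inference) (Phi : iform -> bool) : Prop :=
  forall i, In i infs -> (forall A, In A (fst i) -> Phi A = true) ->
    Phi (snd i) = true.

Lemma closure_step_true infs Phi A : closure_step infs Phi A = true <->
  Phi A = true \/
  exists i, In i infs /\ snd i = A /\ forall B, In B (fst i) -> Phi B = true.
Proof.
  unfold closure_step. rewrite orb_true_iff, existsb_exists.
  split; (intros [H|(i & Hi & H)]; [left; exact H|right; exists i]).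
  - rewrite andb_true_iff, forallb_forall in H. destruct H as [H1 H2].
    destruct iform_eq_dec; [auto|discriminate].
  - destruct H as [<- H]. split; [exact Hi|].
    destruct iform_eq_dec; [|congruence]. now apply forallb_forall.
Qed.

(** A round that finds something new derives the conclusion of a further inference; hence as many
    rounds as there are inferences suffice. *)
Lemma closed_or_grows infs Phi : closed infs Phi \/
  length (filter (fun i => Phi (snd i)) infs) <
  length (filter (fun i => closure_step infs Phi (snd i)) infs).
Proof.
  destruct (classic (closed infs Phi)) as [H|H]; [now left|right].
  assert (exists i, In i infs /\ Phi (snd i) = false /\
            closure_step infs Phi (snd i) = true) as (i & Hi & H1 & H2).
  { apply NNPP. intros N. apply H. intros i Hi HA.
    destruct (Phi (snd i)) eqn:E; [reflexivity|]. exfalso. apply N.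
    exists i. repeat split; auto. apply closure_step_true. eauto 6. }
  assert (G : forall l : list inference, length (filter (fun i => Phi (snd i)) l) <=
            length (filter (fun i => closure_step infs Phi (snd i)) l)).
  { induction l as [|j l IH]; simpl; [lia|].
    destruct (Phi (snd j)) eqn:E.
    - replace (closure_step infs Phi (snd j)) with true
        by (symmetry; apply closure_step_true; auto). apply le_n_S, IH.
    - destruct (closure_step infs Phi (snd j)); [apply le_S|]; apply IH. }
  apply in_split in Hi as (l1 & l2 & Hl). set (Psi := closure_step infs Phi) in *.
  clearbody Psi. subst infs. rewrite !filter_app, !length_app. simpl.
  rewrite H1, H2. simpl. pose proof (G l1). pose proof (G l2). lia.
Qed.

Lemma closure_closed infs Phi : closed infs (closure infs Phi (length infs)).
Proof.
  assert (G : forall r, closed infs (closure infs Phi r) \/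
    r <= length (filter (fun i => closure infs Phi r (snd i)) infs)).
  { induction r as [|r [IH|IH]]; [right; lia| |].
    - left. intros i Hi HA. simpl. apply closure_step_true. right. exists i.
      repeat split; auto. intros B HB. specialize (HA B HB). simpl in HA.
      apply closure_step_true in HA as [HA|(j & Hj & <- & HA)]; auto.
    - destruct (closed_or_grows infs (closure infs Phi r)) as [H|H].
      + left. intros i Hi HA. simpl. apply closure_step_true. right. exists i.
        repeat split; auto. intros B HB. specialize (HA B HB). simpl in HA.
        apply closure_step_true in HA as [HA|(j & Hj & <- & HA)]; auto.
      + right. simpl. lia. }
  destruct (G (length infs)) as [H|H]; [exact H|].
  (* In the remaining case the count has reached its maximum: every conclusion has been derived. *)
  set (Psi := closure _ _ _) in *. clearbody Psi. clear G. intros i Hi _. revert i Hi.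
  induction infs as [|j l IH]; simpl in *; [easy|].
  pose proof (filter_length_le (fun i => Psi (snd i)) l).
  destruct (Psi (snd j)) eqn:E; simpl in H; [|lia].
  intros i [<-|Hi]; [exact E|]. apply IH; [lia|exact Hi].
Qed.

Lemma closure_init infs (Phi : iform -> bool) r A :
  Phi A = true -> closure infs Phi r A = true.
Proof.
  induction r; simpl; intros; auto. apply closure_step_true. auto.
Qed.

Lemma closure_monotone infs (Phi Psi : iform -> bool) r :
  (forall A, Phi A = true -> Psi A = true) ->
  forall A, closure infs Phi r A = true -> closure infs Psi r A = true.
Proof.
  intros H. induction r as [|r IH]; simpl; [exact H|].
  intros A. rewrite !closure_step_true. intros [HA|(i & Hi & E & HA)]; auto.
  right. exists i. auto.
Qed.

Lemma closure_sound infs (Phi : iform -> bool) (Q : iform -> Prop) r :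
  (forall A, Phi A = true -> Q A) ->
  (forall i, In i infs -> (forall A, In A (fst i) -> Q A) -> Q (snd i)) ->
  forall A, closure infs Phi r A = true -> Q A.
Proof.
  intros H HQ. induction r as [|r IH]; simpl; [exact H|].
  intros A. rewrite closure_step_true. intros [HA|(i & Hi & <- & HA)]; auto.
Qed.

(** * The closure as a monotone circuit *)

Definition computes (l : list (graph -> bool)) (F : graph -> bool) : Prop :=
  exists f, In f l /\ forall x, f x = F x.

Definition extends (n : nat) (l l' : list (graph -> bool)) (c : nat) : Prop :=
  circuit n l' /\ incl l l' /\ length l' <= length l + c.

Lemma computes_incl l l' F : incl l l' -> computes l F -> computes l' F.
Proof. intros H (f & Hf & E). exists f. auto. Qed.

Lemma extends_trans n l l' l'' c c' :
  extends n l l' c -> extends n l' l'' c' -> extends n l l'' (c + c').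
Proof.
  intros (H1 & H2 & H3) (H4 & H5 & H6). split; [exact H4|]. split; [|lia].
  eapply incl_tran; eauto.
Qed.

Lemma extends_cons n l f : circuit n (f :: l) -> extends n l (f :: l) 1.
Proof.
  intros H. split; [exact H|]. split; [apply incl_tl, incl_refl|simpl; lia].
Qed.

Lemma extend_and n l F G : circuit n l -> computes l F -> computes l G ->
  exists l', extends n l l' 1 /\ computes l' (fun x => F x && G x).
Proof.
  intros H (f & Hf & Ef) (g & Hg & Eg). exists ((fun x => F x && G x) :: l).
  split.
  - apply extends_cons. apply (circuit_and n l _ f g); auto.
    intros x. now rewrite Ef, Eg.
  - eexists. split; [now left|reflexivity].
Qed.

Lemma extend_or n l F G : circuit n l -> computes l F -> computes l G ->
  exists l', extends n l l' 1 /\ computes l' (fun x => F x || G x).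
Proof.
  intros H (f & Hf & Ef) (g & Hg & Eg). exists ((fun x => F x || G x) :: l).
  split.
  - apply extends_cons. apply (circuit_or n l _ f g); auto.
    intros x. now rewrite Ef, Eg.
  - eexists. split; [now left|reflexivity].
Qed.

Lemma extend_const n l b : circuit n l ->
  exists l', extends n l l' 1 /\ computes l' (fun _ => b).
Proof.
  intros H. exists ((fun _ => b) :: l). split.
  - apply extends_cons. now apply circuit_const with b.
  - eexists. split; [now left|reflexivity].
Qed.

Lemma extend_forallb n (Phi : graph -> iform -> bool) Z l : circuit n l ->
  (forall A, In A Z -> computes l (fun x => Phi x A)) ->
  exists l', extends n l l' (S (length Z)) /\
    computes l' (fun x => forallb (Phi x) Z).
Proof.
  intros Hl. induction Z as [|A Z IH]; intros HZ; [exact (extend_const n l true Hl)|].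
  destruct IH as (l1 & E1 & C1); [intros; apply HZ; now right|].
  destruct (extend_and n l1 (fun x => Phi x A) (fun x => forallb (Phi x) Z))
    as (l2 & E2 & C2).
  - apply E1.
  - apply computes_incl with l; [apply E1|apply HZ; now left].
  - exact C1.
  - exists l2. split; [|exact C2]. replace (S (length (A :: Z)))
      with (S (length Z) + 1) by (simpl; lia).
    now apply extends_trans with l1.
Qed.

Lemma extends_le n l l' c c' : c <= c' -> extends n l l' c -> extends n l l' c'.
Proof. unfold extends. intuition lia. Qed.

Lemma extends_refl n l c : circuit n l -> extends n l l c.
Proof. intros H. split; [exact H|]. split; [apply incl_refl|lia]. Qed.

Lemma extend_existsb n (Phi : graph -> iform -> bool) b infs A l : circuit n l ->
  (forall i, In i infs -> length (fst i) <= b) ->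
  (forall i B, In i infs -> In B (fst i) -> computes l (fun x => Phi x B)) ->
  exists l', extends n l l' (1 + length infs * (b + 2)) /\
    computes l' (fun x => existsb (fun i =>
      (if iform_eq_dec (snd i) A then true else false) && forallb (Phi x) (fst i)) infs).
Proof.
  intros Hl. induction infs as [|i infs IH]; intros Hb HZ; [exact (extend_const n l false Hl)|].
  destruct IH as (l1 & E1 & C1);
    [intros; apply Hb; now right|intros; eapply HZ; eauto; now right|].
  simpl. destruct iform_eq_dec; simpl.
  - destruct (extend_forallb n Phi (fst i) l1) as (l2 & E2 & C2).
    + apply E1.
    + intros B HB. apply computes_incl with l; [apply E1|].
      apply (HZ i); auto. now left.
    + destruct (extend_or n l2 (fun x => forallb (Phi x) (fst i)) (fun x =>
        existsb (fun i => (if iform_eq_dec (snd i) A then true else false)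
          && forallb (Phi x) (fst i)) infs)) as (l3 & E3 & C3); auto.
      * apply E2.
      * apply computes_incl with l1; [apply E2|exact C1].
      * exists l3. split; [|exact C3].
        eapply extends_le; [|eapply extends_trans; [eapply extends_trans|]; eauto].
        specialize (Hb i (or_introl eq_refl)). lia.
  - exists l1. split; [|exact C1]. eapply extends_le; [|exact E1]. lia.
Qed.

Lemma extend_step n (Phi : graph -> iform -> bool) b infs D l : circuit n l ->
  (forall i, In i infs -> length (fst i) <= b) ->
  (forall i B, In i infs -> In B (fst i) -> computes l (fun x => Phi x B)) ->
  (forall A, In A D -> computes l (fun x => Phi x A)) ->
  exists l', extends n l l' (length D * (length infs * (b + 2) + 2)) /\
    forall A, In A D -> computes l' (fun x => closure_step infs (Phi x) A).
Proof.
  intros Hl Hb HZ. induction D as [|A D IH]; intros HD.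
  { exists l. split; [now apply extends_refl|easy]. }
  destruct IH as (l1 & E1 & C1); [intros; apply HD; now right|].
  destruct (extend_existsb n Phi b infs A l1) as (l2 & E2 & C2); auto.
  { apply E1. }
  { intros i B Hi HB. apply computes_incl with l; [apply E1|eauto]. }
  edestruct (extend_or n l2 (fun x => Phi x A)) as (l3 & E3 & C3);
    [apply E2| |exact C2|].
  { apply computes_incl with l; [|apply HD; now left].
    eapply incl_tran; [apply E1|apply E2]. }
  exists l3. split.
  - eapply extends_le; [|eapply extends_trans; [eapply extends_trans|]; eauto].
    simpl length. lia.
  - intros B [<-|HB]; [exact C3|]. apply computes_incl with l1; [|now apply C1].
    eapply incl_tran; [apply E2|apply E3].
Qed.

(** Each round has one output per formula of [D]; as [D] contains all premises, a round can be
    computed from the preceding one. *)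
Lemma closure_circuit n (Phi : graph -> iform -> bool) b infs D r :
  (forall i, In i infs -> length (fst i) <= b) ->
  (forall i B, In i infs -> In B (fst i) -> In B D) ->
  (forall A, In A D -> (exists c, forall x, Phi x A = c) \/
     exists i j, i < n /\ j < n /\ forall x, Phi x A = x i j) ->
  exists l, circuit n l /\
    length l <= length D + r * (length D * (length infs * (b + 2) + 2)) /\
    forall A, In A D -> computes l (fun x => closure infs (Phi x) r A).
Proof.
  intros Hb HB HD. induction r as [|r (l & Hl & Ll & IH)].
  - clear HB. induction D as [|A D IH].
    + exists []. split; [constructor|]. split; [simpl; lia|easy].
    + destruct IH as (l & Hl & Ll & C); [intros; apply HD; now right|].
      exists ((fun x => Phi x A) :: l). split; [|split].
      * destruct (HD A (or_introl eq_refl)) as [(c & Hc)|(i & j & Hi & Hj & Hij)].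
        -- now apply circuit_const with c.
        -- now apply circuit_input with i j.
      * simpl in *. lia.
      * intros B [<-|HB]; [exists (fun x => Phi x A); split; [now left|reflexivity]|].
        apply computes_incl with l; [apply incl_tl, incl_refl|now apply C].
  - destruct (extend_step n (fun x => closure infs (Phi x) r) b infs D l)
      as (l' & E & C); auto.
    + intros i B Hi HBi. apply IH. eauto.
    + exists l'. split; [apply E|]. split; [|exact C]. destruct E as (_ & _ & E). lia.
Qed.

(** * Instances of rules that are valid at the leaves *)

Fixpoint subformulas (A : iform) : list iform :=
  A :: match A with
       | IVar _ | IBot | ITop => []
       | IAnd B C | IOr B C | IImp B C => subformulas B ++ subformulas C
       end.

Lemma subformulas_refl A : In A (subformulas A).
Proof. destruct A; now left. Qed.

Lemma subformulas_trans A B C :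
  In A (subformulas B) -> In B (subformulas C) -> In A (subformulas C).
Proof.
  intros HA. induction C; intros HB; simpl in HB; rewrite ?in_app_iff in HB;
    (destruct HB as [<-|HB]; [exact HA|]); simpl; rewrite ?in_app_iff; intuition.
Qed.

Definition rule_formulas (r : frule Limp) : list iform :=
  flat_map subformulas (fconcl r :: fprems r).

Lemma rule_formulas_sub r A B :
  In A (subformulas B) -> In B (rule_formulas r) -> In A (rule_formulas r).
Proof.
  unfold rule_formulas. rewrite !in_flat_map. intros HA (C & HC & HB).
  exists C. split; [exact HC|]. eapply subformulas_trans; eauto.
Qed.

Fixpoint sublists {A : Type} (l : list A) : list (list A) :=
  match l with
  | [] => [[]]
  | a :: l => map (cons a) (sublists l) ++ sublists l
  end.

Lemma sublists_length {A : Type} (l : list A) : length (sublists l) = 2 ^ length l.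
Proof. induction l; simpl; rewrite ?length_app, ?length_map; lia. Qed.

Lemma sublists_filter {A : Type} (p : A -> bool) l : In (filter p l) (sublists l).
Proof.
  induction l as [|a l IH]; simpl; [now left|]. rewrite in_app_iff.
  destruct (p a); [left; now apply in_map|now right].
Qed.

Lemma sublists_length_le {A : Type} (l l' : list A) :
  In l' (sublists l) -> length l' <= length l.
Proof.
  revert l'. induction l as [|a l IH]; simpl; intros l'.
  - now intros [<-|[]].
  - rewrite in_app_iff, in_map_iff. intros [(l1 & <- & H)|H]; apply IH in H; simpl; lia.
Qed.

Lemma sublists_incl {A : Type} (l l' : list A) :
  In l' (sublists l) -> incl l' l.
Proof.
  revert l'. induction l as [|a l IH]; simpl; intros l'.
  - intros [<-|[]]. easy.
  - rewrite in_app_iff, in_map_iff. intros [(l1 & <- & H)|H]; apply IH in H.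
    + intros x [->|Hx]; [now left|right; auto].
    + now apply incl_tl.
Qed.

Lemma classical_filter {A : Type} (P : A -> Prop) (l : list A) : exists l',
  length l' <= length l /\ forall x, In x l' <-> In x l /\ P x.
Proof.
  induction l as [|a l (l' & Hl & IH)].
  - exists []. split; [simpl; lia|]. simpl. tauto.
  - destruct (classic (P a)) as [H|H].
    + exists (a :: l'). split; [simpl; lia|]. intros x. simpl. rewrite IH.
      intuition (subst; auto).
    + exists l'. split; [simpl; lia|]. intros x. simpl. rewrite IH.
      intuition (subst; tauto).
Qed.

(** Semantic consequence over single leaves below a top with values [g]. The inferences may be
    selected by classical reasoning, since only the existence of a small circuit is at stake. *)
Definition entails (g : iform -> bool) (Z : list iform) (A : iform) : Prop :=
  forall a, (forall x, a x = true -> g (IVar x) = true) ->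
    (forall B, In B Z -> leaf_eval g a B = true) -> leaf_eval g a A = true.

Lemma leaf_eval_ext g g' a a' A :
  (forall B, g B = g' B) -> (forall x, a x = a' x) ->
  leaf_eval g a A = leaf_eval g' a' A.
Proof.
  intros Hg Ha. induction A; simpl; rewrite ?Hg, ?IHA1, ?IHA2; auto.
Qed.

Lemma leaf_eval_subst g sigma a A :
  leaf_eval g a (isubst sigma A) =
  leaf_eval (fun B => g (isubst sigma B)) (fun x => leaf_eval g a (sigma x)) A.
Proof. induction A; simpl; congruence. Qed.

Lemma classical_eval_subst t sigma A : classical_eval t (isubst sigma A) =
  classical_eval (fun x => classical_eval t (sigma x)) A.
Proof. induction A; simpl; congruence. Qed.

Lemma leaf_eval_top m t a A :
  (forall x, a x = true -> top_eval m t (IVar x) = true) ->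
  leaf_eval (top_eval m t) a A = true -> top_eval m t A = true.
Proof.
  unfold top_eval. destruct m; simpl; [reflexivity|]. intros H.
  induction A; simpl; auto; intros E;
    repeat (rewrite ?andb_true_iff, ?orb_true_iff in * ); intuition.
Qed.

Lemma root_eval_leaf g K v a A : In a K -> (forall x, v x = true -> a x = true) ->
  root_eval g K v A = true -> leaf_eval g a A = true.
Proof.
  intros Ha H. induction A; simpl; auto; intros E.
  - rewrite andb_true_iff in *. intuition.
  - rewrite orb_true_iff in *. intuition.
  - rewrite andb_true_iff, forallb_forall in E. now apply E.
Qed.

(** * The slash relative to a closed set *)

Fixpoint slash (Phi : iform -> bool) (v : var -> bool) (A : iform) : bool :=
  Phi A &&
  match A with
  | IVar x => v x
  | IBot => false
  | ITop => true
  | IAnd B C => slash Phi v B && slash Phi v C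
  | IOr B C => slash Phi v B || slash Phi v C
  | IImp B C => implb (slash Phi v B) (slash Phi v C)
  end.

Lemma slash_mem Phi v A : slash Phi v A = true -> Phi A = true.
Proof. destruct A; simpl; rewrite andb_true_iff; tauto. Qed.

Definition all_true : var -> bool := fun _ => true.

Lemma all_true_top m (b : var -> bool) x :
  b x = true -> top_eval m all_true (IVar x) = true.
Proof. unfold top_eval. simpl. now rewrite orb_true_r. Qed.

(** The top as seen through [sigma]. All variables are true at the actual top, so that every
    valuation of a leaf is admissible there. *)
Definition local_top (m : bool) (sigma : var -> iform) : iform -> bool :=
  top_eval m (fun x => classical_eval all_true (sigma x)).

Lemma local_topE m sigma A :
  local_top m sigma A = top_eval m all_true (isubst sigma A).
Proof. unfold local_top, top_eval. now rewrite classical_eval_subst. Qed.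

(** All valid inferences between subformulas of the rule are included, not only the rule itself:
    this is what provides a countervaluation for each missing formula. *)
Definition instance_of (m : bool) (r : frule Limp) (sigma : var -> iform)
    (i : inference) : Prop :=
  exists Z A, In Z (sublists (rule_formulas r)) /\ In A (rule_formulas r) /\
    entails (local_top m sigma) Z A /\
    i = (map (isubst sigma) Z, isubst sigma A).

Lemma instance_sound m r sigma i b : instance_of m r sigma i ->
  (forall A, In A (fst i) -> leaf_eval (top_eval m all_true) b A = true) ->
  leaf_eval (top_eval m all_true) b (snd i) = true.
Proof.
  intros (Z & A & _ & _ & HZ & ->) H. simpl in *.
  set (g := top_eval m all_true) in *.
  assert (E : forall B, leaf_eval g b (isubst sigma B) =
    leaf_eval (local_top m sigma) (fun x => leaf_eval g b (sigma x)) B).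
  { intros B. rewrite leaf_eval_subst. apply leaf_eval_ext; auto.
    intros C. unfold g. now rewrite local_topE. }
  rewrite E. apply HZ.
  - intros x Hx. rewrite local_topE. apply leaf_eval_top in Hx; auto.
    intros y. apply all_true_top.
  - intros B HB. rewrite <- E. apply H. now apply in_map.
Qed.

Lemma instances_finite m r sigma : exists infs : list inference,
  length infs <= 2 ^ length (rule_formulas r) * length (rule_formulas r) /\
  forall i, In i infs <-> instance_of m r sigma i.
Proof.
  set (S := rule_formulas r).
  destruct (classical_filter (fun p => entails (local_top m sigma) (fst p) (snd p))
    (list_prod (sublists S) S)) as (l & Hl & HP).
  exists (map (fun p => (map (isubst sigma) (fst p), isubst sigma (snd p))) l).
  split.
  - rewrite length_map. rewrite length_prod, sublists_length in Hl. exact Hl.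
  - intros i. rewrite in_map_iff. split.
    + intros ([Z A] & <- & H). apply HP in H as [H1 H2].
      apply in_prod_iff in H1. exists Z, A. simpl in *. tauto.
    + intros (Z & A & HZ & HA & HE & ->). exists (Z, A). split; [reflexivity|].
      apply HP. split; [now apply in_prod|exact HE].
Qed.

(* The leaves of the model are countervaluations to the members of
   [rule_formulas r] whose instances are missing from [Phi]. *)
Lemma countermodels m r sigma (Phi : iform -> bool) b :
  (forall i, instance_of m r sigma i ->
     (forall A, In A (fst i) -> Phi A = true) -> Phi (snd i) = true) ->
  (forall A, Phi A = true -> leaf_eval (top_eval m all_true) b A = true) ->
  exists K, K <> [] /\
    (forall a x, In a K -> a x = true -> local_top m sigma (IVar x) = true) /\
    (forall A, In A (rule_formulas r) -> Phi (isubst sigma A) = true <->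
       forall a, In a K -> leaf_eval (local_top m sigma) a A = true).
Proof.
  intros Hcl Hb. set (S := rule_formulas r) in *. set (g := local_top m sigma).
  set (Z := filter (fun A => Phi (isubst sigma A)) S).
  set (good := fun a => (forall x, a x = true -> g (IVar x) = true) /\
                  forall A, In A Z -> leaf_eval g a A = true).
  assert (G : forall S', incl S' S -> exists K, K <> [] /\
    (forall a, In a K -> good a) /\
    forall A, In A S' -> Phi (isubst sigma A) = false ->
      exists a, In a K /\ leaf_eval g a A = false).
  { induction S' as [|A S' IH]; intros HS.
    - exists [fun x => leaf_eval (top_eval m all_true) b (sigma x)].
      split; [easy|]. split; [|easy]. intros a [<-|[]]. split.
      + intros x Hx. unfold g. rewrite local_topE. apply leaf_eval_top in Hx; auto.
        intros y. apply all_true_top.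
      + intros A HA. apply filter_In in HA as [_ HA]. apply Hb in HA.
        rewrite leaf_eval_subst in HA. rewrite <- HA. apply leaf_eval_ext; auto.
        intros B. apply local_topE.
    - destruct IH as (K & HK & H1 & H2); [intros x Hx; apply HS; now right|].
      destruct (Phi (isubst sigma A)) eqn:E.
      + exists K. split; [exact HK|]. split; [exact H1|].
        intros B [<-|HB]; [congruence|auto].
      + assert (exists a, good a /\ leaf_eval g a A = false) as (a & Ga & Ea).
        (* Without such a leaf, [Z] would entail [A], and closure would put the instance of [A] into
           [Phi]. *)
        { apply NNPP. intros N. enough (Phi (isubst sigma A) = true) by congruence.
          apply (Hcl (map (isubst sigma) Z, isubst sigma A)).
          - exists Z, A. split; [apply sublists_filter|].
            split; [apply HS; now left|]. split; [|reflexivity].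
            intros a H3 H4. destruct (leaf_eval g a A) eqn:E'; [exact E'|].
            exfalso. apply N. exists a. split; [|exact E']. split; assumption.
          - intros B HB. apply in_map_iff in HB as (C & <- & HC).
            now apply filter_In in HC as [_ HC]. }
        exists (a :: K). split; [easy|]. split.
        * intros a' [<-|Ha]; auto.
        * intros B [<-|HB] HE; [exists a; split; [now left|exact Ea]|].
          destruct (H2 B HB HE) as (a' & Ha' & E'). exists a'.
          split; [now right|exact E']. }
  destruct (G S (incl_refl S)) as (K & HK & H1 & H2). exists K.
  split; [exact HK|]. split.
  - intros a x Ha. now apply H1.
  - intros A HA. split.
    + intros E a Ha. apply (H1 a Ha). apply filter_In. auto.
    + intros H. destruct (Phi (isubst sigma A)) eqn:E; [reflexivity|].
      destruct (H2 A HA E) as (a & Ha & Ea). rewrite H in Ea; congruence.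
Qed.

(** For formulas of the rule, membership in [Phi] is truth at all leaves. In the slash of an
    implication it is therefore the clause over the leaves, and in the slash of a conjunction or
    disjunction it follows from the parts. One model then suffices to apply the validity of the
    rule. *)
Lemma slash_rule m r sigma (Phi : iform -> bool) v b :
  valid_rule m r ->
  (forall i, instance_of m r sigma i ->
     (forall A, In A (fst i) -> Phi A = true) -> Phi (snd i) = true) ->
  (forall A, Phi A = true -> leaf_eval (top_eval m all_true) b A = true) ->
  (forall A, In A (fprems r) -> slash Phi v (isubst sigma A) = true) ->
  slash Phi v (isubst sigma (fconcl r)) = true.
Proof.
  intros Hr Hcl Hb Hprems.
  destruct (countermodels m r sigma Phi b Hcl Hb) as (K & HK & Htop & HS).
  set (g := local_top m sigma) in *.
  (* Variables not in the rule are made false at the root, because their values at the leaves are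
     not controlled. *)
  set (w := fun x => slash Phi v (sigma x) &&
              if in_dec iform_eq_dec (IVar x) (rule_formulas r) then true else false).
  assert (E : forall A, In A (rule_formulas r) ->
            root_eval g K w A = slash Phi v (isubst sigma A)).
  { assert (B : forall A, In A (rule_formulas r) ->
              (forall a, In a K -> leaf_eval g a A = true) ->
              Phi (isubst sigma A) = true) by (intros; now apply HS).
    assert (D : forall A a, In A (rule_formulas r) -> In a K ->
              slash Phi v (isubst sigma A) = true -> leaf_eval g a A = true).
    { intros A a HA Ha Hs. apply (proj1 (HS A HA)); [|exact Ha].
      eapply slash_mem; eauto. }
    induction A as [x| | |A1 IH1 A2 IH2|A1 IH1 A2 IH2|A1 IH1 A2 IH2]; intros HA;
      try (assert (H1 : In A1 (rule_formulas r)) by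
        (eapply rule_formulas_sub; [|exact HA]; simpl; rewrite in_app_iff;
         auto using subformulas_refl);
       assert (H2 : In A2 (rule_formulas r)) by
        (eapply rule_formulas_sub; [|exact HA]; simpl; rewrite in_app_iff;
         auto using subformulas_refl);
       specialize (IH1 H1); specialize (IH2 H2));
      simpl isubst; simpl slash; simpl root_eval.
    - unfold w. destruct in_dec; [|easy]. now rewrite andb_true_r.
    - now rewrite andb_false_r.
    - symmetry. rewrite andb_true_r. apply (B ITop HA). reflexivity.
    - rewrite IH1, IH2. destruct (slash Phi v (isubst sigma A1)) eqn:E1;
        [|simpl; now rewrite andb_false_r].
      destruct (slash Phi v (isubst sigma A2)) eqn:E2;
        [|simpl; now rewrite andb_false_r].
      symmetry. rewrite andb_true_r. apply (B (IAnd A1 A2) HA). intros a Ha. simpl.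
      now rewrite (D A1 a H1 Ha E1), (D A2 a H2 Ha E2).
    - rewrite IH1, IH2. destruct (slash Phi v (isubst sigma A1)) eqn:E1.
      + symmetry. rewrite andb_true_r. apply (B (IOr A1 A2) HA). intros a Ha. simpl.
        now rewrite (D A1 a H1 Ha E1).
      + destruct (slash Phi v (isubst sigma A2)) eqn:E2;
          [|simpl; now rewrite andb_false_r].
        symmetry. rewrite andb_true_r. apply (B (IOr A1 A2) HA). intros a Ha. simpl.
        now rewrite (D A2 a H2 Ha E2), orb_true_r.
    - rewrite IH1, IH2. f_equal. apply eq_true_iff_eq. rewrite forallb_forall.
      symmetry. exact (HS (IImp A1 A2) HA). }
  assert (HM : is_model m (fun x => classical_eval all_true (sigma x)) K w).
  { split; [exact HK|]. split; [|exact Htop]. intros a x Ha Hx. unfold w in Hx.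
    destruct in_dec as [Hi|]; [|rewrite andb_false_r in Hx; discriminate].
    rewrite andb_true_r in Hx. apply (proj1 (HS _ Hi)); [|exact Ha].
    eapply slash_mem; eauto. }
  assert (Sub : forall A, In A (fconcl r :: fprems r) -> In A (rule_formulas r)).
  { intros A HA. apply in_flat_map. exists A. auto using subformulas_refl. }
  rewrite <- E by (apply Sub; now left). apply Hr; [exact HM|].
  intros A HA. unfold forces. fold (local_top m sigma). fold g.
  rewrite E by (apply Sub; now right). now apply Hprems.
Qed.

(** Counting implications as false makes truth monotone in [v] and persistent to every leaf above
    [v]. *)
Fixpoint positive_eval (v : var -> bool) (A : iform) : bool :=
  match A with
  | IVar x => v x
  | IBot => false
  | ITop => true
  | IAnd A B => positive_eval v A && positive_eval v B
  | IOr A B => positive_eval v A || positive_eval v B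
  | IImp A B => false
  end.

Lemma positive_eval_mono v w A : (forall x, v x = true -> w x = true) ->
  positive_eval v A = true -> positive_eval w A = true.
Proof.
  intros H. induction A; simpl; auto;
    rewrite ?andb_true_iff, ?orb_true_iff; intuition.
Qed.

Lemma positive_eval_leaf g v b A : (forall x, v x = true -> b x = true) ->
  positive_eval v A = true -> leaf_eval g b A = true.
Proof.
  intros H. induction A; simpl; try easy; auto;
    rewrite ?andb_true_iff, ?orb_true_iff; intuition.
Qed.

Definition initial (P : iform) (v : var -> bool) (A : iform) : bool :=
  (if in_dec iform_eq_dec A (subformulas P) then true else false) &&
  positive_eval v A.

Lemma initial_true P v A : initial P v A = true <->
  In A (subformulas P) /\ positive_eval v A = true.
Proof.
  unfold initial. rewrite andb_true_iff. destruct in_dec; intuition discriminate.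
Qed.

Lemma slash_initial P Phi v A : (forall B, initial P v B = true -> Phi B = true) ->
  initial P v A = true -> slash Phi v A = true.
Proof.
  intros H. induction A as [x| | |A1 IH1 A2 IH2|A1 IH1 A2 IH2|]; intros HA;
    pose proof HA as HA'; apply initial_true in HA' as [HA1 HA2]; simpl in *;
    rewrite (H _ HA); simpl; try easy;
    (assert (H1 : In A1 (subformulas P)) by
      (eapply subformulas_trans; [|exact HA1]; simpl; rewrite in_app_iff;
       auto using subformulas_refl);
     assert (H2 : In A2 (subformulas P)) by
      (eapply subformulas_trans; [|exact HA1]; simpl; rewrite in_app_iff;
       auto using subformulas_refl);
     rewrite initial_true in IH1, IH2).
  - apply andb_true_iff in HA2. rewrite IH1, IH2; tauto.
  - apply orb_true_iff in HA2 as [HA2|HA2]; [rewrite IH1|rewrite IH2, orb_true_r]; tauto.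
Qed.

(** * From proofs to circuits *)

Definition justified (js : list (frule Limp * (var -> iform))) (pi : list iform)
    : Prop :=
  forall l A l', pi = l ++ A :: l' -> exists r sigma, In (r, sigma) js /\
    A = isubst sigma (fconcl r) /\
    forall B, In B (fprems r) -> In (isubst sigma B) l.

Lemma proof_justified (P : inference_system Limp) pi :
  (forall l A l', pi = l ++ A :: l' -> inferred P l A) ->
  exists js, length js = length pi /\ (forall j, In j js -> P (fst j)) /\
    justified js pi.
Proof.
  induction pi as [|A pi IH] using rev_ind; intros H.
  - exists []. split; [reflexivity|]. split; [easy|].
    intros [|? ?] A l' E; discriminate.
  - destruct IH as (js & L & HP & J).
    { intros l B l' ->. apply (H l B (l' ++ [A])). now rewrite <- app_assoc. }
    destruct (H pi A [] eq_refl) as (r & sigma & Hr & HA & Hprems).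
    exists ((r, sigma) :: js). split; [rewrite length_app, Nat.add_comm; exact (f_equal S L)|]. split.
    + intros j [<-|Hj]; auto.
    + intros l B l' E. destruct l' as [|C l' _] using rev_ind.
      * apply app_inj_tail in E as [<- <-]. exists r, sigma. split; [now left|]. auto.
      * rewrite app_comm_cons, app_assoc in E. apply app_inj_tail in E as [E <-].
        destruct (J l B l' E) as (r' & sigma' & Hj & HB).
        exists r', sigma'. split; [now right|exact HB].
Qed.

Lemma line_induction (Q : iform -> Prop) js pi : justified js pi ->
  (forall r sigma, In (r, sigma) js ->
     (forall B, In B (fprems r) -> Q (isubst sigma B)) -> Q (isubst sigma (fconcl r))) ->
  forall A, In A pi -> Q A.
Proof.
  intros J H. induction pi as [|A pi IH] using rev_ind; [easy|].
  assert (J' : justified js pi).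
  { intros l B l' ->. apply (J l B (l' ++ [A])). now rewrite <- app_assoc. }
  intros B HB. apply in_app_iff in HB as [HB|[<-|[]]]; [now apply IH|].
  destruct (J pi A [] eq_refl) as (r & sigma & Hj & -> & Hprems).
  apply H; [exact Hj|]. intros B HB. now apply IH, Hprems.
Qed.

Lemma all_instances m (rs : list (frule Limp)) js w :
  (forall r, In r rs -> length (rule_formulas r) <= w) ->
  (forall j, In j js -> In (fst j) rs) ->
  exists infs : list inference, length infs <= length js * (2 ^ w * w) /\
    forall i, In i infs <-> exists r sigma, In (r, sigma) js /\ instance_of m r sigma i.
Proof.
  intros Hw. induction js as [|[r sigma] js IH]; intros Hjs.
  - exists []. split; [simpl; lia|]. intros i. split; [easy|]. now intros (r & s & [] & _).
  - destruct IH as (infs & L & HI); [intros j Hj; apply Hjs; now right|].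
    destruct (instances_finite m r sigma) as (l & Ll & Hl).
    exists (l ++ infs). split.
    + rewrite length_app. specialize (Hw r (Hjs _ (or_introl eq_refl))).
      assert (2 ^ length (rule_formulas r) * length (rule_formulas r) <= 2 ^ w * w).
      { apply Nat.mul_le_mono; [apply Nat.pow_le_mono_r; lia|exact Hw]. }
      simpl length. lia.
    + intros i. rewrite in_app_iff, Hl, HI. split.
      * intros [H|(r' & s' & H1 & H2)]; [exists r, sigma|exists r', s'];
          (split; [simpl; auto|assumption]).
      * intros (r' & s' & [E|H1] & H2); [left; congruence|right; eauto].
Qed.

(** [f x] tells whether the first disjunct lies in the closure for [v x], the valuation readable by
    a monotone circuit. If it does not, monotonicity keeps it out of the closure for [v' x], for
    which the slash is available because [P] holds there. *)
Theorem interpolant m (rs : list (frule Limp)) : (forall r, In r rs -> valid_rule m r) ->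
  exists c, forall n (pi : list iform) P U1 S1 U2 S2 (v v' : graph -> var -> bool),
    (forall x y, v' x y = true -> v x y = true) ->
    (forall A, In A (subformulas P) -> (exists c, forall x, positive_eval (v x) A = c) \/
       exists i j, i < n /\ j < n /\ forall x, positive_eval (v x) A = x i j) ->
    (forall x, positive_eval (v' x) P = true) ->
    @is_proof Limp (fun r => In r rs) nothing pi
      (P → ((U1 → S1) ∨ (U2 → S2)))%imf ->
    exists l f, circuit n l /\ In f l /\ length l <= c * (length pi + 1) ^ 3 /\
      forall x, if f x
        then forall b, (forall y, v x y = true -> b y = true) ->
               leaf_eval (top_eval m all_true) b (U1 → S1)%imf = true
        else forall b, (forall y, v' x y = true -> b y = true) ->
               leaf_eval (top_eval m all_true) b (U2 → S2)%imf = true.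
Proof.
  intros Hrs.
  set (w := list_sum (map (fun r => length (rule_formulas r)) rs)).
  assert (Hw : forall r, In r rs -> length (rule_formulas r) <= w).
  { unfold w. clear Hrs. induction rs as [|r rs IH]; [easy|]. intros r' [<-|H]; simpl; [lia|].
    specialize (IH r' H). lia. }
  clearbody w. set (q := 2 ^ w * w).
  (* Rounds, tracked formulas and inferences are each linear in the number of lines; hence the
     cube. *)
  exists ((w + 1) * (1 + q * (q * (w + 2) + 2))).
  intros n pi P U1 S1 U2 S2 v v' Hv HP HP' [[pi0 Epi] Hpi].
  destruct (proof_justified (fun r => In r rs) pi) as (js & Ljs & Hjs & J).
  { intros l A l' E. now destruct (Hpi l A l' E). }
  change (length js = @length iform pi) in Ljs.
  destruct (all_instances m rs js w Hw Hjs) as (infs & Linfs & Hinfs).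
  set (D := (U1 → S1)%imf :: flat_map (fun j => map (isubst (snd j)) (rule_formulas (fst j))) js).
  assert (LD : length D <= length pi * w + 1).
  { unfold D. simpl. rewrite <- Ljs. clear - Hjs Hw.
    enough (length (flat_map (fun j => map (isubst (snd j)) (rule_formulas (fst j))) js)
      <= length js * w) by lia.
    induction js as [|j js IH]; simpl; [lia|]. rewrite length_app, length_map.
    pose proof (Hw (fst j) (Hjs j (or_introl eq_refl))).
    specialize (IH (fun k Hk => Hjs k (or_intror Hk))). lia. }
  destruct (closure_circuit n (fun x => initial P (v x)) w infs D (length infs))
    as (l & Hl & Ll & C).
  { intros i Hi. apply Hinfs in Hi as (r & s & Hj & Z & A & HZ & _ & _ & ->).
    simpl. rewrite length_map. apply sublists_length_le in HZ.
    specialize (Hw r (Hjs _ Hj)). lia. }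
  { intros i B Hi HB. apply Hinfs in Hi as (r & s & Hj & Z & A & HZ & _ & _ & ->).
    simpl in HB. apply in_map_iff in HB as (B' & <- & HB). right.
    apply in_flat_map. exists (r, s). split; [exact Hj|]. apply in_map.
    now apply (sublists_incl _ _ HZ). }
  { intros A _. unfold initial. destruct in_dec as [Hi|Hi]; [exact (HP A Hi)|].
    left. exists false. reflexivity. }
  destruct (C (U1 → S1)%imf (or_introl eq_refl)) as (f & Hf & Ef).
  exists l, f. split; [exact Hl|]. split; [exact Hf|]. split.
  { rewrite Ljs in Linfs. fold q in Linfs. set (N := length pi) in *.
    assert (H1 : length D <= (w + 1) * (N + 1)) by nia.
    assert (H2 : length infs <= q * (N + 1)) by nia.
    assert (H3 : length infs * (w + 2) + 2 <= (q * (w + 2) + 2) * (N + 1)) by nia.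
    transitivity ((w + 1) * (N + 1) +
      q * (N + 1) * ((w + 1) * (N + 1) * ((q * (w + 2) + 2) * (N + 1)))).
    - etransitivity; [exact Ll|]. apply Nat.add_le_mono; [exact H1|].
      apply Nat.mul_le_mono; [exact H2|]. now apply Nat.mul_le_mono.
    - assert (N + 1 <= (N + 1) ^ 3) by (simpl; nia).
      replace (q * (N + 1) * ((w + 1) * (N + 1) * ((q * (w + 2) + 2) * (N + 1))))
        with ((w + 1) * (q * (q * (w + 2) + 2)) * (N + 1) ^ 3) by (simpl; ring).
      replace ((w + 1) * (1 + q * (q * (w + 2) + 2)) * (N + 1) ^ 3) with
        ((w + 1) * (N + 1) ^ 3 + (w + 1) * (q * (q * (w + 2) + 2)) * (N + 1) ^ 3) by ring.
      apply Nat.add_le_mono_r. now apply Nat.mul_le_mono_l. }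
  assert (Sound : forall (u : var -> bool) b, (forall y, u y = true -> b y = true) ->
    forall A, closure infs (initial P u) (length infs) A = true ->
      leaf_eval (top_eval m all_true) b A = true).
  { intros u b Hb.
    apply closure_sound with (Q := fun A => leaf_eval (top_eval m all_true) b A = true).
    - intros B HB. apply initial_true in HB. now apply positive_eval_leaf with u.
    - intros i Hi. apply Hinfs in Hi as (r & s & _ & Hi). now apply instance_sound with r s. }
  intros x. rewrite Ef. destruct closure eqn:E.
  { intros b Hb. now apply Sound with (v x). }
  set (Phi := closure infs (initial P (v' x)) (length infs)).
  assert (HS : slash Phi (v' x) (P → ((U1 → S1) ∨ (U2 → S2)))%imf = true).
  { apply (line_induction (fun A => slash Phi (v' x) A = true) js pi J).
    2: { rewrite Epi. apply in_app_iff. right. now left. }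
    intros r s Hj. apply (slash_rule m) with (v' x).
    - apply Hrs, (Hjs _ Hj).
    - intros i Hi. apply closure_closed. apply Hinfs. eauto.
    - now apply Sound. }
  assert (SP : slash Phi (v' x) P = true).
  { apply slash_initial with P.
    - intros B. apply closure_init.
    - apply initial_true. split; [apply subformulas_refl|apply HP']. }
  intros b Hb. apply Sound with (v' x); [exact Hb|]. fold Phi.
  change (Phi (P → ((U1 → S1) ∨ (U2 → S2)))%imf && implb (slash Phi (v' x) P)
    (Phi ((U1 → S1) ∨ (U2 → S2))%imf && (slash Phi (v' x) (U1 → S1)%imf ||
      slash Phi (v' x) (U2 → S2)%imf)) = true) in HS.
  rewrite SP, !andb_true_iff in HS. simpl implb in HS.
  rewrite andb_true_iff, orb_true_iff in HS.
  destruct HS as (_ & _ & [HS|HS]); apply andb_true_iff, proj1 in HS;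
    [exfalso|exact HS].
  enough (closure infs (initial P (v x)) (length infs) (U1 → S1)%imf = true) by congruence.
  revert HS. apply closure_monotone. intros A. rewrite !initial_true.
  intros [H1 H2]. split; [exact H1|].
  apply positive_eval_mono with (v' x); [apply Hv|exact H2].
Qed.

(** * Super-intuitionistic logics of infinite branching *)

(** The numbering serves Lindenbaum's lemma; injectivity suffices, since a stage whose number is no
    code adds nothing. *)
Definition var_code (x : var) : nat :=
  match x with
  | vp i j => Cantor.to_nat (0, Cantor.to_nat (i, j))
  | vq i j => Cantor.to_nat (1, Cantor.to_nat (i, j))
  | vs i j => Cantor.to_nat (2, Cantor.to_nat (i, j))
  | vs' i j => Cantor.to_nat (3, Cantor.to_nat (i, j))
  | vr i j => Cantor.to_nat (4, Cantor.to_nat (i, j))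
  | vr' i j => Cantor.to_nat (5, Cantor.to_nat (i, j))
  end.

Fixpoint iform_code (A : iform) : nat :=
  match A with
  | IVar x => Cantor.to_nat (0, var_code x)
  | IBot => Cantor.to_nat (1, 0)
  | ITop => Cantor.to_nat (2, 0)
  | IAnd A B => Cantor.to_nat (3, Cantor.to_nat (iform_code A, iform_code B))
  | IOr A B => Cantor.to_nat (4, Cantor.to_nat (iform_code A, iform_code B))
  | IImp A B => Cantor.to_nat (5, Cantor.to_nat (iform_code A, iform_code B))
  end.

Lemma to_nat_inj p q : Cantor.to_nat p = Cantor.to_nat q -> p = q.
Proof. intros H. now rewrite <- (Cantor.cancel_of_to p), H, Cantor.cancel_of_to. Qed.

Lemma var_code_inj x y : var_code x = var_code y -> x = y.
Proof.
  destruct x, y; unfold var_code; intros H; apply to_nat_inj in H;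
    apply pair_equal_spec in H as [H1 H2]; try discriminate;
    apply to_nat_inj in H2; congruence.
Qed.

Lemma iform_code_inj A B : iform_code A = iform_code B -> A = B.
Proof.
  revert B. induction A; intros []; unfold iform_code; fold iform_code; intros H;
    apply to_nat_inj, pair_equal_spec in H as [H0 H]; try discriminate; try reflexivity.
  1: now f_equal; apply var_code_inj.
  all: apply to_nat_inj, pair_equal_spec in H as [H1 H2]; f_equal; auto.
Qed.

Definition adjoin (X : iform -> Prop) (A : iform) : iform -> Prop :=
  fun B => X B \/ B = A.

Definition prime_theory (vd : consequence Limp) (y : iform -> Prop) : Prop :=
  (forall A, vd y A -> y A) /\ ~ y IBot /\
  forall A B, y (IOr A B) -> y A \/ y B.

(** * Prime theories of a super-intuitionistic logic *)

Section SuperIntuitionistic.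
Variable vd : consequence Limp.
Hypothesis Hvd : super_intuitionistic vd.

Let refl : forall (X : iform -> Prop) A, X A -> vd X A := cr_refl _ (proj1 Hvd).
Let cut : forall (X Y : iform -> Prop) A,
  (forall B, Y B -> vd X B) -> vd Y A -> vd X A := cr_cut _ (proj1 Hvd).

Lemma vd_mono (X Y : iform -> Prop) A : (forall B, X B -> Y B) -> vd X A -> vd Y A.
Proof. intros H. apply cut. auto. Qed.

Lemma vd_list (X : iform -> Prop) l A :
  vd (elems l) A -> (forall B, In B l -> vd X B) -> vd X A.
Proof. intros H HB. now apply cut with (elems l). Qed.

Lemma vd_init G D : LJ_init (G, D) ->
  vd (elems G) (match D with Some A => A | None => IBot end).
Proof. apply (proj1 (proj2 Hvd) (G, D)). Qed.

Lemma vd_rule prems G D : LJ_rule prems (G, D) ->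
  (forall G' D', In (G', D') prems ->
     vd (elems G') (match D' with Some A => A | None => IBot end)) ->
  vd (elems G) (match D with Some A => A | None => IBot end).
Proof.
  intros H Hp. apply (proj2 (proj2 Hvd) prems (G, D) H).
  intros [G' D'] HD. exact (Hp G' D' HD).
Qed.

Lemma vd_top X : vd X ITop.
Proof. apply vd_list with []; [apply (vd_init _ _ LJ_top)|easy]. Qed.

Lemma vd_bot X A : vd X IBot -> vd X A.
Proof.
  intros H. apply vd_list with [IBot]; [|now intros B [<-|[]]].
  apply (vd_rule _ _ _ (LJ_Rweakening [IBot] A)).
  intros G D [E|[]]. injection E as <- <-. apply (vd_init _ _ LJ_bot).
Qed.

Lemma vd_and X A B : vd X A -> vd X B -> vd X (IAnd A B).
Proof.
  intros HA HB. apply vd_list with [A; B]; [|now intros C [<-|[<-|[]]]].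
  apply (vd_rule _ _ _ (LJ_Rand [A; B] A B)).
  intros G D [E|[E|[]]]; injection E as <- <-; apply refl; simpl; auto.
Qed.

Lemma vd_and1 X A B : vd X (IAnd A B) -> vd X A.
Proof.
  intros H. apply vd_list with [IAnd A B]; [|now intros C [<-|[]]].
  apply (vd_rule _ _ _ (LJ_Land1 [] A B (Some A))).
  intros G D [E|[]]; injection E as <- <-; apply refl; simpl; auto.
Qed.

Lemma vd_and2 X A B : vd X (IAnd A B) -> vd X B.
Proof.
  intros H. apply vd_list with [IAnd A B]; [|now intros C [<-|[]]].
  apply (vd_rule _ _ _ (LJ_Land2 [] A B (Some B))).
  intros G D [E|[]]; injection E as <- <-; apply refl; simpl; auto.
Qed.

Lemma vd_or1 X A B : vd X A -> vd X (IOr A B).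
Proof.
  intros H. apply vd_list with [A]; [|now intros C [<-|[]]].
  apply (vd_rule _ _ _ (LJ_Ror1 [A] A B)).
  intros G D [E|[]]; injection E as <- <-; apply refl; simpl; auto.
Qed.

Lemma vd_or2 X A B : vd X B -> vd X (IOr A B).
Proof.
  intros H. apply vd_list with [B]; [|now intros C [<-|[]]].
  apply (vd_rule _ _ _ (LJ_Ror2 [B] A B)).
  intros G D [E|[]]; injection E as <- <-; apply refl; simpl; auto.
Qed.

Lemma vd_mp X A B : vd X (IImp A B) -> vd X A -> vd X B.
Proof.
  intros H HA. apply vd_list with [IImp A B; A]; [|now intros C [<-|[<-|[]]]].
  apply (vd_rule _ _ _ (LJ_Limp [A] [] A B (Some B))).
  intros G D [E|[E|[]]]; injection E as <- <-; apply refl; simpl; auto.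
Qed.

(** The deduction theorem: antecedents in [LJ] are finite, so finitarity is used to replace [X] by a
    list. *)
Lemma vd_imp X A B : vd (adjoin X A) B -> vd X (IImp A B).
Proof.
  intros H. destruct (cr_fin _ (proj1 Hvd) _ _ H) as (l & Hl & HB).
  destruct (classical_filter X l) as (l' & _ & Hl').
  apply vd_list with l'; [|intros C HC; apply Hl' in HC; now apply refl].
  apply (vd_rule _ _ _ (LJ_Rimp l' A B)).
  intros G D [E|[]]; injection E as <- <-. apply vd_mono with (elems l); [|exact HB].
  intros C HC. destruct (Hl C HC) as [HX| ->]; [right; now apply Hl'|now left].
Qed.

Lemma vd_or X A B C : vd (adjoin X A) C -> vd (adjoin X B) C -> vd X (IOr A B) -> vd X C.
Proof.
  intros HA HB H. apply vd_imp in HA, HB.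
  apply vd_list with [IOr A B; IImp A C; IImp B C];
    [|now intros D [<-|[<-|[<-|[]]]]].
  apply (vd_rule _ _ _ (LJ_Lor [IImp A C; IImp B C] A B (Some C))).
  intros G D [E|[E|[]]]; injection E as <- <-.
  - apply vd_mp with A; apply refl; simpl; auto.
  - apply vd_mp with B; apply refl; simpl; auto.
Qed.

Section Lindenbaum.
Variables (X : iform -> Prop) (d : iform).

Fixpoint stage (n : nat) : iform -> Prop :=
  match n with
  | O => X
  | S n => fun A => stage n A \/ iform_code A = n /\ ~ vd (adjoin (stage n) A) d
  end.

Lemma stage_le n n' A : n <= n' -> stage n A -> stage n' A.
Proof. induction 1; simpl; auto. Qed.

Lemma stage_consistent n : ~ vd X d -> ~ vd (stage n) d.
Proof.
  intros HX. induction n as [|n IH]; [exact HX|]. intros H.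
  destruct (classic (exists A, iform_code A = n /\ ~ vd (adjoin (stage n) A) d))
    as [(A & HA & NA)|N].
  - apply NA. revert H. apply vd_mono. intros B [HB|[HB _]]; [now left|right].
    apply iform_code_inj. congruence.
  - apply IH. revert H. apply vd_mono. intros B [HB|HB]; [exact HB|]. exfalso. eauto.
Qed.

(** The last clause, maximality without [d], is what later forces every proper extension of the root
    to contain [d]. *)
Lemma lindenbaum : ~ vd X d -> exists y, (forall A, X A -> y A) /\
  prime_theory vd y /\ ~ y d /\ forall A, ~ y A -> vd (adjoin y A) d.
Proof.
  intros HX. set (y := fun A => exists n, stage n A). exists y.
  assert (Nd : ~ vd y d).
  { intros H. destruct (cr_fin _ (proj1 Hvd) _ _ H) as (l & Hl & Hd).
    assert (exists n, forall A, In A l -> stage n A) as (n & Hn).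
    { clear Hd. induction l as [|A l IH]; [now exists 0|].
      destruct IH as (n & Hn); [intros; apply Hl; now right|].
      destruct (Hl A (or_introl eq_refl)) as (n' & Hn'). exists (max n n').
      intros B [<-|HB]; [apply stage_le with n'|apply stage_le with n];
        auto; lia. }
    apply (stage_consistent n HX). revert Hd. now apply vd_mono. }
  assert (M : forall A, ~ y A -> vd (adjoin y A) d).
  { intros A HA. apply vd_mono with (adjoin (stage (iform_code A)) A).
    - intros B [HB|HB]; [left; now exists (iform_code A)|now right].
    - apply NNPP. intros N. apply HA. exists (S (iform_code A)). simpl. auto. }
  assert (C : forall A, vd y A -> y A).
  { intros A HA. apply NNPP. intros N. apply Nd. apply cut with (adjoin y A); [|now apply M].
    intros B [HB| ->]; auto. }
  split; [intros A HA; now exists 0|]. split; [|split]; auto. split; [exact C|]. split.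
  - intros H. apply Nd, vd_bot. auto.
  - intros A B H. apply NNPP. intros N. apply not_or_and in N as [NA NB].
    apply Nd. apply vd_or with A B; auto.
Qed.
End Lindenbaum.

Section PrimeTheory.
Variable y : iform -> Prop.
Hypothesis Hy : prime_theory vd y.

Let mem A : y A <-> vd y A.
Proof. split; [apply refl|apply (proj1 Hy)]. Qed.

Lemma prime_top : y ITop.
Proof. apply mem, vd_top. Qed.

Lemma prime_and A B : y (IAnd A B) <-> y A /\ y B.
Proof.
  rewrite !mem. split; [|intros []; now apply vd_and].
  intros H. eauto using vd_and1, vd_and2.
Qed.

Lemma prime_or A B : y (IOr A B) <-> y A \/ y B.
Proof.
  split; [apply (proj2 (proj2 Hy))|]. rewrite !mem. intros []; auto using vd_or1, vd_or2.
Qed.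

Lemma prime_imp A B : y (IImp A B) <-> forall z, prime_theory vd z ->
  (forall C, y C -> z C) -> z A -> z B.
Proof.
  split.
  - intros H z Hz Hyz HA. apply (proj1 Hz), vd_mp with A; auto.
  - intros H. apply NNPP. intros N. destruct (lindenbaum (adjoin y A) B) as (z & Hz & Pz & NB & _).
    + intros HB. now apply N, mem, vd_imp.
    + apply NB, (H z Pz); [intros C HC|]; apply Hz; [now left|now right].
Qed.

Lemma prime_bigIOr l : y (bigIOr l) <-> exists A, In A l /\ y A.
Proof.
  unfold bigIOr. induction l as [|A l IH]; simpl.
  - split; [intros H; now apply (proj1 (proj2 Hy)) in H|now intros (A & [] & _)].
  - destruct l as [|B l].
    + split; [eauto|]. now intros (B & [<-|[]] & HB).
    + rewrite prime_or, IH. split.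
      * intros [HA|(C & HC & HyC)]; eauto.
      * intros (C & [<-|HC] & HyC); eauto.
Qed.

Lemma prime_bigIAnd l : y (bigIAnd l) <-> forall A, In A l -> y A.
Proof.
  unfold bigIAnd. induction l as [|A l IH]; simpl.
  - split; [easy|intros; apply prime_top].
  - destruct l as [|B l].
    + split; [now intros HA B [<-|[]]|auto].
    + rewrite prime_and, IH. split.
      * intros [HA H] C [<-|HC]; auto.
      * intros H. split; [|intros C HC]; apply H; auto.
Qed.
End PrimeTheory.
End SuperIntuitionistic.

Arguments lindenbaum {vd} Hvd X d _.
Arguments prime_imp {vd} Hvd {y} Hy A B.
Arguments prime_top {vd} Hvd {y} Hy.
Arguments prime_and {vd} Hvd {y} Hy A B.
Arguments prime_or {vd} Hvd {y} Hy A B.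
Arguments prime_bigIOr {vd} Hvd {y} Hy l.
Arguments prime_bigIAnd {vd} Hvd {y} Hy l.

(* [L y a] and [Tp y] say that the point [y] of the canonical model above [w] is
   mapped to the leaf [a], or to the top, by a p-morphism. *)
Lemma p_morphism_truth vd (Hvd : super_intuitionistic vd) m t K v
    (w : iform -> Prop) (L : (iform -> Prop) -> (var -> bool) -> Prop)
    (Tp : (iform -> Prop) -> Prop) (sigma : var -> iform) :
  let above y z := prime_theory vd z /\ forall C : iform, y C -> z C in
  prime_theory vd w -> K <> [] ->
  (forall y, above w y -> (forall A, y A -> w A) \/ Tp y \/ exists a, In a K /\ L y a) ->
  (forall y, Tp y -> m = false) ->
  (forall y z, above w y -> above y z -> Tp y -> Tp z) ->
  (forall y z a, above w y -> above y z -> L y a -> Tp z \/ L z a) ->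
  (forall y a, m = false -> above w y -> L y a -> exists z, above y z /\ Tp z) ->
  (forall a, In a K -> exists y, above w y /\ L y a) ->
  (forall y x, above w y -> Tp y -> (y (sigma x) <-> t x = true)) ->
  (forall y a x, above w y -> L y a -> (y (sigma x) <-> a x = true)) ->
  (forall x, w (sigma x) <-> v x = true) ->
  forall A, w (isubst sigma A) <-> forces m t K v A.
Proof.
  intros above Hw HK Hcover HTm HTup HLup HLT HL ST SL Sw.
  assert (trans : forall x y z, above x y -> above y z -> above x z).
  { intros x y z [_ H1] [P H2]. split; auto. }
  assert (self : forall x y, above x y -> above y y) by (intros x y [P _]; now split).
  assert (Top : forall A y, above w y -> Tp y ->
            (y (isubst sigma A) <-> top_eval m t A = true)).
  { intros A y Hwy HT. unfold top_eval. rewrite (HTm y HT). simpl. revert y Hwy HT.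
    induction A as [x| | |A IHA B IHB|A IHA B IHB|A IHA B IHB]; intros y Hwy HT; simpl.
    - now apply ST.
    - destruct Hwy as [[_ [N _]] _]. split; [tauto|discriminate].
    - split; [reflexivity|]. intros _. apply (prime_top Hvd (proj1 Hwy)).
    - rewrite (prime_and Hvd (proj1 Hwy)), andb_true_iff, IHA, IHB; tauto.
    - rewrite (prime_or Hvd (proj1 Hwy)), orb_true_iff, IHA, IHB; tauto.
    - rewrite (prime_imp Hvd (proj1 Hwy)), implb_true_iff. split.
      + intros H HA. apply IHB with y; auto. apply H; auto.
        * apply Hwy.
        * now apply IHA.
      + intros H z Pz Hyz HA. assert (Z : above y z) by now split.
        apply IHB; eauto. apply H. apply IHA with z; eauto. }
  assert (Leaf : forall A y a, above w y -> L y a ->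
            (y (isubst sigma A) <-> leaf_eval (top_eval m t) a A = true)).
  { induction A as [x| | |A IHA B IHB|A IHA B IHB|A IHA B IHB]; intros y a Hwy Ha; simpl.
    - now apply SL.
    - destruct Hwy as [[_ [N _]] _]. split; [tauto|discriminate].
    - split; [reflexivity|]. intros _. apply (prime_top Hvd (proj1 Hwy)).
    - rewrite (prime_and Hvd (proj1 Hwy)), andb_true_iff, (IHA y a), (IHB y a); tauto.
    - rewrite (prime_or Hvd (proj1 Hwy)), orb_true_iff, (IHA y a), (IHB y a); tauto.
    - rewrite (prime_imp Hvd (proj1 Hwy)), andb_true_iff, !implb_true_iff. split.
      + intros H. split.
        * intros HA. destruct m eqn:Em; [reflexivity|].
          destruct (HLT y a eq_refl Hwy Ha) as (z & Hyz & Tz).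
          assert (Hwz : above w z) by eauto.
          apply Top with z; auto. apply H; [apply Hyz..|]. now apply Top.
        * intros HA. apply IHB with y; auto. apply H; auto.
          -- apply Hwy.
          -- now apply IHA with a.
      + intros [HT Hl] z Pz Hyz HA. assert (Z : above y z) by now split.
        destruct (HLup y z a Hwy Z Ha) as [Tz|Lz].
        * apply Top; eauto. apply HT. apply Top with z; eauto.
        * apply (IHB z a); eauto. apply Hl. apply IHA with z; eauto. }
  assert (W : above w w) by now split.
  induction A as [x| | |A IHA B IHB|A IHA B IHB|A IHA B IHB];
    unfold forces in *; simpl.
  - apply Sw.
  - destruct Hw as [_ [N _]]. split; [tauto|discriminate].
  - split; [reflexivity|]. intros _. apply (prime_top Hvd Hw).
  - rewrite (prime_and Hvd Hw), andb_true_iff. tauto.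
  - rewrite (prime_or Hvd Hw), orb_true_iff. tauto.
  - change (w (isubst sigma (IImp A B)) <-> forallb (fun a =>
      leaf_eval (top_eval m t) a (IImp A B)) K &&
      implb (root_eval (top_eval m t) K v A) (root_eval (top_eval m t) K v B) = true).
    rewrite andb_true_iff, forallb_forall, implb_true_iff. split.
    + intros H. split.
      * intros a Ha. destruct (HL a Ha) as (y & Hwy & Hy). apply Leaf with y; auto.
        now apply Hwy.
      * simpl in H. rewrite (prime_imp Hvd Hw) in H. intros HA. apply IHB, H; auto.
        now apply IHA.
    + intros [HF HR]. simpl. apply (prime_imp Hvd Hw). intros z Pz Hwz HA.
      assert (Z : above w z) by now split.
      assert (imp : forall a, In a K ->
        implb (top_eval m t A) (top_eval m t B) = true /\
        implb (leaf_eval (top_eval m t) a A) (leaf_eval (top_eval m t) a B) = true).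
      { intros a Ha. apply andb_true_iff. now apply HF. }
      destruct (Hcover z Z) as [Hzw|[Tz|(a & Ha & Lz)]].
      * apply Hwz, IHB, HR, IHA, Hzw, HA.
      * destruct K as [|a K]; [easy|]. apply Top; auto.
        eapply implb_true_iff; [apply (imp a); now left|]. now apply Top with z.
      * apply Leaf with a; auto.
        eapply implb_true_iff; [now apply (imp a)|]. now apply Leaf with z.
Qed.

Lemma classical_partition {A : Type} (P : A -> Prop) (l : list A) : NoDup l ->
  exists l1 l2, length l = length l1 + length l2 /\ NoDup l1 /\ NoDup l2 /\
    (forall x, In x l1 <-> In x l /\ P x) /\ (forall x, In x l2 <-> In x l /\ ~ P x).
Proof.
  induction 1 as [|a l Ha Hl (l1 & l2 & E & N1 & N2 & H1 & H2)].
  - exists [], []. repeat split; try constructor; simpl; tauto.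
  - destruct (classic (P a)) as [Pa|Pa].
    + exists (a :: l1), l2. split; [simpl; lia|]. split.
      { constructor; [rewrite H1; tauto|exact N1]. }
      split; [exact N2|]. split; intros x; simpl; rewrite ?H1, ?H2;
        intuition (subst; tauto).
    + exists l1, (a :: l2). split; [simpl; lia|]. split; [exact N1|]. split.
      { constructor; [rewrite H2; tauto|exact N2]. }
      split; intros x; simpl; rewrite ?H1, ?H2; intuition (subst; tauto).
Qed.

(** Indices outside [J] are sent to leaves too, since theories containing such a p_j also need an
    image. *)
Lemma onto_function {A : Type} (K : list A) (J : list nat) : NoDup J -> K <> [] ->
  length K <= length J ->
  exists F : nat -> A, (forall j, In (F j) K) /\ forall a, In a K -> exists j, In j J /\ F j = a.
Proof.
  revert J. induction K as [|a K IH]; intros J NJ HK L; [easy|].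
  destruct J as [|j0 J]; [simpl in L; lia|]. inversion_clear NJ as [|? ? Nj NJ'].
  destruct K as [|b K].
  - exists (fun _ => a). split; [intros; now left|]. intros ? [<-|[]].
    exists j0. split; [now left|reflexivity].
  - destruct (IH J NJ') as (F & H1 & H2); [easy|simpl in *; lia|].
    exists (fun j => if Nat.eq_dec j j0 then a else F j). split.
    + intros j. destruct Nat.eq_dec; [now left|right; apply H1].
    + intros c [<-|Hc].
      * exists j0. split; [now left|]. now destruct Nat.eq_dec.
      * destruct (H2 c Hc) as (j & Hj & E). exists j. split; [now right|].
        destruct Nat.eq_dec; [congruence|exact E].
Qed.

(** * Forks from a refuted instance of T_k *)

Section Branching.
Variable vd : consequence Limp.
Hypothesis Hvd : super_intuitionistic vd.
Variables (k : nat) (p : nat -> iform).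
Let ix := seq 0 (S k).
Let d := bigIOr (map p ix).

Definition overlap : iform :=
  bigIOr (map (fun ij => IAnd (p (fst ij)) (p (snd ij)))
    (filter (fun ij => negb (fst ij =? snd ij)) (list_prod ix ix))).
Let mu := overlap.
Let nmu := IImp overlap IBot.

(** The i-th conjunct of the antecedent keeps p_i → \/_{j≠i} p_j out of [w], since otherwise [d]
    would follow; this yields a point with p_i and no other p_j. *)
Lemma refuting_theory : ~ vd nothing (T_axiom k p) ->
  exists w, prime_theory vd w /\ ~ w d /\
    (forall y, prime_theory vd y -> (forall C, w C -> y C) ->
       (forall C, y C -> w C) \/ y d) /\
    forall i, In i ix -> exists y, prime_theory vd y /\ (forall C, w C -> y C) /\
      y (p i) /\ forall j, In j ix -> j <> i -> ~ y (p j).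
Proof.
  intros HT. set (H := bigIAnd (map (fun i =>
     ((p i → bigIOr (map p (filter (fun j => negb (j =? i)) ix))) → d)%imf) ix)).
  destruct (lindenbaum Hvd (adjoin nothing H) d) as (w & Hw & Pw & Nd & M).
  { intros D. now apply HT, (vd_imp _ Hvd). }
  exists w. split; [exact Pw|]. split; [exact Nd|]. split.
  - intros y Py Hwy. destruct (classic (forall C, y C -> w C)) as [E|E]; [now left|right].
    apply not_all_ex_not in E as (C & E). apply imply_to_and in E as [HC NC].
    apply (proj1 Py). apply (vd_mono _ Hvd (adjoin w C)); [|now apply M].
    intros B [HB| ->]; auto.
  - intros i Hi. assert (HH : w H) by (apply Hw; now right).
    apply (prime_bigIAnd Hvd Pw) with (A := ((p i →
      bigIOr (map p (filter (fun j => negb (j =? i)) ix))) → d)%imf) in HH;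
      [|apply in_map_iff; now exists i].
    apply NNPP. intros N. apply Nd.
    apply (proj1 (prime_imp Hvd Pw _ _) HH w Pw (fun _ HC => HC)).
    apply (prime_imp Hvd Pw). intros y Py Hwy Hpi. apply (prime_bigIOr Hvd Py).
    apply NNPP. intros N'. apply N. exists y. repeat split; auto; try apply Py.
    intros j Hj Hji Hpj. apply N'. exists (p j). split; [|exact Hpj].
    apply in_map, filter_In. split; [exact Hj|]. apply negb_true_iff, Nat.eqb_neq, Hji.
Qed.

Section Root.
Variable w : iform -> Prop.
Hypothesis Pw : prime_theory vd w.
Hypothesis Nd : ~ w d.
Hypothesis Hmax : forall y, prime_theory vd y -> (forall C, w C -> y C) ->
  (forall C, y C -> w C) \/ y d.
Hypothesis Hexcl : forall i, In i ix -> exists y, prime_theory vd y /\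
  (forall C, w C -> y C) /\ y (p i) /\ forall j, In j ix -> j <> i -> ~ y (p j).

Lemma mem_d y : prime_theory vd y -> (y d <-> exists i, In i ix /\ y (p i)).
Proof.
  intros Py. unfold d. rewrite (prime_bigIOr Hvd Py). split.
  - intros (A & HA & H). apply in_map_iff in HA as (i & <- & Hi). eauto.
  - intros (i & Hi & H). exists (p i). split; [now apply in_map|exact H].
Qed.

Lemma mem_mu y : prime_theory vd y ->
  (y mu <-> exists i j, In i ix /\ In j ix /\ i <> j /\ y (p i) /\ y (p j)).
Proof.
  intros Py. unfold mu, overlap. rewrite (prime_bigIOr Hvd Py). split.
  - intros (A & HA & H). apply in_map_iff in HA as ([i j] & <- & Hij).
    apply filter_In in Hij as [H1 H2]. apply in_prod_iff in H1.
    apply negb_true_iff, Nat.eqb_neq in H2. apply (prime_and Hvd Py) in H.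
    exists i, j. simpl in *. tauto.
  - intros (i & j & Hi & Hj & Hij & H1 & H2). exists (IAnd (p i) (p j)).
    split; [|now apply (prime_and Hvd Py)]. apply in_map_iff. exists (i, j).
    split; [reflexivity|]. apply filter_In. split; [now apply in_prod|].
    now apply negb_true_iff, Nat.eqb_neq.
Qed.

Lemma mu_nmu y : prime_theory vd y -> y mu -> y nmu -> False.
Proof.
  intros Py H1 H2. apply (proj1 (proj2 Py)). apply (proj1 Py).
  apply (vd_mp _ Hvd _ mu); apply (cr_refl _ (proj1 Hvd)); assumption.
Qed.

Lemma w_not_p i : In i ix -> ~ w (p i).
Proof. intros Hi H. apply Nd, mem_d; eauto. Qed.

Lemma w_not_mu : ~ w mu.
Proof.
  intros H. apply mem_mu in H as (i & _ & Hi & _ & _ & H & _); [|exact Pw].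
  now apply (w_not_p i).
Qed.

(** Above [w], each j in [J] owns the points with p_j /\ ~mu. All other proper extensions contain
    [other] and join the leaf of [j0]. These pieces are defined by formulas, exclude each other and
    persist upwards, so every point has a leaf and keeps it. *)
Lemma fork_truth t K v (J : list nat) : is_model true t K v -> NoDup J ->
  length K <= length J ->
  (forall j, In j J -> In j ix /\ w (IImp (p j) (IOr mu nmu))) ->
  exists sigma, forall A, w (isubst sigma A) <-> forces true t K v A.
Proof.
  intros (HK & Hv & _) NJ LJ HJ.
  destruct (onto_function K J NJ HK LJ) as (F & HF & Honto).
  assert (exists j0, In j0 J) as (j0 & Hj0).
  { destruct J as [|j J]; [destruct K; simpl in LJ; [easy|lia]|]. exists j. now left. }
  set (rest := filter (fun j => if in_dec Nat.eq_dec j J then false else true) ix).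
  assert (Hrest : forall j, In j rest <-> In j ix /\ ~ In j J).
  { intros j. unfold rest. rewrite filter_In. destruct in_dec; intuition discriminate. }
  set (O := fun j => IAnd (p j) nmu).
  set (other := IOr mu (bigIOr (map p rest))).
  exists (fun x => if v x then ITop else
    IOr (bigIOr (map O (filter (fun j => F j x) J))) (if F j0 x then other else IBot)).
  assert (HO : forall y j, prime_theory vd y -> (y (O j) <-> y (p j) /\ y nmu)).
  { intros y j Py. apply (prime_and Hvd Py). }
  assert (Hother : forall y, prime_theory vd y ->
    (y other <-> y mu \/ exists j, In j ix /\ ~ In j J /\ y (p j))).
  { intros y Py. unfold other. rewrite (prime_or Hvd Py), (prime_bigIOr Hvd Py).
    apply or_iff_compat_l. split.
    - intros (A & HA & H). apply in_map_iff in HA as (j & <- & Hj). apply Hrest in Hj.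
      exists j. tauto.
    - intros (j & Hj & NJj & H). exists (p j). split; [|exact H].
      apply in_map, Hrest. tauto. }
  assert (uniq : forall y j j', prime_theory vd y -> In j J -> In j' ix ->
    y (O j) -> y (p j') -> j = j').
  { intros y j j' Py Hj Hj' H1 H2. apply HO in H1 as [H1 H3]; [|exact Py].
    apply NNPP. intros N. apply (mu_nmu y Py); [|exact H3]. apply mem_mu; [exact Py|].
    exists j, j'. repeat split; auto. now apply HJ. }
  assert (disj : forall y j, prime_theory vd y -> In j J -> y (O j) -> y other -> False).
  { intros y j Py Hj H1 H2. apply Hother in H2 as [H2|(j' & Hj' & NJj & H2)]; [| |exact Py].
    - apply HO in H1 as [_ H1]; [|exact Py]. now apply (mu_nmu y Py).
    - rewrite (uniq y j j' Py Hj Hj' H1 H2) in Hj. contradiction. }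
  apply (p_morphism_truth vd Hvd true t K v w (fun y a =>
    (exists j, In j J /\ y (O j) /\ a = F j) \/ y other /\ a = F j0) (fun _ => False));
    try easy.
  - intros y [Py Hwy]. destruct (Hmax y Py Hwy) as [H|H]; [now left|right; right].
    apply mem_d in H as (j & Hj & H); [|exact Py].
    destruct (in_dec Nat.eq_dec j J) as [HjJ|NjJ].
    + destruct (HJ j HjJ) as [_ Himp].
      assert (Himp' := proj1 (prime_imp Hvd Pw _ _) Himp y Py Hwy H).
      apply (prime_or Hvd Py) in Himp' as [Hmu|Hnmu].
      * exists (F j0). split; [apply HF|]. right. split; [|reflexivity].
        apply Hother; auto.
      * exists (F j). split; [apply HF|]. left. exists j.
        split; [exact HjJ|]. split; [|reflexivity]. apply HO; auto.
    + exists (F j0). split; [apply HF|]. right. split; [|reflexivity].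
      apply Hother; [exact Py|]. right. eauto.
  - intros y z a _ [_ Hyz] [(j & Hj & H & E)|[H E]]; right; [left|right]; eauto.
  - intros a Ha. destruct (Honto a Ha) as (j & Hj & <-).
    destruct (HJ j Hj) as [Hjx Himp].
    (* A point with p_j alone does not contain mu, hence by the assumption on j it contains ~mu. *)
    destruct (Hexcl j Hjx) as (y & Py & Hwy & Hpj & Hex). exists y.
    split; [now split|]. left. exists j. split; [exact Hj|]. split; [|reflexivity].
    apply HO; [exact Py|]. split; [exact Hpj|].
    assert (Himp' := proj1 (prime_imp Hvd Pw _ _) Himp y Py Hwy Hpj).
    apply (prime_or Hvd Py) in Himp' as [Hmu|Hnmu]; [exfalso|exact Hnmu].
    apply mem_mu in Hmu as (i & i' & Hi & Hi' & Hne & H1 & H2); [|exact Py].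
    destruct (Nat.eq_dec i j) as [->|N]; [|now apply (Hex i)].
    apply (Hex i'); auto.
  - intros y a x [Py Hwy] HL. destruct (v x) eqn:Ev.
    { split; [intros _|intros _; apply (prime_top Hvd Py)].
      apply Hv; [|exact Ev]. destruct HL as [(j & _ & _ & ->)|[_ ->]]; apply HF. }
    rewrite (prime_or Hvd Py), (prime_bigIOr Hvd Py). split.
    + intros [(A & HA & H)|H].
      * apply in_map_iff in HA as (j & <- & Hj). apply filter_In in Hj as [Hj E].
        destruct HL as [(j' & Hj' & H' & ->)|[H' _]].
        -- assert (j' = j) as ->; [|exact E]. apply (uniq y); auto; [now apply HJ|].
           now apply HO in H.
        -- exfalso. eauto.
      * destruct (F j0 x) eqn:E; [|now apply (proj1 (proj2 Py)) in H].
        destruct HL as [(j & Hj & H' & ->)|[_ ->]]; [exfalso; eauto|exact E].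
    + intros E. destruct HL as [(j & Hj & H & ->)|[H ->]].
      * left. exists (O j). split; [|exact H]. apply in_map, filter_In. auto.
      * right. now rewrite E.
  - intros x. destruct (v x) eqn:Ev.
    { split; [reflexivity|intros _; apply (prime_top Hvd Pw)]. }
    rewrite (prime_or Hvd Pw), (prime_bigIOr Hvd Pw). split; [|discriminate].
    intros [(A & HA & H)|H]; exfalso.
    + apply in_map_iff in HA as (j & <- & Hj). apply filter_In in Hj as [Hj _].
      apply HO in H as [H _]; [|exact Pw]. apply (w_not_p j); [now apply HJ|exact H].
    + destruct (F j0 x); [|now apply (proj1 (proj2 Pw)) in H].
      apply Hother in H as [H|(j & Hj & _ & H)]; [| |exact Pw].
      * now apply w_not_mu.
      * now apply (w_not_p j).
Qed.

(** Proper extensions containing T = mu \/ ~mu form the top. One without T contains exactly one p_j,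
    as two would give mu, and goes to the leaf of j. Since it lacks ~mu, it has an extension with
    mu, so the leaf sees the top. *)
Lemma fan_truth t K v (J : list nat) : is_model false t K v -> NoDup J ->
  length K <= length J ->
  (forall j, In j J -> In j ix /\ ~ w (IImp (p j) (IOr mu nmu))) ->
  exists sigma, forall A, w (isubst sigma A) <-> forces false t K v A.
Proof.
  intros (HK & Hv & Ht) NJ LJ HJ.
  destruct (onto_function K J NJ HK LJ) as (F & HF & Honto).
  set (T := IOr mu nmu).
  assert (exists j, In j J) as (j0 & Hj0).
  { destruct J as [|j J]; [destruct K; simpl in LJ; [easy|lia]|]. exists j. now left. }
  assert (HJ' : forall j, In j J -> exists y, prime_theory vd y /\
            (forall C, w C -> y C) /\ y (p j) /\ ~ y T).
  { intros j Hj. destruct (HJ j Hj) as [_ H]. apply NNPP. intros N. apply H.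
    apply (prime_imp Hvd Pw). intros y Py Hwy Hp. apply NNPP. intros NT.
    apply N. eauto. }
  assert (NwT : ~ w T).
  { intros H. destruct (HJ' j0 Hj0) as (y & _ & Hwy & _ & NT). auto. }
  assert (uniq : forall y j j', prime_theory vd y -> In j ix -> In j' ix ->
    ~ y T -> y (p j) -> y (p j') -> j = j').
  { intros y j j' Py Hj Hj' NT H1 H2. apply NNPP. intros N. apply NT.
    apply (prime_or Hvd Py). left. apply mem_mu; [exact Py|].
    exists j, j'. auto. }
  exists (fun x => if v x then ITop else
    IOr (bigIOr (map p (filter (fun j => F j x) ix))) (if t x then T else IBot)).
  assert (HFt : forall j x, F j x = true -> t x = true).
  { intros j x E. exact (Ht (F j) x (HF j) E). }
  apply (p_morphism_truth vd Hvd false t K v w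
    (fun y a => exists j, In j ix /\ y (p j) /\ ~ y T /\ a = F j)
    (fun y => y d /\ y T)); auto.
  - intros y [Py Hwy]. destruct (Hmax y Py Hwy) as [H|H]; [now left|right].
    destruct (classic (y T)) as [HT|NT]; [now left|right].
    apply mem_d in H as (j & Hj & H); [|exact Py].
    exists (F j). split; [apply HF|]. eauto.
  - intros y z _ [_ Hyz] [H1 H2]. auto.
  - intros y z a [Py Hwy] [Pz Hyz] (j & Hj & H & NT & ->).
    destruct (classic (z T)) as [HT|NT']; [left|right; eauto 6].
    split; [|exact HT]. apply mem_d; eauto.
  - intros y a _ [Py Hwy] (j & Hj & H & NT & ->).
    assert (exists z, prime_theory vd z /\ (forall C, y C -> z C) /\ z mu)
      as (z & Pz & Hyz & Hmu).
    { apply NNPP. intros N. apply NT. apply (prime_or Hvd Py). right.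
      apply (prime_imp Hvd Py). intros z Pz Hyz Hmu. exfalso. eauto. }
    exists z. split; [now split|]. split; [apply mem_d; eauto|].
    apply (prime_or Hvd Pz). now left.
  - intros a Ha. destruct (Honto a Ha) as (j & Hj & <-).
    destruct (HJ' j Hj) as (y & Py & Hwy & Hp & NT). exists y. split; [now split|].
    exists j. repeat split; auto. now apply HJ.
  - intros y x [Py Hwy] [Hd HT]. destruct (v x) eqn:Ev.
    { split; [intros _|intros _; apply (prime_top Hvd Py)].
      apply (HFt j0), Hv; auto. }
    rewrite (prime_or Hvd Py), (prime_bigIOr Hvd Py). split.
    + intros [(A & HA & H)|H].
      * apply in_map_iff in HA as (j & <- & Hj). apply filter_In in Hj as [Hj E].
        now apply (HFt j).
      * destruct (t x); [reflexivity|now apply (proj1 (proj2 Py)) in H].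
    + intros ->. now right.
  - intros y a x [Py Hwy] (j & Hj & H & NT & ->). destruct (v x) eqn:Ev.
    { split; [intros _|intros _; apply (prime_top Hvd Py)]. apply Hv; auto. }
    rewrite (prime_or Hvd Py), (prime_bigIOr Hvd Py). split.
    + intros [(A & HA & H')|H'].
      * apply in_map_iff in HA as (j' & <- & Hj'). apply filter_In in Hj' as [Hj' E].
        now rewrite (uniq y j j').
      * destruct (t x); [contradiction|now apply (proj1 (proj2 Py)) in H'].
    + intros E. left. exists (p j). split; [|exact H]. apply in_map, filter_In. auto.
  - intros x. destruct (v x) eqn:Ev.
    { split; [reflexivity|intros _; apply (prime_top Hvd Pw)]. }
    rewrite (prime_or Hvd Pw), (prime_bigIOr Hvd Pw). split; [|discriminate].
    intros [(A & HA & H)|H]; exfalso.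
    + apply in_map_iff in HA as (j & <- & Hj). apply filter_In in Hj as [Hj _].
      now apply (w_not_p j).
    + destruct (t x); [contradiction|now apply (proj1 (proj2 Pw)) in H].
Qed.
End Root.
End Branching.

(** Branching speaks of all theorems of T_k; this reduces it to instances of the axiom, so infinite
    branching refutes such an instance for every k. *)
Lemma T_axioms_branching vd k : super_intuitionistic vd ->
  (forall p, vd nothing (T_axiom k p)) -> has_branching (logic_of vd) k.
Proof.
  intros Hvd H A HA. unfold T_, IPC_plus in HA. simpl.
  enough (G : forall s, Defs.derivable (fun s => LJ_init s \/ exists g,
      (exists p, g = T_axiom k p) /\ s = ([] ⇒ Some g)%seq) LJ_rule s ->
      vd (elems (fst s)) (match snd s with Some phi => phi | None => IBot end)).
  { apply (vd_mono _ Hvd (elems [])); [intros B []|]. exact (G _ HA). }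
  induction 1 as [s [Hs|(g & (p & ->) & ->)]|prems s Hr _ IH].
  - now apply (proj1 (proj2 Hvd)).
  - apply (vd_mono _ Hvd nothing); [intros B []|]. apply H.
  - now apply (proj2 (proj2 Hvd) prems).
Qed.

(** One [m] has to serve all theorems. Otherwise there are counterexamples of both kinds, and k is
    chosen as their total number of leaves: among the k + 1 formulas p_i, one kind is frequent
    enough to realize its counterexample at [w], which contains every instance of a theorem. *)
Theorem branching_dichotomy vd : super_intuitionistic vd ->
  infinite_branching (logic_of vd) ->
  exists m, forall A, vd nothing A ->
    forall t K v, is_model m t K v -> forces m t K v A.
Proof.
  intros Hvd Hbr. apply NNPP. intros N.
  assert (R : forall m, exists A t K v,
    vd nothing A /\ is_model m t K v /\ ~ forces m t K v A).
  { intros m. apply NNPP. intros N'. apply N. exists m. intros A HA t K v HM.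
    apply NNPP. intros NF. apply N'. eauto 8. }
  destruct (R true) as (A1 & t1 & K1 & v1 & HA1 & M1 & F1).
  destruct (R false) as (A2 & t2 & K2 & v2 & HA2 & M2 & F2). clear R N.
  set (k := length K1 + length K2).
  assert (exists p, ~ vd nothing (T_axiom k p)) as (p & Hp).
  { apply NNPP. intros N. apply (Hbr k), T_axioms_branching; [exact Hvd|].
    intros p. apply NNPP. eauto. }
  destruct (refuting_theory vd Hvd k p Hp) as (w & Pw & Nd & Hmax & Hexcl).
  assert (no : forall m t K v A, vd nothing A -> ~ forces m t K v A ->
    (exists sigma, forall B, w (isubst sigma B) <-> forces m t K v B) -> False).
  { intros m t K v A HA NF (sigma & Hs). apply NF, Hs, (proj1 Pw).
    apply (vd_mono _ Hvd (fun psi => exists chi, nothing chi /\ psi = isubst sigma chi)).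
    - now intros B (C & [] & _).
    - exact (cr_subst _ (proj1 Hvd) sigma nothing A HA). }
  destruct (classical_partition (fun j => w (IImp (p j) (IOr (overlap k p)
    (IImp (overlap k p) IBot)))) (seq 0 (S k)) (seq_NoDup _ _))
    as (l1 & l2 & E & N1 & N2 & H1 & H2).
  rewrite length_seq in E.
  destruct (le_lt_dec (length K1) (length l1)) as [L|L].
  - apply (no true t1 K1 v1 A1 HA1 F1).
    apply (fork_truth vd Hvd k p w Pw Nd Hmax Hexcl t1 K1 v1 l1); auto.
    intros j Hj. now apply H1.
  - apply (no false t2 K2 v2 A2 HA2 F2).
    apply (fan_truth vd Hvd k p w Pw Nd Hmax t2 K2 v2 l2); auto; [lia|].
    intros j Hj. now apply H2.
Qed.

(** * Substructural logics and extension axioms *)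

(* The translation [tr], except that 0 becomes top when [z = true]: this is
   needed for the calculi in which 0 and 1 are equivalent. *)
Fixpoint trz (z : bool) (A : sform) : iform :=
  match A with
  | SVar x => IVar x
  | SZero => if z then ITop else IBot
  | SOne => ITop
  | SAnd A B => IAnd (trz z A) (trz z B)
  | SOr A B => IOr (trz z A) (trz z B)
  | SFus A B => IAnd (trz z A) (trz z B)
  | SUnder A B => IImp (trz z A) (trz z B)
  | SOver B A => IImp (trz z A) (trz z B)
  end.

Lemma trz_subst z sigma A :
  trz z (ssubst sigma A) = isubst (fun x => trz z (sigma x)) (trz z A).
Proof. induction A; simpl; try congruence. now destruct z. Qed.

Lemma trz_occurs z x A : ioccurs x (trz z A) -> soccurs x A.
Proof. induction A; simpl; try tauto. now destruct z. Qed.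

(** * Soundness of the substructural calculi for forks *)

Definition point (t : var -> bool) (K : list (var -> bool)) (v : var -> bool)
    (e : iform -> bool) : Prop :=
  e = root_eval (top_eval true t) K v \/
  exists a, In a K /\ e = leaf_eval (top_eval true t) a.

Section Points.
Variables (t : var -> bool) (K : list (var -> bool)) (v : var -> bool).
Hypothesis HM : is_model true t K v.

Section Point.
Variable e : iform -> bool.
Hypothesis He : point t K v e.

Lemma point_top : e ITop = true.
Proof. now destruct He as [->|(a & _ & ->)]. Qed.

Lemma point_bot : e IBot = false.
Proof. now destruct He as [->|(a & _ & ->)]. Qed.

Lemma point_and A B : e (IAnd A B) = true <-> e A = true /\ e B = true.
Proof. destruct He as [->|(a & _ & ->)]; apply andb_true_iff. Qed.

Lemma point_or A B : e (IOr A B) = true <-> e A = true \/ e B = true.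
Proof. destruct He as [->|(a & _ & ->)]; apply orb_true_iff. Qed.

Lemma point_mp A B : e (IImp A B) = true -> e A = true -> e B = true.
Proof.
  destruct He as [->|(a & _ & ->)]; simpl; rewrite ?andb_true_iff, !implb_true_iff; tauto.
Qed.

Lemma point_imp A B :
  (forall e', point t K v e' -> (forall C, e C = true -> e' C = true) ->
     e' A = true -> e' B = true) ->
  e (IImp A B) = true.
Proof.
  destruct He as [->|(a & Ha & ->)]; intros H.
  - change (forallb (fun a => leaf_eval (top_eval true t) a (IImp A B)) K &&
      implb (root_eval (top_eval true t) K v A) (root_eval (top_eval true t) K v B) = true).
    rewrite andb_true_iff, forallb_forall, implb_true_iff. split.
    + intros a Ha. simpl. apply implb_true_iff. apply H; [right; eauto|].
      intros C. apply root_eval_leaf; [exact Ha|]. intros x. now apply HM.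
    + apply H; auto.
  - simpl. apply implb_true_iff. apply H; auto.
Qed.
End Point.

Variable z : bool.

Definition context_true (e : iform -> bool) (G : list sform) : Prop :=
  Forall (fun A => e (trz z A) = true) G.

(** An empty succedent is read as 0. For [z = true] it is then always true, so the rule (o) has to
    be excluded in that case. *)
Definition satisfied (s : ssequent) : Prop :=
  forall e, point t K v e -> context_true e (fst s) ->
    e (trz z (match snd s with Some A => A | None => SZero end)) = true.

Lemma FL_init_sound s : FL_init s -> satisfied s.
Proof.
  intros [A| |] e He H; unfold context_true in H; simpl in *.
  - now inversion H.
  - now apply point_top.
  - now inversion H.
Qed.

Lemma FL_rule_sound S prems s : (z = true -> ~ S oweak) -> FL_rule S prems s ->
  (forall s', In s' prems -> satisfied s') -> satisfied s.
Proof.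
  intros HS Hr Hp e He H.
  assert (E : forall G D, In (G, D) prems -> context_true e G ->
    e (trz z (match D with Some A => A | None => SZero end)) = true).
  { intros G D HG. exact (Hp (G, D) HG e He). }
  assert (Himp : forall G A B, context_true e G ->
    (forall e', point t K v e' -> context_true e' G -> e' (trz z A) = true ->
       e' (trz z B) = true) -> e (IImp (trz z A) (trz z B)) = true).
  { intros G A B HG HAB. apply point_imp; [exact He|]. intros e' He' Hee' HA.
    apply HAB; auto. eapply Forall_impl; [|exact HG]. intros C. apply Hee'. }
  pose proof (point_top e He) as Htop. pose proof (point_bot e He) as Hbot.
  pose proof (point_and e He) as Hand. pose proof (point_or e He) as Hor.
  pose proof (point_mp e He) as Hmp.
  destruct Hr; simpl in H; unfold context_true in *;
    repeat rewrite ?Forall_app, ?Forall_cons_iff in H; simpl in H |- *;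
    try rewrite Hand in *; try rewrite Hor in *;
    try (apply (E _ _ (or_introl eq_refl));
         repeat rewrite ?Forall_app, ?Forall_cons_iff; tauto).
  - apply (E _ _ (or_intror (or_introl eq_refl))).
    repeat rewrite ?Forall_app, ?Forall_cons_iff. split; [tauto|]. split; [|tauto].
    apply (E _ _ (or_introl eq_refl)). tauto.
  - split; [apply (E _ _ (or_introl eq_refl))|
      apply (E _ _ (or_intror (or_introl eq_refl)))]; exact H.
  - destruct H as (H1 & [H2|H2] & H3);
      [apply (E _ _ (or_introl eq_refl))|apply (E _ _ (or_intror (or_introl eq_refl)))];
      repeat rewrite ?Forall_app, ?Forall_cons_iff; tauto.
  - left. exact (E _ _ (or_introl eq_refl) H).
  - right. exact (E _ _ (or_introl eq_refl) H).
  - split; [apply (E _ _ (or_introl eq_refl))|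
      apply (E _ _ (or_intror (or_introl eq_refl)))]; tauto.
  - apply (E _ _ (or_intror (or_introl eq_refl))).
    repeat rewrite ?Forall_app, ?Forall_cons_iff. split; [tauto|]. split; [|tauto].
    apply Hmp with (trz z phi); [tauto|]. apply (E _ _ (or_introl eq_refl)). tauto.
  - apply Himp with G; [exact H|]. intros e' He' HG HA.
    apply (Hp _ (or_introl eq_refl) e' He'). simpl. unfold context_true.
    repeat rewrite ?Forall_app, ?Forall_cons_iff. auto.
  - apply (E _ _ (or_intror (or_introl eq_refl))).
    repeat rewrite ?Forall_app, ?Forall_cons_iff. split; [tauto|]. split; [|tauto].
    apply Hmp with (trz z phi); [tauto|]. apply (E _ _ (or_introl eq_refl)). tauto.
  - apply Himp with G; [exact H|]. intros e' He' HG HA.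
    apply (Hp _ (or_introl eq_refl) e' He'). simpl. unfold context_true.
    repeat rewrite ?Forall_app, ?Forall_cons_iff. auto.
  - exfalso. pose proof (E _ _ (or_introl eq_refl) H) as F. simpl in F.
    destruct z; [now apply HS|congruence].
Qed.

Lemma provable_sound C s : (z = true -> ~ str C oweak) ->
  (forall s, extra C s -> satisfied s) -> provable C s -> satisfied s.
Proof.
  intros HS HE. induction 1 as [s [Hs|Hs]|prems s Hr _ IH].
  - now apply FL_init_sound.
  - now apply HE.
  - now apply FL_rule_sound with (str C) prems.
Qed.

Lemma iff_seq_sound A B s :
  (forall e, point t K v e -> e (trz z A) = e (trz z B)) -> iff_seq A B s -> satisfied s.
Proof.
  intros H [->| ->] e He HG; unfold context_true in HG; simpl in *;
    inversion HG; rewrite H in *; auto.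
Qed.

Lemma spow_value A n e : point t K v e -> 1 <= n ->
  e (trz z (spow A n)) = e (trz z A).
Proof.
  intros He. induction n as [|[|n] IH]; intros Hn; [lia|reflexivity|].
  apply eq_true_iff_eq.
  change (e (IAnd (trz z A) (trz z (spow A (S n)))) = true <-> e (trz z A) = true).
  rewrite (point_and e He), IH by lia. tauto.
Qed.

Lemma distributivity_sound s : distributivity s -> satisfied s.
Proof.
  intros (A & B & C & H). revert H. apply iff_seq_sound. intros e He.
  apply eq_true_iff_eq. simpl.
  repeat rewrite ?(point_and e He), ?(point_or e He). tauto.
Qed.

Lemma divisibility_sound s : divisibility s -> satisfied s.
Proof.
  assert (D : forall A B e, point t K v e ->
    (e (IAnd A B) = true <-> e A = true /\ e (IImp A B) = true)).
  { intros A B e He. rewrite (point_and e He). split; intros [H1 H2].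
    - split; [exact H1|]. apply point_imp; auto.
    - split; [exact H1|]. now apply (point_mp e He A B). }
  intros (A & B & [H|H]); revert H; apply iff_seq_sound; intros e He;
    apply eq_true_iff_eq; simpl; rewrite (D _ _ e He), (point_and e He); tauto.
Qed.
End Points.

(** With fusion as conjunction, the structural rules and added axioms hold intuitionistically; only
    0 ⇔ 1 needs [z = true], chosen for [RL] and its extensions, which lack the rule (o). *)
Lemma listed_sound C : listed C -> exists z, forall t K v, is_model true t K v ->
  forall s, provable C s -> satisfied t K v z s.
Proof.
  assert (RL_sound : forall t K v s, is_model true t K v ->
    iff_seq SZero SOne s -> satisfied t K v true s).
  { intros t K v s HM. apply iff_seq_sound. reflexivity. }
  intros [S| | | |n Hn| | | | | | |];
    [exists false|exists true|exists false|exists false|exists false|exists false|exists false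
    |exists true|exists true|exists true|exists true|exists true];
    intros t K v HM s; (apply provable_sound; [exact HM|now intros|]); cbn -[spow]; intros s'.
  - easy.
  - intros [[]|H]. now apply RL_sound.
  - intros [[]|(A & H)]. revert H. apply iff_seq_sound. reflexivity.
  - intros [[]|H]. now apply distributivity_sound.
  - intros [[]|(A & H)]. revert H. apply iff_seq_sound. intros e He.
    rewrite (spow_value t K v false A n e), (spow_value t K v false A (S n) e);
      (reflexivity || assumption || lia).
  - intros [[]|H]. now apply divisibility_sound.
  - intros [[]|(A & H)]. revert H. apply iff_seq_sound. intros e He.
    now rewrite (spow_value t K v false A 2 e) by (assumption || lia).
  - intros [[[]|H]|H]; [now apply RL_sound|now apply distributivity_sound].
  - intros [[[]|H]|(A & ->)]; [now apply RL_sound|]. intros e He _.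
    now apply (point_top t K v).
  - intros [[[]|H]|(A & B & H)]; [now apply RL_sound|]. revert H. apply iff_seq_sound.
    intros e He. apply eq_true_iff_eq. simpl. rewrite !(point_and t K v e He). tauto.
  - intros [[[]|H]|H]; [now apply RL_sound|now apply divisibility_sound].
  - intros [[[]|H]|(A & B & H)]; [now apply RL_sound|]. revert H. apply iff_seq_sound.
    reflexivity.
Qed.

Definition translated_rule (z : bool) (r : frule Lstar) : frule Limp :=
  @FRule Limp (map (trz z) (fprems r)) (trz z (fconcl r)).

(** Premises true at the root persist to the leaves, so they are satisfied as initial sequents at
    every point. *)
Lemma substructural_rule_valid C z (r : frule Lstar) :
  (forall t K v, is_model true t K v ->
     forall s, provable C s -> satisfied t K v z s) ->
  ent (substructural C) (elems (fprems r)) (fconcl r) ->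
  valid_rule true (translated_rule z r).
Proof.
  intros HC Hr t K v HM Hprems. simpl in *.
  apply (provable_sound t K v HM z) in Hr.
  - apply (Hr (root_eval (top_eval true t) K v)); [now left|constructor].
  - now intros _.
  - simpl. intros s [[]|(A & [HA|HA] & ->)].
    + intros e He _. simpl. assert (F := Hprems (trz z A) (in_map _ _ _ HA)).
      destruct He as [->|(a & Ha & ->)]; [exact F|].
      apply root_eval_leaf with K v; [exact Ha| |exact F]. intros x. now apply HM.
    + now apply HC.
Qed.

(** * Elimination of extension axioms *)

Definition extension_rule : frule Limp :=
  @FRule Limp [] (ext_axiom (l := Limp) (vp 0 0) (IVar (vp 0 0))).

Lemma extension_rule_valid m : valid_rule m extension_rule.
Proof.
  intros t K v (HK & Hv & Ht) _. unfold forces. simpl.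
  assert (E : forallb (fun a => implb (top_eval m t (IVar (vp 0 0)))
     (top_eval m t (IVar (vp 0 0))) && implb (a (vp 0 0)) (a (vp 0 0))) K = true).
  { apply forallb_forall. intros a _. now rewrite !implb_same. }
  now rewrite E, implb_same.
Qed.

Lemma isubst_agree sigma tau A : (forall x, ioccurs x A -> sigma x = tau x) ->
  isubst sigma A = isubst tau A.
Proof. induction A; simpl; intros H; f_equal; auto. Qed.

Lemma isubst_comp tau sigma A :
  isubst tau (isubst sigma A) = isubst (fun x => isubst tau (sigma x)) A.
Proof. induction A; simpl; congruence. Qed.

Lemma isubst_id tau A : (forall x, ioccurs x A -> tau x = IVar x) -> isubst tau A = A.
Proof. induction A; simpl; intros H; f_equal; auto. Qed.

Definition var_eq_dec (x y : var) : {x = y} + {x <> y}.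
Proof. decide equality; apply Nat.eq_dec. Defined.

(** Definitions are substituted in the order of the proof. A new variable occurs neither in earlier
    lines nor in the conclusion, so these keep their images, while p ≡ ψ becomes an instance of
    [extension_rule]. Formulas may grow exponentially, but only lines are counted. *)
Lemma extension_elimination (rs : list (frule Limp)) (pi : list iform) phi :
  is_ext_proof (F := Limp) (fun r => In r rs) nothing pi phi ->
  exists pi' : list iform, length pi' = length pi /\
    is_proof (F := Limp) (fun r => In r (extension_rule :: rs)) nothing pi' phi.
Proof.
  intros [[l0 El] H].
  assert (G : exists tau, (forall x, ioccurs x phi -> tau x = IVar x) /\
    forall l A l', map (isubst tau) pi = l ++ A :: l' ->
      inferred (F := Limp) (fun r => In r (extension_rule :: rs)) l A).
  { clear l0 El. induction pi as [|A pi IH] using rev_ind.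
    - exists IVar. split; [reflexivity|]. intros [|? ?] A l' E; discriminate.
    - destruct IH as (tau & Htau & IH).
      { intros l B l' ->. apply (H l B (l' ++ [A])). now rewrite <- app_assoc. }
      assert (K : exists tau', (forall x, ioccurs x phi -> tau' x = IVar x) /\
        map (isubst tau') pi = map (isubst tau) pi /\
        inferred (F := Limp) (fun r => In r (extension_rule :: rs))
          (map (isubst tau) pi) (isubst tau' A)).
      { destruct (H pi A [] eq_refl) as [[]|[(r & sigma & Hr & -> & Hp)|
          (p & psi & -> & H1 & H2 & _ & H4)]].
        - exists tau. split; [exact Htau|]. split; [reflexivity|].
          exists r, (fun x => isubst tau (sigma x)). split; [now right|].
          split; [apply isubst_comp|]. intros B HB. simpl. rewrite <- isubst_comp.
          apply in_map. now apply Hp.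
        - set (tau' := fun x => if var_eq_dec x p then isubst tau psi else tau x).
          assert (E : forall B, ~ ioccurs p B -> isubst tau' B = isubst tau B).
          { intros B HB. apply isubst_agree. intros x Hx. unfold tau'.
            destruct var_eq_dec as [->|]; [contradiction|reflexivity]. }
          exists tau'. split; [|split].
          + intros x Hx. unfold tau'. destruct var_eq_dec as [->|]; [contradiction|auto].
          + apply map_ext_in. intros B HB. apply E, (H2 B HB).
          + exists extension_rule, (fun _ => isubst tau psi). split; [now left|].
            split; [|easy]. simpl. rewrite (E psi H1). unfold tau'.
            now destruct var_eq_dec. }
      destruct K as (tau' & Htau' & Emap & Hinf). exists tau'. split; [exact Htau'|].
      intros l B l'. rewrite map_app, Emap. simpl. intros E.
      destruct l' as [|C l' _] using rev_ind.
      + apply app_inj_tail in E as [<- <-]. exact Hinf.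
      + rewrite app_comm_cons, app_assoc in E. apply app_inj_tail in E as [E _].
        now apply IH in E. }
  destruct G as (tau & Htau & G). exists (map (isubst tau) pi).
  split; [apply length_map|]. split.
  - exists (map (isubst tau) l0). rewrite El, map_app. simpl.
    now rewrite (isubst_id tau phi Htau).
  - intros l A l' E. right. now apply (G l A l').
Qed.

Lemma ext_proof_translation (rs : list (frule Lstar)) (P : inference_system Lstar) z
    (pi : list sform) phi :
  (forall r, P r -> In r rs) ->
  is_ext_proof (F := Lstar) P nothing pi phi ->
  is_ext_proof (F := Limp) (fun r => In r (map (translated_rule z) rs)) nothing
    (map (trz z) pi) (trz z phi).
Proof.
  intros HP [[l0 ->] H]. split; [exists (map (trz z) l0); now rewrite map_app|].
  intros l A l' E. apply map_eq_app in E as (l1 & l2 & E & <- & E2).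
  apply map_eq_cons in E2 as (B & l3 & -> & <- & <-). right.
  destruct (H l1 B l3 E) as [[]|[(r & sigma & Hr & -> & Hp)|(p & psi & -> & H1 & H2 & _ & H4)]].
  - left. exists (translated_rule z r), (fun x => trz z (sigma x)).
    split; [now apply in_map, HP|]. split; [apply trz_subst|].
    intros B HB. simpl in HB. apply in_map_iff in HB as (C & <- & HC). simpl.
    rewrite <- trz_subst. apply in_map. now apply Hp.
  - right. exists p, (trz z psi). split; [reflexivity|].
    split; [intros Hx; apply H1; now apply trz_occurs in Hx|]. split; [|split; [easy|]].
    + intros B HB. apply in_map_iff in HB as (C & <- & HC). intros Hx.
      apply (H2 C HC). now apply trz_occurs in Hx.
    + intros Hx. apply H4. now apply trz_occurs in Hx.
Qed.

Lemma proof_is_ext_proof {F : language} (P : inference_system F) X pi phi :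
  is_proof P X pi phi -> is_ext_proof P X pi phi.
Proof. intros [H1 H2]. split; [exact H1|]. intros l A l' E. destruct (H2 l A l' E); auto. Qed.

(** * The lower bound *)

Definition colour_choice (n k : nat) : sform :=
  bigSFus (map (fun '(i, l) => (s_ i l ∧ 1) ∨ (s'_ i l ∧ 1))%sf (pairs n k)).
Definition clique_choice (n k : nat) : sform :=
  bigSFus (map (fun '(i, l) => (r_ i l ∧ 1) ∨ (r'_ i l ∧ 1))%sf (pairs n k)).

Lemma in_pairs m n i j : In (i, j) (pairs m n) <-> i < m /\ j < n.
Proof. unfold pairs. rewrite in_prod_iff, !in_seq. lia. Qed.

Lemma trz_big z (op : sform -> sform -> sform) e l :
  (forall A B, trz z A = tr A -> trz z B = tr B -> trz z (op A B) = tr (op A B)) ->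
  (trz z e = tr e \/ l <> []) -> (forall A, In A l -> trz z A = tr A) ->
  trz z (big op e l) = tr (big op e l).
Proof.
  intros Hop He. induction l as [|A [|B l] IH]; intros H.
  - destruct He as [He|[]]; [exact He|reflexivity].
  - apply H. now left.
  - change (trz z (op A (big op e (B :: l))) = tr (op A (big op e (B :: l)))).
    apply Hop; [apply H; now left|]. apply IH; [now right|].
    intros C HC. apply H. now right.
Qed.

Lemma trz_and z A B : trz z A = tr A -> trz z B = tr B -> trz z (SAnd A B) = tr (SAnd A B).
Proof. simpl. congruence. Qed.
Lemma trz_or z A B : trz z A = tr A -> trz z B = tr B -> trz z (SOr A B) = tr (SOr A B).
Proof. simpl. congruence. Qed.
Lemma trz_fus z A B : trz z A = tr A -> trz z B = tr B -> trz z (SFus A B) = tr (SFus A B).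
Proof. simpl. congruence. Qed.

Lemma map_nonempty {A B : Type} (f : A -> B) (l : list A) a : In a l -> map f l <> [].
Proof. now destruct l. Qed.

(* Zero occurs in [Theta_] only as an empty disjunction. *)
Lemma trz_Theta z n k : 1 <= k -> 1 <= n -> trz z (Theta_ n k) = tr (Theta_ n k).
Proof.
  intros Hk Hn.
  assert (E : forall (f : nat * nat -> sform) l, (forall a, In a l -> trz z (f a) = tr (f a)) ->
            trz z (bigSFus (map f l)) = tr (bigSFus (map f l))).
  { intros f l H. apply trz_big; [apply trz_fus|now left|].
    intros A HA. apply in_map_iff in HA as (a & <- & Ha). auto. }
  assert (F : forall {T : Type} (f : T -> sform) l, (forall a, In a l -> trz z (f a) = tr (f a)) ->
            trz z (bigSAnd (map f l)) = tr (bigSAnd (map f l))).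
  { intros T f l H. apply trz_big; [apply trz_and|now left|].
    intros A HA. apply in_map_iff in HA as (a & <- & Ha). auto. }
  assert (G : forall {T : Type} (f : T -> sform) l a, In a l ->
            (forall a, In a l -> trz z (f a) = tr (f a)) ->
            trz z (bigSOr (map f l)) = tr (bigSOr (map f l))).
  { intros T f l a Ha H. apply trz_big; [apply trz_or|right; eapply map_nonempty; eauto|].
    intros A HA. apply in_map_iff in HA as (b & <- & Hb). auto. }
  assert (Halpha : trz z (alpha n k) = tr (alpha n k)).
  { apply trz_or.
    - apply (G nat _ _ 0); [apply in_seq; lia|]. intros i _. now apply F.
    - apply (G _ _ _ (0, 0)); [apply in_pairs; lia|]. intros [i j] _.
      apply (G nat _ _ 0); [apply in_seq; lia|]. reflexivity. }
  assert (Hbeta : trz z (beta n (k + 1)) = tr (beta n (k + 1))).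
  { apply trz_or.
    - apply (G nat _ _ 0); [apply in_seq; lia|]. intros i _. now apply F.
    - apply (G _ _ _ (0, 0)); [apply in_pairs; lia|]. intros [i j] _.
      apply (G _ _ _ (0, 1)).
      + apply filter_In. split; [apply in_pairs; lia|reflexivity].
      + now intros [l m] _. }
  unfold Theta_. cbn [trz tr]. rewrite Halpha, Hbeta.
  f_equal; [|f_equal; f_equal]; apply E; now intros [i j] _.
Qed.

(** All q are true here, because the intended value of q, a non-edge, is not monotone in the graph;
    [graph_valuation] has the exact values. *)
Definition premise_valuation (x : graph) (y : var) : bool :=
  match y with vp i j => x i j | vq _ _ => true | _ => false end.

Definition graph_valuation (x : graph) (y : var) : bool :=
  match y with vp i j => x i j | vq i j => negb (x i j) | _ => false end.

Definition edge_choices (l : list (nat * nat)) : sform :=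
  bigSFus (map (fun '(i, j) => (p_ i j ∧ 1) ∨ (q_ i j ∧ 1))%sf l).

Lemma edge_choices_true (v : var -> bool) l :
  (forall i j, v (vp i j) || v (vq i j) = true) ->
  positive_eval v (tr (edge_choices l)) = true.
Proof.
  intros H. unfold edge_choices, bigSFus.
  induction l as [|[i j] [|b l] IH]; [reflexivity| |].
  - simpl. now rewrite !andb_true_r.
  - change (positive_eval v (tr ((p_ i j ∧ 1) ∨ (q_ i j ∧ 1))%sf) &&
      positive_eval v (tr (edge_choices (b :: l))) = true).
    rewrite (IH : positive_eval v (tr (edge_choices (b :: l))) = true).
    simpl. now rewrite !andb_true_r.
Qed.

(** As every q is true, all subformulas are constant except p_{i,j} and p_{i,j} ∧ 1. *)
Lemma edge_choices_inputs n l A :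
  (forall i j, In (i, j) l -> i < n /\ j < n) ->
  In A (subformulas (tr (edge_choices l))) ->
  (exists c, forall x, positive_eval (premise_valuation x) A = c) \/
  exists i j, i < n /\ j < n /\
    forall x, positive_eval (premise_valuation x) A = x i j.
Proof.
  intros HL.
  assert (H1 : forall i j, In (i, j) l ->
    In A (subformulas (tr ((p_ i j ∧ 1) ∨ (q_ i j ∧ 1))%sf)) ->
    (exists c, forall x, positive_eval (premise_valuation x) A = c) \/
    exists i j, i < n /\ j < n /\
      forall x, positive_eval (premise_valuation x) A = x i j).
  { intros i j Hij HA. apply HL in Hij as [Hi Hj]. simpl in HA.
    repeat destruct HA as [<-|HA]; try contradiction; simpl;
      try (left; exists true; intros x; now rewrite ?orb_true_r);
      right; exists i, j; repeat split; auto; intros x; now rewrite andb_true_r. }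
  clear HL. induction l as [|[i j] [|b l] IH].
  - intros [<-|[]]. left. now exists true.
  - apply H1. now left.
  - change (In A (subformulas (IAnd (tr ((p_ i j ∧ 1) ∨ (q_ i j ∧ 1))%sf)
      (tr (edge_choices (b :: l))))) ->
     (exists c, forall x, positive_eval (premise_valuation x) A = c) \/
     exists i j, i < n /\ j < n /\
       forall x, positive_eval (premise_valuation x) A = x i j).
    intros [<-|HA].
    + left. exists true. intros x.
      exact (edge_choices_true (premise_valuation x) ((i, j) :: b :: l)
        (fun i j => orb_true_r _)).
    + apply in_app_iff in HA as [HA|HA]; [apply (H1 i j); [now left|exact HA]|].
      apply IH; [|exact HA]. intros i' j' H. apply H1. now right.
Qed.

(** * Countervaluations to the two disjuncts *)

Section Evaluation.
Variables (g : iform -> bool) (b : var -> bool).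
Let ev (A : sform) : bool := leaf_eval g b (tr A).

Lemma eval_bigSOr l : ev (bigSOr l) = true -> exists A, In A l /\ ev A = true.
Proof.
  unfold bigSOr. induction l as [|A [|B l] IH]; [easy|eauto using in_eq|].
  intros H. apply orb_true_iff in H as [H|H]; [eauto using in_eq|].
  destruct (IH H) as (C & HC & HE). exists C. split; [now right|exact HE].
Qed.

Lemma eval_bigSAnd l : ev (bigSAnd l) = true -> forall A, In A l -> ev A = true.
Proof.
  unfold bigSAnd. induction l as [|A [|B l] IH]; [easy|now intros H C [<-|[]]|].
  intros H C HC. apply andb_true_iff in H as [H1 H2]. destruct HC as [<-|HC]; auto.
Qed.

Lemma eval_bigSFus l : (forall A, In A l -> ev A = true) -> ev (bigSFus l) = true.
Proof.
  unfold bigSFus. induction l as [|A [|B l] IH]; intros H; [reflexivity|apply H; now left|].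
  apply andb_true_iff. split; [apply H; now left|]. apply IH.
  intros C HC. apply H. now right.
Qed.

(** s_{i,l} says that vertex i has colour l, and s'_{i,l} is its negation; α then says that some
    vertex is uncoloured or some edge is monochromatic. *)
Lemma colouring_refutes n k (c : nat -> nat) :
  (forall i, i < n -> c i < k) ->
  (forall i l, b (vs i l) = (c i =? l)) -> (forall i l, b (vs' i l) = negb (c i =? l)) ->
  (forall i j, i < n -> j < n -> b (vp i j) = true -> c i <> c j) ->
  leaf_eval g b (IImp (tr (colour_choice n k)) (tr (alpha n k))) = false.
Proof.
  intros Hc Hs Hs' Hp.
  assert (H1 : ev (colour_choice n k) = true).
  { apply eval_bigSFus. intros A HA. apply in_map_iff in HA as ([i l] & <- & _).
    unfold ev. simpl. rewrite Hs, Hs'. now destruct (c i =? l). }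
  assert (H2 : ev (alpha n k) <> true).
  { intros H. apply orb_true_iff in H as [H|H]; apply eval_bigSOr in H as (A & HA & H).
    - apply in_map_iff in HA as (i & <- & Hi). apply in_seq in Hi.
      apply eval_bigSAnd with (A := s'_ i (c i)) in H.
      + unfold ev in H. simpl in H. now rewrite Hs', Nat.eqb_refl in H.
      + apply in_map_iff. exists (c i). split; [reflexivity|].
        apply in_seq. specialize (Hc i). lia.
    - apply in_map_iff in HA as ([i j] & <- & Hij). apply in_pairs in Hij as [Hi Hj].
      apply eval_bigSOr in H as (A & HA & H). apply in_map_iff in HA as (l & <- & _).
      unfold ev in H. simpl in H. rewrite !andb_true_iff, !Hs, !Nat.eqb_eq in H.
      apply (Hp i j); try tauto. destruct H as (-> & -> & _). reflexivity. }
  apply not_true_is_false. intros H. simpl in H. apply andb_true_iff in H as [_ H].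
  rewrite implb_true_iff in H. auto.
Qed.

(** r_{i,l} says that i is the l-th vertex of the clique; β then says that some place is unfilled or
    some pair is a non-edge. *)
Lemma clique_refutes n k (h : nat -> nat) :
  (forall l, l < k -> h l < n) ->
  (forall i l, b (vr i l) = (h l =? i)) -> (forall i l, b (vr' i l) = negb (h l =? i)) ->
  (forall l m, l < m -> m < k -> b (vq (h l) (h m)) = false) ->
  leaf_eval g b (IImp (tr (clique_choice n k)) (tr (beta n k))) = false.
Proof.
  intros Hh Hr Hr' Hq.
  assert (H1 : ev (clique_choice n k) = true).
  { apply eval_bigSFus. intros A HA. apply in_map_iff in HA as ([i l] & <- & _).
    unfold ev. simpl. rewrite Hr, Hr'. now destruct (h l =? i). }
  assert (H2 : ev (beta n k) <> true).
  { intros H. apply orb_true_iff in H as [H|H]; apply eval_bigSOr in H as (A & HA & H).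
    - apply in_map_iff in HA as (l & <- & Hl). apply in_seq in Hl.
      apply eval_bigSAnd with (A := r'_ (h l) l) in H.
      + unfold ev in H. simpl in H. now rewrite Hr', Nat.eqb_refl in H.
      + apply in_map_iff. exists (h l). split; [reflexivity|].
        apply in_seq. specialize (Hh l). lia.
    - apply in_map_iff in HA as ([i j] & <- & Hij).
      apply eval_bigSOr in H as (A & HA & H). apply in_map_iff in HA as ([l m] & <- & Hlm).
      apply filter_In in Hlm as [Hlm Hl]. apply Nat.ltb_lt in Hl.
      apply in_pairs in Hlm as [_ Hm].
      unfold ev in H. simpl in H. rewrite !andb_true_iff, !Hr, !Nat.eqb_eq in H.
      destruct H as (<- & <- & H). rewrite Hq in H; [discriminate|exact Hl|exact Hm]. }
  apply not_true_is_false. intros H. simpl in H. apply andb_true_iff in H as [_ H].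
  rewrite implb_true_iff in H. auto.
Qed.
End Evaluation.

(** A clique refutes the second disjunct above [graph_valuation], so [f] accepts; a colouring
    refutes the first one above [premise_valuation], so [f] rejects. The false q-values are needed
    only for the clique. *)
Lemma Theta_lines m (rs : list (frule Limp)) : (forall r, In r rs -> valid_rule m r) ->
  exists c, forall n r (pi : list iform), 2 <= r -> 16 * (r * r) <= Nat.sqrt n ->
    is_proof (F := Limp) (fun r => In r rs) nothing pi (tr (Theta n)) ->
    2 ^ S r <= c * (length pi + 1) ^ 3.
Proof.
  intros Hrs. destruct (interpolant m rs Hrs) as (c & Hc). exists c.
  intros n r pi Hr Hk Hpi. set (k := Nat.sqrt n) in *.
  destruct (Hc n pi (tr (edge_choices (pairs n n))) (tr (colour_choice n k)) (tr (alpha n k))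
    (tr (clique_choice n (k + 1))) (tr (beta n (k + 1))) premise_valuation graph_valuation)
    as (l & f & Hl & Hf & Ll & H).
  - intros x []; simpl; auto.
  - intros A. apply edge_choices_inputs. intros i j. apply in_pairs.
  - intros x. apply edge_choices_true. intros i j. apply orb_negb_r.
  - exact Hpi.
  - etransitivity; [|exact Ll].
    apply (@CliqueColouring.circuit_lower_bound n k r l f); auto.
    (* 8r²(k+1) <= 16r²k <= k² <= n. *)
    + pose proof (Nat.sqrt_spec n (Nat.le_0_l n)) as [Hn _]. fold k in Hn. nia.
    + intros x (h & Hh & Hx). specialize (H x). destruct (f x); [reflexivity|exfalso].
      set (b := fun y => match y with
                         | vr i l => h l =? i
                         | vr' i l => negb (h l =? i)
                         | _ => graph_valuation x y
                         end).
      assert (HB := H b). rewrite (clique_refutes _ b n (k + 1) h) in HB;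
        try reflexivity.
      * discriminate HB. intros []; simpl; easy.
      * intros l' Hl'. apply Hh. lia.
      * intros l' m' Hl' Hm'. simpl. rewrite Hx; [reflexivity|exact Hl'|lia].
    + intros x (col & Hcol & Hx). specialize (H x). destruct (f x); [exfalso|reflexivity].
      set (b := fun y => match y with
                         | vs i l => col i =? l
                         | vs' i l => negb (col i =? l)
                         | _ => premise_valuation x y
                         end).
      assert (HB := H b). rewrite (colouring_refutes _ b n k col) in HB; auto.
      discriminate HB. intros []; simpl; easy.
Qed.

(** * Numerical estimates *)

Lemma quartic_root_bound n : let r := Nat.sqrt (Nat.sqrt n) / 4 in
  16 * (r * r) <= Nat.sqrt n /\ n < 256 * ((r + 1) * (r + 1) * ((r + 1) * (r + 1))).
Proof.
  intros r. set (k := Nat.sqrt n). set (q := Nat.sqrt k).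
  pose proof (Nat.sqrt_spec n (Nat.le_0_l n)) as [Hn1 Hn2]. fold k in Hn1, Hn2.
  pose proof (Nat.sqrt_spec k (Nat.le_0_l k)) as [Hk1 Hk2]. fold q in Hk1, Hk2.
  assert (H1 : 4 * r <= q) by apply Nat.Div0.mul_div_le.
  assert (H2 : q < 4 * (r + 1)).
  { unfold r. fold k q. rewrite Nat.add_1_r. apply Nat.mul_succ_div_gt. lia. }
  split; [nia|]. assert (H3 : k + 1 <= 16 * ((r + 1) * (r + 1))) by nia.
  assert (n < (k + 1) * (k + 1)) by nia. nia.
Qed.

Section Growth.
Local Open Scope R_scope.

Lemma INR_le_pow2 c : INR c <= 2 ^ c.
Proof.
  induction c as [|c IH]; [simpl; lra|]. rewrite S_INR. simpl.
  assert (1 <= 2 ^ c) by (apply pow_R1_Rle; lra). lra.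
Qed.

(** With r about n^(1/4)/4, the number y = n^(1/8) satisfies y² < 4(r+1). If L < 2^y, the bound
    gives r + 1 <= c + 3(y+1), which is linear in y and impossible once y >= c + 24; this determines
    [N]. *)
Lemma exponential_growth c : exists N : nat, forall n L : nat, (N <= n)%nat ->
  (forall r, (2 <= r)%nat -> (16 * (r * r) <= Nat.sqrt n)%nat ->
     (2 ^ S r <= c * (L + 1) ^ 3)%nat) ->
  Rpower 2 (Rpower (INR n) (1 / 8)) <= INR L.
Proof.
  exists ((c + 24) ^ 8)%nat. intros n L HN H.
  destruct (quartic_root_bound n) as [H1 H2]. set (r := (Nat.sqrt (Nat.sqrt n) / 4)%nat) in *.
  assert (Hpos : 0 < INR (c + 24)) by (apply lt_0_INR; lia).
  assert (HNR : INR (c + 24) ^ 8 <= INR n).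
  { rewrite <- pow_INR. now apply le_INR. }
  assert (Hn : 0 < INR n) by (pose proof (pow_lt _ 8 Hpos); lra).
  set (y := Rpower (INR n) (1 / 8)).
  assert (Hy : y ^ 8 = INR n).
  { unfold y. rewrite <- Rpower_pow by apply exp_pos. rewrite Rpower_mult.
    replace (1 / 8 * INR 8) with 1 by (simpl; lra). now apply Rpower_1. }
  assert (Hy0 : 0 < y) by apply exp_pos.
  assert (Hyc : INR c + 24 <= y).
  { replace (INR c + 24) with (INR (c + 24)) by (rewrite plus_INR; simpl; lra).
    unfold y. transitivity (Rpower (INR (c + 24) ^ 8) (1 / 8)).
    - rewrite <- Rpower_pow, Rpower_mult by exact Hpos.
      replace (INR 8 * (1 / 8)) with 1 by (simpl; lra). rewrite Rpower_1; lra.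
    - apply Rle_Rpower_l; [lra|]. split; [now apply pow_lt|exact HNR]. }
  assert (Hc : 0 <= INR c) by apply pos_INR.
  assert (Hr : y * y < 4 * (INR r + 1)).
  { apply lt_INR in H2. rewrite !mult_INR, plus_INR in H2.
    replace (INR 256) with 256 in H2 by (simpl; lra). simpl (INR 1) in H2.
    rewrite <- Hy in H2. assert (Hr0 := pos_INR r).
    apply Rnot_le_lt. intros F. set (s := INR r + 1) in *.
    assert (F2 : (4 * s) * (4 * s) <= (y * y) * (y * y)) by (apply Rmult_le_compat; unfold s in *; lra).
    assert (F3 : ((4 * s) * (4 * s)) * ((4 * s) * (4 * s)) <= ((y * y) * (y * y)) * ((y * y) * (y * y))).
    { apply Rmult_le_compat; try exact F2; apply Rmult_le_pos; unfold s in *; lra. }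
    simpl in H2. nra. }
  apply Rnot_lt_le. intros F. fold y in F.
  assert (H2r : (2 <= r)%nat).
  { apply INR_le. replace (INR 2) with 2 by (simpl; lra). nra. }
  specialize (H r H2r H1). apply le_INR in H.
  rewrite mult_INR, !pow_INR, plus_INR in H. replace (INR 2) with 2 in H by (simpl; lra).
  simpl (INR 1) in H.
  assert (E1 : 1 <= Rpower 2 y).
  { rewrite <- (Rpower_O 2) by lra. apply Rle_Rpower; lra. }
  assert (E2 : INR L + 1 <= Rpower 2 (y + 1)).
  { rewrite Rpower_plus, Rpower_1 by lra. lra. }
  assert (E3 : (INR L + 1) ^ 3 <= Rpower 2 (3 * (y + 1))).
  { replace (3 * (y + 1)) with ((y + 1) * INR 3) by (simpl; lra).
    rewrite <- Rpower_mult, Rpower_pow by apply exp_pos.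
    apply pow_incr. split; [|exact E2]. pose proof (pos_INR L). lra. }
  assert (E4 : INR c <= Rpower 2 (INR c)).
  { rewrite Rpower_pow by lra. apply INR_le_pow2. }
  assert (E5 : 2 ^ S r <= Rpower 2 (INR c + 3 * (y + 1))).
  { rewrite Rpower_plus. etransitivity; [exact H|]. apply Rmult_le_compat; auto.
    apply pow_le. pose proof (pos_INR L). lra. }
  rewrite <- Rpower_pow, S_INR in E5 by lra.
  assert (E6 : INR r + 1 <= INR c + 3 * (y + 1)).
  { apply Rnot_lt_le. intros G. apply (Rpower_lt 2) in G; lra. }
  nra.
Qed.

Lemma ext_proof_exponential m (rs : list (frule Limp)) :
  (forall r, In r rs -> valid_rule m r) ->
  exists N : nat, forall (n : nat) (pi : list iform), (N <= n)%nat ->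
    is_ext_proof (F := Limp) (fun r => In r rs) nothing pi (tr (Theta n)) ->
    Rpower 2 (Rpower (INR n) (1 / 8)) <= INR (length pi).
Proof.
  intros Hrs. destruct (Theta_lines m (extension_rule :: rs)) as (c & Hc).
  { intros r [<-|Hr]; [apply extension_rule_valid|auto]. }
  destruct (exponential_growth c) as (N & HN). exists N. intros n pi Hn Hpi.
  apply HN; [exact Hn|]. intros r H2 Hr.
  destruct (extension_elimination rs pi _ Hpi) as (pi' & <- & Hpi').
  now apply (Hc n r pi').
Qed.

Lemma lines_le_symbols {F : language} (pi : list F) :
  (forall A : F, (1 <= size A)%nat) -> (lines pi <= symbols pi)%nat.
Proof.
  intros H. unfold lines, symbols. induction pi as [|A pi IH]; simpl; [lia|].
  specialize (H A). lia.
Qed.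

(** Frege proofs are extended Frege proofs, and lines never outnumber symbols, so counting lines of
    extended proofs covers both claims. *)
Lemma exponential_lines_symbols {F : language} (P : inference_system F)
    (Phi : nat -> F) (N : nat) :
  (forall A : F, (1 <= size A)%nat) ->
  (forall n (pi : list F), (N <= n)%nat -> is_ext_proof P nothing pi (Phi n) ->
     Rpower 2 (Rpower (INR n) (1 / 8)) <= INR (length pi)) ->
  exponential (fun n pi => is_proof P nothing pi (Phi n)) lines /\
  exponential (fun n pi => is_ext_proof P nothing pi (Phi n)) symbols.
Proof.
  intros Hs H. split; exists (1 / 8); (split; [lra|]); exists N; intros n pi Hn Hpi.
  - apply H; [exact Hn|]. now apply proof_is_ext_proof.
  - eapply Rle_trans; [exact (H n pi Hn Hpi)|]. apply le_INR. now apply lines_le_symbols.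
Qed.

End Growth.

(** The deduction theorem turns the rule into a theorem, a nested implication, and modus ponens
    holds at the root. *)
Lemma vd_rule_valid vd m (r : frule Limp) : super_intuitionistic vd ->
  (forall A, vd nothing A -> forall t K v, is_model m t K v -> forces m t K v A) ->
  vd (elems (fprems r)) (fconcl r) -> valid_rule m r.
Proof.
  intros Hvd Hm Hr t K v HM.
  assert (G : forall l A, vd (elems l) A -> (forall B, In B l -> forces m t K v B) ->
            forces m t K v A).
  { induction l as [|B l IH]; intros A HA HB.
    - apply Hm; [|exact HM]. apply (vd_mono _ Hvd (elems [])); [now intros C []|exact HA].
    - assert (HI : forces m t K v (IImp B A)).
      { apply IH; [|intros C HC; apply HB; now right]. apply (vd_imp _ Hvd).
        apply (vd_mono _ Hvd (elems (B :: l))); [|exact HA].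
        intros C [<-|HC]; [now right|now left]. }
      unfold forces in *. simpl in HI. apply andb_true_iff in HI as [_ HI].
      rewrite implb_true_iff in HI. apply HI, HB. now left. }
  now apply G.
Qed.

Theorem corollary5p3 :
  (forall C : calculus, listed C ->
   forall P : inference_system Lstar, frege (substructural C) P ->
     exponential (fun n pi => is_proof P nothing pi (Theta n)) lines /\
     exponential (fun n pi => is_ext_proof P nothing pi (Theta n)) symbols)
  /\
  (forall L : logic Limp, L = BPC \/ L = EBPC ->
   forall vd : consequence Limp,
     super_intuitionistic vd ->
     infinite_branching (logic_of vd) ->
     (exists Q : inference_system Limp, frege (logic_of vd) Q) ->
   forall P : inference_system Limp, frege_wrt L (logic_of vd) P ->
     exponential (fun n pi => is_proof P nothing pi (tr (Theta n))) lines /\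
     exponential (fun n pi => is_ext_proof P nothing pi (tr (Theta n))) symbols).
Proof.
  split.
  - intros C HC P ((rs & Hrs) & _ & _ & HP).
    destruct (listed_sound C HC) as (z & Hz).
    destruct (ext_proof_exponential true (map (translated_rule z) rs)) as (N & HN).
    { intros r Hr. apply in_map_iff in Hr as (r' & <- & Hr).
      apply (substructural_rule_valid C); [exact Hz|]. now apply HP, Hrs. }
    (* n >= 1 gives k >= 1, so no empty disjunction puts a 0 into [Theta n]. *)
    apply (exponential_lines_symbols (F := Lstar) P Theta (max N 1)).
    { intros []; simpl; lia. }
    intros n pi Hn Hpi. rewrite <- (length_map (trz z)). apply HN; [lia|].
    unfold Theta. rewrite <- (trz_Theta z) by
      (try apply Nat.sqrt_le_square; simpl; lia).
    eapply ext_proof_translation; [|exact Hpi]. intros r. apply Hrs.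
  - intros L _ vd Hvd Hbr _ P ((rs & Hrs) & _ & _ & HP).
    destruct (branching_dichotomy vd Hvd Hbr) as (m & Hm).
    destruct (ext_proof_exponential m rs) as (N & HN).
    { intros r Hr. apply (vd_rule_valid vd); [exact Hvd|exact Hm|]. now apply HP, Hrs. }
    apply (exponential_lines_symbols (F := Limp) P (fun n => tr (Theta n)) N).
    { intros []; simpl; lia. }
    intros n pi Hn [Hend Hpi]. apply HN; [exact Hn|]. split; [exact Hend|].
    intros l A l' E. destruct (Hpi l A l' E) as [[]|[(r & sigma & Hr & H)|H]]; auto.
    right. left. exists r, sigma. split; [now apply Hrs|exact H].
Qed.
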